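(* Let $\mathbf{c}=(c_1,\dots,c_n)$ and $\bar{\mathbf{c}}=(\bar c_1,\dots,\bar c_n)$ be renormalized solutions of the Maxwell--Stefan system on $\mathbb{T}^3\times(0,\infty)$ (with velocities $u_i$ and $\bar u_i$, respectively) emanating from the same initial data. Then for any $T>0$ and any $\beta\in C^2([0,\infty))$, $$\sum_{i=1}^n\int_{\mathbb{T}^3}\big(\beta(c_i)-\beta(\bar c_i)\big)(c_i-\bar c_i)\,dx\Big|_{t=T}=\sum_{i=1}^n\int_0^T\!\!\int_{\mathbb{T}^3}\nabla\big(\beta(c_i)-\beta(\bar c_i)\big)\cdot(c_iu_i-\bar c_i\bar u_i)\,dx\,dt$$ $$\qquad+\sum_{i=1}^n\int_0^T\!\!\int_{\mathbb{T}^3}\Big(\nabla\big[(c_i-\bar c_i)\beta'(c_i)\big]\cdot c_iu_i-\nabla\big[(c_i-\bar c_i)\beta'(\bar c_i)\big]\cdot\bar c_i\bar u_i\Big)\,dx\,dt.$$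
   Context: $\mathbb{T}^3$ is the 3-dimensional torus, $n\ge 2$, and $D_{ij}=D_{ji}>0$ ($i\neq j$) are given constants. The Maxwell--Stefan system for concentrations $\mathbf{c}=(c_1,\dots,c_n)$ and velocities $u_i(x,t)\in\mathbb{R}^3$, with fluxes $J_i=c_iu_i$, is $$\partial_t c_i+\nabla\cdot(c_iu_i)=0,\qquad i=1,\dots,n,$$ together with the constrained linear system $$-\sum_{j\neq i}\frac{c_jJ_i-c_iJ_j}{D_{ij}}=\nabla c_i\quad (i=1,\dots,n),\qquad \sum_{i=1}^nJ_i=0, \qquad (\ast)$$ and initial conditions $c_i(x,0)=c_i^0(x)$. The initial data always satisfy $0\le c_i^0\in L^\infty(\mathbb{T}^3)$, $\sum_{i=1}^nc_i^0=1$, and $H(\mathbf{c}^0)=\int_{\mathbb{T}^3}\sum_ic_i^0(\ln c_i^0-1)\,dx<+\infty$. Renormalized solution: $\mathbf{c}$ (with velocities $u_i$) is a renormalized solution with initial data $\mathbf{c}^0$ if for all $i$: (i) $0\le c_i\le1$ and $\sum_ic_i=1$; (ii) $\nabla\sqrt{c_i}\in L^2(\mathbb{T}^3\times(0,T))$ and $\sqrt{c_i}\,u_i\in L^2(\mathbb{T}^3\times(0,T))$ for every $T>0$; (iii) for every $\phi_i\in C_c^\infty(\mathbb{T}^3\times[0,\infty))$ and every $\beta\in C^2([0,\infty))$, $$\int_{\mathbb{T}^3}\beta(c_i^0)\phi_i(x,0)\,dx+\int_0^\infty\!\!\int_{\mathbb{T}^3}\beta(c_i)\partial_t\phi_i\,dx\,dt+\int_0^\infty\!\!\int_{\mathbb{T}^3}\sqrt{c_i}\,\beta'(c_i)\sqrt{c_i}\,u_i\cdot\nabla\phi_i\,dx\,dt+2\int_0^\infty\!\!\int_{\mathbb{T}^3}c_i\beta''(c_i)\nabla\sqrt{c_i}\cdot\sqrt{c_i}\,u_i\,\phi_i\,dx\,dt=0,$$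 and $J_i=c_iu_i$ satisfies $(\ast)$; (iv) $\lim_{t\to0}\int_{\mathbb{T}^3}|\beta(c_i(x,t))-\beta(c_i^0(x))|\,dx=0$ for every $\beta\in C^2([0,\infty))$. Solutions are identified with their representatives in $C([0,\infty);L^2(\mathbb{T}^3))$, so that values at time $t=T$ make sense. *)

(* Defs.v *)
From HB Require Import structures.
From mathcomp Require Import all_boot all_order all_algebra.
From mathcomp Require Import all_classical all_reals all_analysis.

Set Implicit Arguments.
Unset Strict Implicit.
Unset Printing Implicit Defensive.

Import Order.TTheory GRing.Theory Num.Theory.
Import numFieldNormedType.Exports.

Local Open Scope classical_set_scope.
Local Open Scope ring_scope.

(* The torus T^3 is R^3/Z^3, represented by its fundamental domain [0,1[^3 with
   Lebesgue measure.  A (class of) measurable function on T^3, or on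
   T^3 x (0,oo), is given by its values on [0,1[^3, resp. [0,1[^3 x (0,oo);
   values elsewhere are never used.  Only the smooth test functions, whose
   differentiability sees the gluing of the faces, are required to be
   Z^3-periodic on R^3.  A point of space-time is
   z = (x, t) : R * R * R * R with x : R * R * R. *)

(* Restated because, for products, the library's canonical sigma-finite
   structure is shadowed by the one for sub-probabilities. *)
Lemma product_sigma_finite d1 d2 (T1 : measurableType d1)
    (T2 : measurableType d2) (R : realType)
    (m1 : {sigma_finite_measure set T1 -> \bar R})
    (m2 : {sigma_finite_measure set T2 -> \bar R}) :
  sigma_finite setT (m1 \x m2)%E.
Proof.
have /sigma_finiteP[F [TF ndF Foo]] := sigma_finiteT m1.
have /sigma_finiteP[G [TG ndG Goo]] := sigma_finiteT m2.
exists (fun n => F n `*` G n).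
  rewrite -setXTT TF TG predeqE => -[x y]; split.
    move=> [/= [n _ Fnx] [k _ Gky]]; exists (maxn n k) => //; split.
    - by move: x Fnx; exact/subsetPset/ndF/leq_maxl.
    - by move: y Gky; exact/subsetPset/ndG/leq_maxr.
  by move=> [n _ []/= ? ?]; split; exists n.
move=> k; have [? ?] := Foo k; have [? ?] := Goo k.
split; first exact: measurableX.
by rewrite product_measure1E// lte_mul_pinfty// ge0_fin_numE.
Qed.

Section LebesgueMeasures.
Variable R : realType.
Let mR := measurableTypeR R.

Definition leb2 : set (mR * mR) -> \bar R :=
  (@lebesgue_measure R \x @lebesgue_measure R)%E.
HB.instance Definition _ := Measure.on leb2.
HB.instance Definition _ := Measure_isSigmaFinite.Build _ _ _ leb2
  (product_sigma_finite _ _).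

Definition leb3 : set (mR * mR * mR) -> \bar R :=
  (leb2 \x @lebesgue_measure R)%E.
HB.instance Definition _ := Measure.on leb3.
HB.instance Definition _ := Measure_isSigmaFinite.Build _ _ _ leb3
  (product_sigma_finite _ _).

Definition leb4 : set (mR * mR * mR * mR) -> \bar R :=
  (leb3 \x @lebesgue_measure R)%E.
HB.instance Definition _ := Measure.on leb4.
HB.instance Definition _ := Measure_isSigmaFinite.Build _ _ _ leb4
  (product_sigma_finite _ _).

End LebesgueMeasures.
Arguments leb2 : clear implicits.
Arguments leb3 : clear implicits.
Arguments leb4 : clear implicits.

Section Domains.
Variable R : realType.

Definition torus : set (R * R * R) :=
  `[0, 1[%classic `*` `[0, 1[%classic `*` `[0, 1[%classic.

Definition cylinder (T : R) : set (R * R * R * R) := torus `*` `]0, T[%classic.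

Definition cylinder_oo : set (R * R * R * R) := torus `*` `]0, +oo[%classic.

End Domains.
Arguments torus : clear implicits.
Arguments cylinder_oo : clear implicits.

(* The sigma-algebra on R is the Borel one; Lebesgue measurability on D is
   measurability up to a.e. equality on D.  Extension by 0 shows that every
   element of L^p(D) is the restriction of an element of L^p. *)
Definition in_Lp {d : measure_display} {T : measurableType d} {R : realType}
    (mu : {measure set T -> \bar R}) (p : \bar R) (D : set T) (f : T -> R) : Prop :=
  exists2 g : T -> R, g \in Lfun mu p & f = g %[ae mu in D].

Section TestFunctions.
Variable R : realType.

Fixpoint class_C (V : normedModType R) (m : nat) (f : V -> R) : Prop :=
  continuous f /\
  (if m is m'.+1 then
     forall v : V, (forall z, derivable f z v) /\ class_C m' ('D_v f)
   else True).

Definition smooth (V : normedModType R) (f : V -> R) : Prop :=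
  forall m, class_C m f.

Definition basis3 (k : 'I_3) : R * R * R :=
  ((k == 0 :> nat)%:R, (k == 1 :> nat)%:R, (k == 2 :> nat)%:R).

Definition space_periodic (phi : R * R * R * R -> R) : Prop :=
  forall (k : 'I_3) (x : R * R * R) (t : R), phi (x + basis3 k, t) = phi (x, t).

(* C_c^oo(T^3 x [0,oo)): restrictions to t >= 0 of smooth functions on
   T^3 x R vanishing for large t. *)
Definition test_fun (phi : R * R * R * R -> R) : Prop :=
  [/\ smooth phi, space_periodic phi &
      exists M : R, forall x t, M <= t -> phi (x, t) = 0].

(* C_c^oo(T^3 x (0,oo)) *)
Definition test_fun_interior (phi : R * R * R * R -> R) : Prop :=
  test_fun phi /\ exists2 a : R, 0 < a & forall x t, t <= a -> phi (x, t) = 0.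

Definition time_deriv (phi : R * R * R * R -> R) (z : R * R * R * R) : R :=
  'D_((0, 1) : R * R * R * R) phi z.

Definition space_deriv (k : 'I_3) (phi : R * R * R * R -> R)
    (z : R * R * R * R) : R :=
  'D_((basis3 k, 0) : R * R * R * R) phi z.

Definition space_grad (phi : R * R * R * R -> R) (z : R * R * R * R) :
    'rV[R]_3 :=
  \row_k space_deriv k phi z.

Definition dot (v w : 'rV[R]_3) : R := \sum_(k < 3) v 0 k * w 0 k.

End TestFunctions.

Section WeakGradient.
Variable R : realType.

Definition is_weak_deriv (k : 'I_3) (f g : R * R * R * R -> R) : Prop :=
  (forall a b : R, 0 < a ->
     in_Lp (leb4 R) 1%E (torus R `*` `[a, b]%classic) f /\
     in_Lp (leb4 R) 1%E (torus R `*` `[a, b]%classic) g) /\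
  (forall phi, test_fun_interior phi ->
     \int[leb4 R]_(z in cylinder_oo R) (f z * space_deriv k phi z) =
     - \int[leb4 R]_(z in cylinder_oo R) (g z * phi z)).

Definition weakly_differentiable (f : R * R * R * R -> R) : Prop :=
  forall k, exists g, is_weak_deriv k f g.

(* A choice of representative, unique up to a.e. equality on T^3 x (0,oo)
   when f is weakly differentiable, and 0 by convention otherwise. *)
Definition weak_deriv (k : 'I_3) (f : R * R * R * R -> R) :
    R * R * R * R -> R :=
  xget (cst 0) [set g | is_weak_deriv k f g].

Definition weak_grad (f : R * R * R * R -> R) (z : R * R * R * R) : 'rV[R]_3 :=
  \row_k weak_deriv k f z.

Definition in_L2_vec (D : set (R * R * R * R)) (v : R * R * R * R -> 'rV[R]_3) :
    Prop :=
  forall k, in_Lp (leb4 R) 2%:E D (fun z => v z 0 k).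

End WeakGradient.

Section HalfLine.
Variable R : realType.

(* Derivative relative to [0,oo): two-sided for x > 0, one-sided at 0; the
   values of f on the negative half-line are never used. *)
Definition diff_quot (f : R -> R) (x : R) : set_system R :=
  (f y - f x) / (y - x) @[y --> within `[0, +oo[%classic x^'].

Definition half_deriv (f : R -> R) (x : R) : R := lim (diff_quot f x).

Definition C1_half (f : R -> R) : Prop :=
  (forall x, 0 <= x -> cvg (diff_quot f x)) /\
  {within `[0, +oo[%classic, continuous (half_deriv f)}.

Definition C2_half (f : R -> R) : Prop := C1_half f /\ C1_half (half_deriv f).

End HalfLine.

Section MaxwellStefan.
Variables (R : realType) (n : nat).

Definition diffusivities (D : 'I_n -> 'I_n -> R) : Prop :=
  forall i j, i != j -> D i j = D j i /\ 0 < D i j.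

(* In the entropy, ln 0 = 0, so that 0 (ln 0 - 1) = 0 as usual. *)
Definition initial_data (c0 : 'I_n -> R * R * R -> R) : Prop :=
  [/\ forall i, in_Lp (leb3 R) +oo%E (torus R) (c0 i),
      forall i, {ae leb3 R, forall x, torus R x -> 0 <= c0 i x},
      {ae leb3 R, forall x, torus R x -> \sum_(i < n) c0 i x = 1} &
      (\int[leb3 R]_(x in torus R)
         (\sum_(i < n) c0 i x * (ln (c0 i x) - 1))%:E < +oo)%E].

Definition flux (c : 'I_n -> R * R * R * R -> R)
    (u : 'I_n -> R * R * R * R -> 'rV[R]_3) (i : 'I_n) (z : R * R * R * R) :
    'rV[R]_3 :=
  c i z *: u i z.

Definition flux_system (D : 'I_n -> 'I_n -> R)
    (c : 'I_n -> R * R * R * R -> R)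
    (J : 'I_n -> R * R * R * R -> 'rV[R]_3) : Prop :=
  (forall i, weakly_differentiable (c i) /\
     {ae leb4 R, forall z, cylinder_oo R z ->
       - (\sum_(j < n | j != i)
            (D i j)^-1 *: (c j z *: J i z - c i z *: J j z)) =
       weak_grad (c i) z}) /\
  {ae leb4 R, forall z, cylinder_oo R z -> \sum_(i < n) J i z = 0}.

Definition renormalized_equation (c0 : R * R * R -> R)
    (c : R * R * R * R -> R) (u : R * R * R * R -> 'rV[R]_3)
    (beta : R -> R) (phi : R * R * R * R -> R) : Prop :=
  let beta' := half_deriv beta in
  let beta'' := half_deriv beta' in
  \int[leb3 R]_(x in torus R) (beta (c0 x) * phi (x, 0))
  + \int[leb4 R]_(z in cylinder_oo R) (beta (c z) * time_deriv phi z)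
  + \int[leb4 R]_(z in cylinder_oo R)
      (Num.sqrt (c z) * beta' (c z)
       * dot (Num.sqrt (c z) *: u z) (space_grad phi z))
  + 2 * \int[leb4 R]_(z in cylinder_oo R)
      (c z * beta'' (c z)
       * dot (weak_grad (fun w => Num.sqrt (c w)) z) (Num.sqrt (c z) *: u z)
       * phi z)
  = 0.

Definition renormalized_solution (D : 'I_n -> 'I_n -> R)
    (c0 : 'I_n -> R * R * R -> R) (c : 'I_n -> R * R * R * R -> R)
    (u : 'I_n -> R * R * R * R -> 'rV[R]_3) : Prop :=
  [/\ (forall i, in_Lp (leb4 R) +oo%E (cylinder_oo R) (c i) /\
         {ae leb4 R, forall z, cylinder_oo R z -> 0 <= c i z <= 1}) /\
      {ae leb4 R, forall z, cylinder_oo R z -> \sum_(i < n) c i z = 1},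
      forall i, weakly_differentiable (fun z => Num.sqrt (c i z)) /\
        (forall T : R, 0 < T ->
           in_L2_vec (cylinder T) (weak_grad (fun z => Num.sqrt (c i z))) /\
           in_L2_vec (cylinder T) (fun z => Num.sqrt (c i z) *: u i z)),
      (forall i (phi : R * R * R * R -> R) (beta : R -> R),
         test_fun phi -> C2_half beta ->
         renormalized_equation (c0 i) (c i) (u i) beta phi) /\
      flux_system D c (flux c u) &
      forall i (beta : R -> R), C2_half beta ->
        \int[leb3 R]_(x in torus R) `|beta (c i (x, t)) - beta (c0 i x)|
          @[t --> 0^'+] --> (0 : R)].

(* c is the representative in C([0,oo); L^2(T^3)). *)
Definition L2_continuous_in_time (c : 'I_n -> R * R * R * R -> R) : Prop :=
  forall (i : 'I_n) (t : R), 0 <= t ->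
    in_Lp (leb3 R) 2%:E (torus R) (fun x => c i (x, t)) /\
    (\int[leb3 R]_(x in torus R) (c i (x, s) - c i (x, t)) ^+ 2
       @[s --> within `[0, +oo[%classic (nbhs t)] --> (0 : R)).

End MaxwellStefan.

(* Main.v *)
From HB Require Import structures.
From mathcomp Require Import all_boot all_order all_algebra.
From mathcomp Require Import all_classical all_reals all_analysis.
From mathcomp Require Import measurable_realfun ring lra.

Require Import Defs.

Set Implicit Arguments.
Unset Strict Implicit.
Unset Printing Implicit Defensive.

Import Order.TTheory GRing.Theory Num.Theory.
Import numFieldNormedType.Exports.

Local Open Scope classical_set_scope.
Local Open Scope ring_scope.

(** Fix one species, with densities c and d, fluxes J and K, and write
    Phi(a, b) = (beta(a) - beta(b)) (a - b). If everything were smooth, the time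
    derivative of Phi(c, d) would be - Phi_1(c, d) div J - Phi_2(c, d) div K, and
    an integration by parts in space would give the integral of
    grad (Phi_1(c, d)) . J + grad (Phi_2(c, d)) . K. Now Phi_1 = f + g and
    Phi_2 = - (f + h), where f(a, b) = beta(a) - beta(b),
    g(a, b) = (a - b) beta'(a) and h(a, b) = (a - b) beta'(b)
    ([C1pair_product]); grouping the terms gives exactly the right-hand side of
    the identity. At time 0 the integrand Phi(c, d) vanishes, because the
    solutions have the same initial data.

    To make this rigorous it is enough to know the equation renormalized by the
    identity, that is the weak continuity equation for c with flux J, and that
    the gradient of c is square integrable. The latter follows from the linear
    system of the fluxes: grad c_i is a combination of the products c_j J_i, whose
    factors are bounded, respectively square integrable ([gradient_rep]).

    The densities are regularized in space only, by averaging against a smooth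
    periodic kernel on the torus, built from the function exp(-1/x) and a cosine
    ([kap_mollifier], [tor_mollifier]). At every point x the average of c solves
    an ordinary differential equation in time, whose right-hand side is minus the
    averaged divergence of J ([wf_ode]); testing with functions of time that fall
    from 1 to 0 just before T, and continuity in time, give the value at T
    ([weak_time_derivative]). The averages are absolutely continuous in time, so
    the chain rule of the first paragraph holds for them ([chain_time]). They are
    continuously differentiable in space, and their gradient is the average of
    the weak gradient ([wg_avg_deriv]), so the integration by parts is legitimate
    ([avg_flow_identity], [avg_chain_rule]).

    Then the regularization is removed. Averages of gradients and of fluxes
    converge in the mean square, so their products converge in the mean, and the
    continuous functions of the averaged densities in front of them are bounded
    and converge in the mean; this suffices for the integrals to converge
    ([Rint_comp_cvg], [flux_term_cvg], [flow_identity]).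

    The same regularization shows that the chain rule holds for weak gradients of
    functions of (c, d) ([weak_chain_rule], [chain_is_weak_deriv]). As weak
    gradients are unique ([weak_deriv_unique]), those that occur in the statement
    are the ones computed above. Finally beta is only given on the half-line; it
    is extended to a function of class C2 on the line ([C2_half_extension]), which
    changes nothing since densities are nonnegative. *)

Notation itg mu f := (integrable mu setT (EFin \o f)).

(** * Integration tools *)

Section AlmostEverywhere.
Import HBNNSimple.
Context d (T : measurableType d) (R : realType).
Variable mu : {measure set T -> \bar R}.

Lemma le_integral_ae (f g : T -> \bar R) : (forall x, 0 <= f x)%E ->
  (forall x, 0 <= g x)%E -> {ae mu, forall x, f x = g x} ->
  (\int[mu]_x f x <= \int[mu]_x g x)%E.
Proof.
move=> f0 g0 [N [mN N0 fgN]].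
rewrite ge0_integralTE// ge0_integralTE//; apply: ge_ereal_sup => _ [h hf <-].
apply: ereal_sup_ubound; exists (proj_nnsfun h (measurableC mN)) => /=.
  move=> x /=; rewrite /mindic indicE.
  have [|_] := boolP (x \in ~` N); last by rewrite mulr0.
  rewrite mulr1 inE/= => Nx; rewrite (le_trans (hf x))//.
  by rewrite (_ : f x = g x)//; apply: contrapT => fgx; apply: Nx; exact: fgN.
rewrite -!integralT_nnsfun.
rewrite [RHS](@ge0_negligible_integral _ _ _ _ setT N)//; last 2 first.
- exact/measurable_EFinP.
- by move=> x _; rewrite lee_fin.
rewrite setTD [RHS]integral_mkcond; apply: eq_integral => x _.
by rewrite restrict_EFin/= (mrestrict h (measurableC mN)).
Qed.

(** The integral is a supremum over simple functions below the integrand, and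
    cutting a simple function off on a null set does not change its integral:
    so no measurability is needed. This matters because slices and composites
    of functions that are only measurable up to null sets occur below. *)
Lemma eq_integral_ae (f g : T -> \bar R) : {ae mu, forall x, f x = g x} ->
  (\int[mu]_x f x = \int[mu]_x g x)%E.
Proof.
move=> fg; rewrite integralE [RHS]integralE.
have E (u v : T -> \bar R) : (forall x, 0 <= u x)%E -> (forall x, 0 <= v x)%E ->
    {ae mu, forall x, u x = v x} -> (\int[mu]_x u x = \int[mu]_x v x)%E.
  move=> u0 v0 uv; apply/eqP; rewrite eq_le !le_integral_ae//.
  by apply: filterS uv => x ->.
congr (_ - _)%E; apply: E => // ; apply: filterS fg => x.
  by rewrite !funeposE => ->.
by rewrite !funenegE => ->.
Qed.

Lemma eq_Rintegral_ae (f g : T -> R) : {ae mu, forall x, f x = g x} ->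
  \int[mu]_x f x = \int[mu]_x g x.
Proof.
move=> fg; rewrite /Rintegral; congr fine; apply: eq_integral_ae.
by apply: filterS fg => x ->.
Qed.

Lemma eq_Rintegral_ae_in (D : set T) (f g : T -> R) :
  {ae mu, forall x, D x -> f x = g x} ->
  \int[mu]_(x in D) f x = \int[mu]_(x in D) g x.
Proof.
move=> fg; rewrite Rintegral_mkcond [RHS]Rintegral_mkcond.
apply: eq_Rintegral_ae; apply: filterS fg => x fg; rewrite !patchE.
by case: ifPn => //; rewrite inE.
Qed.

Lemma itg_ae (f g : T -> R) : itg mu f -> measurable_fun setT g ->
  {ae mu, forall x, f x = g x} -> itg mu g.
Proof.
move=> /integrableP[mf fi] mg fg; apply/integrableP; split.
  exact/measurable_EFinP.
rewrite -(eq_integral_ae (f := fun x => `|(EFin \o f) x|%E))//.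
by apply: filterS fg => x /= ->.
Qed.

Lemma itgM (f : T -> R) : itg mu f -> measurable_fun setT f.
Proof. by move=> /integrableP[/measurable_EFinP]. Qed.

Lemma itg_le (f g : T -> R) : measurable_fun setT f -> itg mu g ->
  {ae mu, forall x, `|f x| <= g x} -> itg mu f.
Proof.
move=> mf ig fg.
have mfg : measurable_fun setT (fun x => Num.min `|f x| (`|g x|)).
  apply: measurable_minr; apply: measurableT_comp => //; exact: itgM ig.
have im : itg mu (fun x => Num.min `|f x| (`|g x|)).
  apply: (@le_integrable _ _ _ _ _ measurableT _ (EFin \o g)) => //.
    exact/measurable_EFinP.
  move=> x _ /=; rewrite lee_fin ger0_norm ?ge_min ?lexx ?orbT//.
have ia : itg mu (fun x => `|f x|).
  apply: (itg_ae im); first exact: measurableT_comp.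
  apply: filterS fg => x fg; apply/min_idPl; by rewrite (le_trans fg)// ler_norm.
move/integrableP : ia => [_ ia]; apply/integrableP; split.
  exact/measurable_EFinP.
by under eq_integral do rewrite /= -[`|f _|]normr_id.
Qed.

Lemma itgZ (k : R) (f : T -> R) : itg mu f -> itg mu (fun x => k * f x).
Proof. by move=> fi; have := integrableZl measurableT k fi. Qed.

Lemma itgD (f g : T -> R) : itg mu f -> itg mu g -> itg mu (fun x => f x + g x).
Proof. by move=> fi gi; have := integrableD measurableT fi gi. Qed.

Lemma itgB (f g : T -> R) : itg mu f -> itg mu g -> itg mu (fun x => f x - g x).
Proof. by move=> fi gi; have := integrableB measurableT fi gi. Qed.

Lemma itgN (f : T -> R) : itg mu f -> itg mu (fun x => - f x).
Proof. by move=> fi; have := integrableN fi. Qed.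

Lemma itg_abs (f : T -> R) : itg mu f -> itg mu (fun x => `|f x|).
Proof. exact: integrable_norm. Qed.

Lemma itg_sum (I : Type) (s : seq I) (f : I -> T -> R) :
  (forall i, itg mu (f i)) -> itg mu (fun x => \sum_(i <- s) f i x).
Proof.
move=> fi; have := @integrable_sum _ _ _ mu _ measurableT _ s xpredT
  (fun i => EFin \o f i) (fun i _ => fi i).
by apply: eq_integrable => // x _ /=; rewrite sumEFin.
Qed.

Lemma itg_bM (b f : T -> R) (C : R) : measurable_fun setT b ->
  {ae mu, forall x, `|b x| <= C} -> itg mu f -> itg mu (fun x => b x * f x).
Proof.
move=> mb bC fi; apply: (itg_le (g := fun x => C * `|f x|)).
- exact: measurable_funM mb (itgM fi).
- exact/itgZ/itg_abs.
- by apply: filterS bC => x bC; rewrite normrM ler_wpM2r.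
Qed.

Lemma eq_itg (f g : T -> R) : f =1 g -> itg mu f -> itg mu g.
Proof. by move=> /funext ->. Qed.

Lemma RintD (f g : T -> R) : itg mu f -> itg mu g ->
  \int[mu]_x (f x + g x) = \int[mu]_x f x + \int[mu]_x g x.
Proof. by move=> fi gi; rewrite RintegralD. Qed.

Lemma RintB (f g : T -> R) : itg mu f -> itg mu g ->
  \int[mu]_x (f x - g x) = \int[mu]_x f x - \int[mu]_x g x.
Proof. by move=> fi gi; rewrite RintegralB. Qed.

Lemma RintZ (k : R) (f : T -> R) : itg mu f ->
  \int[mu]_x (k * f x) = k * \int[mu]_x f x.
Proof. by move=> fi; rewrite RintegralZl. Qed.

Lemma RintN (f : T -> R) : itg mu f ->
  \int[mu]_x (- f x) = - \int[mu]_x f x.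
Proof.
move=> fi; rewrite -mulN1r -RintZ//.
by apply: eq_Rintegral => x _; rewrite mulN1r.
Qed.

Lemma Rint_sum (I : Type) (s : seq I) (f : I -> T -> R) :
  (forall i, itg mu (f i)) ->
  \int[mu]_x (\sum_(i <- s) f i x) = \sum_(i <- s) \int[mu]_x f i x.
Proof.
move=> fi; elim: s => [|i s IH].
  rewrite big_nil -[RHS](mul0r (fine (mu setT))) -Rintegral_cst//.
  by apply: eq_Rintegral => x _; rewrite big_nil.
rewrite big_cons -IH -RintD//; last exact: itg_sum.
by apply: eq_Rintegral => x _; rewrite big_cons.
Qed.

Lemma le_Rint (f g : T -> R) : itg mu f -> itg mu g ->
  {ae mu, forall x, f x <= g x} -> \int[mu]_x f x <= \int[mu]_x g x.
Proof.
move=> fi gi fg.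
rewrite (@eq_Rintegral_ae f (fun x => Num.min (f x) (g x))); last first.
  by apply: filterS fg => x fg; apply/esym/min_idPl.
have mm : measurable_fun setT (fun x => Num.min (f x) (g x)).
  exact: measurable_minr (itgM fi) (itgM gi).
apply: le_Rintegral => //; last by move=> x _; rewrite ge_min lexx orbT.
apply: (itg_ae fi) => //.
by apply: filterS fg => x fg; apply/esym/min_idPl.
Qed.

Lemma Rint_norm (f : T -> R) : itg mu f ->
  `|\int[mu]_x f x| <= \int[mu]_x `|f x|.
Proof. by move=> fi; exact: le_normr_Rintegral. Qed.

Lemma Rint_ge0 (f : T -> R) : (forall x, 0 <= f x) -> 0 <= \int[mu]_x f x.
Proof. by move=> f0; apply: Rintegral_ge0. Qed.

Lemma Rint_EFin (f : T -> R) : itg mu f ->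
  (\int[mu]_x (f x)%:E)%E = (\int[mu]_x f x)%:E.
Proof. by move=> fi; rewrite /Rintegral fineK//; exact: integrable_fin_num fi. Qed.

Lemma Rint_dominated (f_ : nat -> T -> R) (f g : T -> R) :
  (forall n, measurable_fun setT (f_ n)) -> measurable_fun setT f ->
  itg mu g -> {ae mu, forall x, f_ n x @[n --> \oo] --> f x} ->
  {ae mu, forall x, forall n, `|f_ n x| <= g x} ->
  [/\ itg mu f, \int[mu]_x `|f_ n x - f x| @[n --> \oo] --> (0 : R) &
      \int[mu]_x f_ n x @[n --> \oo] --> \int[mu]_x f x].
Proof.
move=> mf_ mf ig fcv fle.
have [] := @dominated_convergence _ _ _ mu setT measurableT
  (fun n => EFin \o f_ n) (EFin \o f) (EFin \o g).
- by move=> n; exact/measurable_EFinP.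
- exact/measurable_EFinP.
- by apply: filterS fcv => x fx _; apply: cvg_EFin => //; exact: nearW.
- by [].
- by apply: filterS fle => x fx n _ /=; rewrite lee_fin.
move=> fi c1 c2; split => //.
- exact: (fine_cvg c1).
- by apply: fine_cvg; rewrite -Rint_EFin.
Qed.

Lemma Rint_eq0 (f : T -> R) : itg mu f -> \int[mu]_x `|f x| = 0 ->
  {ae mu, forall x, f x = 0}.
Proof.
move=> fi f0.
have : (\int[mu]_x `|(EFin \o f) x| = 0)%E.
  by have := Rint_EFin (itg_abs fi); rewrite f0.
have mf := measurable_int _ fi.
move/(ae_eq_integral_abs mu measurableT mf).
by apply: filterS => x /(_ I) /= [].
Qed.

End AlmostEverywhere.

Section FiniteMeasure.
Context d (T : measurableType d) (R : realType).
Variable mu : {finite_measure set T -> \bar R}.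

Lemma itg_cst (k : R) : itg mu (fun=> k).
Proof. exact: finite_measure_integrable_cst. Qed.

Lemma itg_bounded (f : T -> R) (C : R) : measurable_fun setT f ->
  {ae mu, forall x, `|f x| <= C} -> itg mu f.
Proof. by move=> mf fC; exact: itg_le (itg_cst C) fC. Qed.

Lemma itg_sqr (f : T -> R) : measurable_fun setT f ->
  itg mu (fun x => f x ^+ 2) -> itg mu f.
Proof.
move=> mf fi; apply: (itg_le (g := fun x => 1 + f x ^+ 2)) => //.
  by apply: itgD => //; exact: itg_cst.
apply: aeW => x; rewrite -[f x ^+ 2]real_normK ?num_real//.
by have := normr_ge0 (f x); nra.
Qed.

End FiniteMeasure.

Lemma itg_sqrM d (T : measurableType d) (R : realType)
  (mu : {measure set T -> \bar R}) (f g : T -> R) :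
  measurable_fun setT f -> measurable_fun setT g ->
  itg mu (fun x => f x ^+ 2) -> itg mu (fun x => g x ^+ 2) ->
  itg mu (fun x => f x * g x).
Proof.
move=> mf mg fi gi; apply: (itg_le (g := fun x => f x ^+ 2 + g x ^+ 2)).
- exact: measurable_funM.
- exact: itgD.
- apply: aeW => x; rewrite normrM -[f x ^+ 2]real_normK ?num_real//.
  rewrite -[g x ^+ 2]real_normK ?num_real//.
  by have := normr_ge0 (f x); have := normr_ge0 (g x); nra.
Qed.
(** * Product and restricted measures *)

Section ParametricIntegral.
Context d1 d2 (X : measurableType d1) (Y : measurableType d2) (R : realType).

Lemma measurable_Rint2 (nu : {finite_measure set Y -> \bar R}) (f : X * Y -> R) :
  measurable_fun setT f -> measurable_fun setT (fun x => \int[nu]_y f (x, y)).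
Proof.
move=> mf; apply: measurableT_comp => //.
rewrite (_ : (fun x => _) = (fun x => (\int[nu]_y ((EFin \o f)^\+ (x, y)) -
   \int[nu]_y ((EFin \o f)^\- (x, y)))%E)); last first.
  apply/funext => x; rewrite integralE.
  by congr (_ - _)%E; apply: eq_integral => y _; rewrite ?funeposE ?funenegE.
have mef : measurable_fun setT (EFin \o f) by exact/measurable_EFinP.
apply: emeasurable_funB; apply: measurable_fun_fubini_tonelli_F => //.
  exact: measurable_funepos.
exact: measurable_funeneg.
Qed.

Lemma measurable_Rint1 (mu : {finite_measure set X -> \bar R}) (f : X * Y -> R) :
  measurable_fun setT f -> measurable_fun setT (fun y => \int[mu]_x f (x, y)).
Proof.
move=> mf; apply: measurableT_comp => //.
rewrite (_ : (fun y => _) = (fun y => (\int[mu]_x ((EFin \o f)^\+ (x, y)) -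
   \int[mu]_x ((EFin \o f)^\- (x, y)))%E)); last first.
  apply/funext => y; rewrite integralE.
  by congr (_ - _)%E; apply: eq_integral => x _; rewrite ?funeposE ?funenegE.
have mef : measurable_fun setT (EFin \o f) by exact/measurable_EFinP.
apply: emeasurable_funB; apply: measurable_fun_fubini_tonelli_G => //.
  exact: measurable_funepos.
exact: measurable_funeneg.
Qed.

End ParametricIntegral.

(** The restrictions of Lebesgue measure to boxes are products only up to
    propositional equality, so product structure is a hypothesis. *)
Definition is_prod d1 d2 (X : measurableType d1) (Y : measurableType d2)
    (R : realType) (rho : {finite_measure set (X * Y)%type -> \bar R})
    (mu : {finite_measure set X -> \bar R})
    (nu : {finite_measure set Y -> \bar R}) : Prop :=
  forall A, measurable A -> rho A = (mu \x nu)%E A.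

Section Fubini.
Context d1 d2 (X : measurableType d1) (Y : measurableType d2) (R : realType).
Variables (rho : {finite_measure set (X * Y)%type -> \bar R})
  (mu : {finite_measure set X -> \bar R})
  (nu : {finite_measure set Y -> \bar R}).
Hypothesis rhoE : is_prod rho mu nu.

Lemma integral_is_prod (f : X * Y -> \bar R) :
  (\int[rho]_z f z = \int[(mu \x nu)%E]_z f z)%E.
Proof. by apply: eq_measure_integral => A mA _; exact: rhoE. Qed.

Lemma tonelli1 (f : X * Y -> \bar R) : measurable_fun setT f ->
  (forall z, 0 <= f z)%E ->
  (\int[rho]_z f z = \int[mu]_x \int[nu]_y f (x, y))%E.
Proof. by move=> mf f0; rewrite integral_is_prod fubini_tonelli1. Qed.

Lemma tonelli2 (f : X * Y -> \bar R) : measurable_fun setT f ->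
  (forall z, 0 <= f z)%E ->
  (\int[rho]_z f z = \int[nu]_y \int[mu]_x f (x, y))%E.
Proof. by move=> mf f0; rewrite integral_is_prod fubini_tonelli2. Qed.

Lemma itg_prod (f : X * Y -> R) : itg rho f <-> itg (mu \x nu)%E f.
Proof.
split=> /integrableP[mf fi]; apply/integrableP; split => //.
  by rewrite -integral_is_prod.
by rewrite integral_is_prod.
Qed.

Lemma itg_slice1 (f : X * Y -> R) : itg rho f ->
  {ae mu, forall x, itg nu (fun y => f (x, y))}.
Proof. by move/itg_prod/ae_integrable1. Qed.

Lemma itg_slice2 (f : X * Y -> R) : itg rho f ->
  {ae nu, forall y, itg mu (fun x => f (x, y))}.
Proof. by move/itg_prod/ae_integrable2. Qed.

Let Rint1_ae (f : X * Y -> R) : itg rho f ->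
  {ae mu, forall x, (\int[nu]_y (f (x, y))%:E)%E = (\int[nu]_y f (x, y))%:E}.
Proof. by move=> /itg_slice1; apply: filterS => x fi; rewrite Rint_EFin. Qed.

Let Rint2_ae (f : X * Y -> R) : itg rho f ->
  {ae nu, forall y, (\int[mu]_x (f (x, y))%:E)%E = (\int[mu]_x f (x, y))%:E}.
Proof. by move=> /itg_slice2; apply: filterS => x fi; rewrite Rint_EFin. Qed.

Lemma Rfubini1 (f : X * Y -> R) : itg rho f ->
  \int[rho]_z f z = \int[mu]_x \int[nu]_y f (x, y).
Proof.
move=> fi; rewrite /Rintegral integral_is_prod.
rewrite -(integral12_prod_meas1 (f := EFin \o f)); last exact/itg_prod.
by congr fine; apply: eq_integral_ae; exact: Rint1_ae.
Qed.

Lemma Rfubini2 (f : X * Y -> R) : itg rho f ->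
  \int[rho]_z f z = \int[nu]_y \int[mu]_x f (x, y).
Proof.
move=> fi; rewrite /Rintegral integral_is_prod.
rewrite -(integral21_prod_meas1 (f := EFin \o f)); last exact/itg_prod.
by congr fine; apply: eq_integral_ae; exact: Rint2_ae.
Qed.

Lemma itg_Rint1 (f : X * Y -> R) : itg rho f ->
  itg mu (fun x => \int[nu]_y f (x, y)).
Proof.
move=> fi; apply/integrableP; split.
  by apply/measurable_EFinP/measurable_Rint2; exact: itgM fi.
rewrite -(eq_integral_ae
    (f := fun x => `|\int[nu]_y (f (x, y))%:E|%E)); last first.
  by apply: filterS (Rint1_ae fi) => x /= ->.
have /integrableP[_] := integrable_fubini_F (f := EFin \o f) ((itg_prod f).1 fi).
by [].
Qed.

Lemma ae_prod2 (P : X * Y -> Prop) : {ae rho, forall z, P z} ->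
  {ae nu, forall y, {ae mu, forall x, P (x, y)}}.
Proof.
move=> [N [mN N0 PN]]; move: N0; rewrite rhoE// => N0.
have : (\int[nu]_y mu (ysection N y) = 0)%E.
  have := @product_measure_unique _ _ _ _ _ mu nu (mu \x^ nu)%E.
  rewrite -[RHS]N0 => -> // A B mA mB; exact: product_measure2E.
have my : measurable_fun setT (fun y => mu (ysection N y)).
  exact: measurable_fun_ysection.
under eq_integral do rewrite -[mu _]gee0_abs//.
move/(ae_eq_integral_abs nu measurableT my).
apply: filterS => y /(_ I) yN; exists (ysection N y); split => //.
  exact: measurable_ysection.
by move=> x Px; rewrite /ysection/= inE; exact: PN.
Qed.

(** Measurability lets Fubini's theorem measure the exceptional set by its
    slices. *)
Lemma prod_ae1 (f g : X * Y -> R) :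
  measurable_fun setT f -> measurable_fun setT g ->
  (forall x, {ae nu, forall y, f (x, y) = g (x, y)}) ->
  {ae rho, forall z, f z = g z}.
Proof.
move=> mf mg fg.
have mN : measurable [set z | f z != g z].
  rewrite -[X in measurable X]setTI.
  have := @measurable_neqe _ _ R setT measurableT (EFin \o f) (EFin \o g).
  by apply; exact/measurable_EFinP.
exists [set z | f z != g z]; split => //; last by move=> z /eqP.
rewrite rhoE// /product_measure1 integral0_eq// => x _ /=.
have [N [mN' N0 fgN]] := fg x.
apply: (subset_measure0 _ mN' _ N0); first exact: measurable_xsection.
by move=> y; rewrite /xsection/= inE/= => /eqP; exact: fgN.
Qed.

End Fubini.

Section Swap.
Context d1 d2 (X : measurableType d1) (Y : measurableType d2) (R : realType).
Variables (mu : {finite_measure set X -> \bar R})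
  (nu : {finite_measure set Y -> \bar R}).

Lemma itg_tensor (rho : {finite_measure set (X * Y)%type -> \bar R})
    (f : X -> R) (g : Y -> R) : is_prod rho mu nu ->
  itg mu f -> itg nu g -> itg rho (fun z => f z.1 * g z.2).
Proof.
move=> rhoE fi gi; pose h (z : X * Y) := f z.1 * g z.2.
have mh : measurable_fun setT h.
  apply: measurable_funM.
    exact: measurableT_comp (itgM fi) measurable_fst.
  exact: measurableT_comp (itgM gi) measurable_snd.
apply/integrableP; split; first exact/measurable_EFinP.
have mz : measurable_fun setT (fun z : X * Y => (`|h z|)%:E).
  by apply/measurable_EFinP; exact: measurableT_comp.
rewrite (_ : (fun x => _) = (fun z : X * Y => (`|h z|)%:E))//.
rewrite (tonelli1 rhoE)//.
rewrite (_ : (fun x => _) = (fun x => (`|f x| * \int[nu]_y `|g y|)%:E)).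
  rewrite Rint_EFin ?ltry//.
  rewrite (eq_itg (f := fun x => (\int[nu]_y `|g y|) * `|f x|))//.
    by move=> x; rewrite mulrC.
  exact/itgZ/itg_abs.
apply/funext => x; rewrite /= -RintZ; last exact: itg_abs.
rewrite -Rint_EFin; last exact/itgZ/itg_abs.
by apply: eq_integral => y _; rewrite normrM.
Qed.

End Swap.

Section Restriction.
Context d (T : measurableType d) (R : realType).
Variables (mu : {measure set T -> \bar R}) (D : set T) (mD : measurable D).
Hypothesis Doo : (mu D < +oo)%E.
Local Notation muD := (mfrestr mD Doo).

Lemma ae_restrP (P : T -> Prop) :
  {ae muD, forall x, P x} <-> {ae mu, forall x, D x -> P x}.
Proof.
split=> -[N [mN N0 PN]].
  exists (N `&` D); split => //; first exact: measurableI.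
  by move=> x /not_implyP[Dx Px]; split => //; exact: PN.
exists (N `|` ~` D); split.
- by apply: measurableU => //; exact: measurableC.
- rewrite /mfrestr /mrestr/= setIUl setICl setU0.
  by apply: (subset_measure0 _ mN _ N0) => //; exact: measurableI.
- move=> x Px /=; have [Dx|Dx] := pselect (D x); last by right.
  by left; apply: PN => /= H; apply: Px; exact: H.
Qed.

Lemma ge0_integral_restr (f : T -> \bar R) : measurable_fun setT f ->
  (forall x, 0 <= f x)%E -> (\int[muD]_x f x = \int[mu]_(x in D) f x)%E.
Proof.
move=> mf f0.
have E : (\int[muD]_x f x = \int[muD]_(x in D) f x)%E.
  rewrite (@ge0_negligible_integral _ _ _ muD setT (~` D))//.
  - by rewrite setTD setCK.
  - exact: measurableC.
  - by rewrite [LHS](_ : _ = mu (~` D `&` D))// setICl.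
rewrite E; apply: eq_measure_integral => A mA AD.
by rewrite [LHS](_ : _ = mu (A `&` D))// setIidl.
Qed.

Lemma integral_restr (f : T -> \bar R) : measurable_fun setT f ->
  (\int[muD]_x f x = \int[mu]_(x in D) f x)%E.
Proof.
move=> mf; rewrite [LHS]integralE [RHS]integralE.
have E (g : T -> \bar R) := @ge0_integral_restr g.
rewrite E; [|exact: measurable_funepos|exact: funepos_ge0].
by rewrite E; [|exact: measurable_funeneg|exact: funeneg_ge0].
Qed.

Lemma Rint_restr (f : T -> R) : measurable_fun setT f ->
  \int[muD]_x f x = \int[mu]_(x in D) f x.
Proof.
by move=> mf; rewrite /Rintegral integral_restr//; exact/measurable_EFinP.
Qed.

Lemma itg_restr (f : T -> R) : measurable_fun setT f ->
  itg muD f <-> integrable mu D (EFin \o f).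
Proof.
move=> mf; have mef : measurable_fun setT (EFin \o f) by exact/measurable_EFinP.
split=> /integrableP[_ fi]; apply/integrableP; split => //.
- exact: measurable_funTS.
- by rewrite -integral_restr//; exact: measurableT_comp.
- by rewrite integral_restr//; exact: measurableT_comp.
Qed.

End Restriction.

Lemma is_prod_restr d1 d2 (X : measurableType d1) (Y : measurableType d2)
    (R : realType) (mu : {sigma_finite_measure set X -> \bar R})
    (nu : {sigma_finite_measure set Y -> \bar R})
    (rho : {measure set (X * Y)%type -> \bar R}) (A : set X) (B : set Y)
    (mA : measurable A) (mB : measurable B) (mAB : measurable (A `*` B))
    (Aoo : (mu A < +oo)%E) (Boo : (nu B < +oo)%E) (ABoo : (rho (A `*` B) < +oo)%E) :
  (forall Z, rho Z = (mu \x nu)%E Z) ->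
  is_prod (mfrestr mAB ABoo) (mfrestr mA Aoo) (mfrestr mB Boo).
Proof.
move=> rhoE Z mZ; apply/esym.
apply: (@product_measure_unique _ _ _ _ _ (mfrestr mA Aoo) (mfrestr mB Boo)
  (mfrestr mAB ABoo)) => // U V mU mV.
rewrite [LHS](_ : _ = rho ((U `*` V) `&` (A `*` B)))// -setXI rhoE.
by rewrite product_measure1E//; exact: measurableI.
Qed.
Section ProductMeasure.
Context d1 d2 (X : measurableType d1) (Y : measurableType d2) (R : realType).
Variables (mu : {finite_measure set X -> \bar R})
  (nu : {finite_measure set Y -> \bar R}).

Definition prodm : set (X * Y)%type -> \bar R := (mu \x nu)%E.

HB.instance Definition _ := Measure.on prodm.

Let prodm_fin : fin_num_fun prodm.
Proof.
move=> A mA; rewrite ge0_fin_numE//; apply: (@le_lt_trans _ _ (prodm setT)).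
  by apply: le_measure; rewrite ?inE.
rewrite /prodm -setXTT product_measure1E//.
by rewrite lte_mul_pinfty// ?ltey_eq ?fin_num_measure.
Qed.

HB.instance Definition _ := Measure_isFinite.Build _ _ _ prodm prodm_fin.

Lemma is_prod_prodm : is_prod prodm mu nu. Proof. by []. Qed.

End ProductMeasure.

Section SwapFactors.
Context d1 d2 (X : measurableType d1) (Y : measurableType d2) (R : realType).
Variables (rho : {finite_measure set (X * Y)%type -> \bar R})
  (mu : {finite_measure set X -> \bar R})
  (nu : {finite_measure set Y -> \bar R}).
Hypothesis rhoE : is_prod rho mu nu.

Lemma itg_swap (f : X * Y -> R) : itg rho f ->
  itg (prodm nu mu) (fun z => f (z.2, z.1)).
Proof.
move=> fi; have mf := itgM fi.
have mfs : measurable_fun setT (fun z : Y * X => f (z.2, z.1)).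
  exact: (measurableT_comp mf (measurable_fun_pair measurable_snd measurable_fst)).
have ms : measurable_fun setT (fun z : Y * X => (`|f (z.2, z.1)|)%:E).
  by apply/measurable_EFinP; exact: measurableT_comp.
have ma : measurable_fun setT (fun z => (`|f z|)%:E).
  by apply/measurable_EFinP; exact: measurableT_comp.
apply/integrableP; split; first exact/measurable_EFinP.
rewrite (_ : (fun x => _) = (fun z : Y * X => (`|f (z.2, z.1)|)%:E))//.
rewrite (tonelli2 (is_prod_prodm nu mu))//=.
by move/integrableP : fi => [_]; rewrite (tonelli1 rhoE).
Qed.

Lemma Rint_swap (f : X * Y -> R) : itg rho f ->
  \int[rho]_z f z = \int[prodm nu mu]_z f (z.2, z.1).
Proof.
move=> fi; rewrite (Rfubini1 rhoE)// (Rfubini2 (is_prod_prodm nu mu))//.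
exact: itg_swap.
Qed.

End SwapFactors.

(** * Mollification by Markov kernels *)

(** Unit mass of the rows makes the average a mean of values; unit mass of the
    columns makes averaging preserve integrals, hence contract the norm of the
    mean. *)
Record markov_kernel d (X : measurableType d) (R : realType)
    (mu : {finite_measure set X -> \bar R}) (k : X -> X -> R) : Prop := Markov {
  markov_meas : measurable_fun setT (fun z : X * X => k z.1 z.2);
  markov_ge0 : forall x y, 0 <= k x y;
  markov_bnd : exists C, forall x y, k x y <= C;
  markov_row : forall x, \int[mu]_y k x y = 1;
  markov_col : forall y, \int[mu]_x k x y = 1 }.

Definition avg d (X : measurableType d) (R : realType)
    (mu : {finite_measure set X -> \bar R}) (k : X -> X -> R) (f : X -> R)
    (x : X) : R := \int[mu]_y (k x y * f y).

(** The second factor is a parameter: time, or another space coordinate. *)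
Definition avgp d1 d2 (X : measurableType d1) (Y : measurableType d2)
    (R : realType) (mu : {finite_measure set X -> \bar R}) (k : X -> X -> R)
    (f : X * Y -> R) (z : X * Y) : R := avg mu k (fun x => f (x, z.2)) z.1.

Section Markov.
Context d (X : measurableType d) (R : realType).
Variables (mu : {finite_measure set X -> \bar R}) (k : X -> X -> R).
Hypothesis mk : markov_kernel mu k.

Lemma measurable_kernel_row x : measurable_fun setT (k x).
Proof. exact: measurable_fun_pair2 x (markov_meas mk). Qed.

Lemma kernel_norm : exists C, forall x y, `|k x y| <= C.
Proof.
by have [C kC] := markov_bnd mk; exists C => x y; rewrite ger0_norm ?kC// (markov_ge0 mk).
Qed.

Lemma itg_row x (f : X -> R) : itg mu f -> itg mu (fun y => k x y * f y).
Proof.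
have [C kC] := kernel_norm; apply: (itg_bM (C := C)).
  exact: measurable_kernel_row.
exact: aeW.
Qed.

Lemma itg_kernel_row x : itg mu (k x).
Proof.
have [C kC] := kernel_norm; apply: (itg_bounded (C := C)).
  exact: measurable_kernel_row.
exact: aeW.
Qed.

Lemma avgB (f g : X -> R) x : itg mu f -> itg mu g ->
  avg mu k (fun y => f y - g y) x = avg mu k f x - avg mu k g x.
Proof.
move=> fi gi; rewrite /avg -RintB; [|exact: itg_row|exact: itg_row].
by apply: eq_Rintegral => y _; rewrite mulrBr.
Qed.

Lemma le_avg (f g : X -> R) x : itg mu f -> itg mu g ->
  {ae mu, forall y, f y <= g y} -> avg mu k f x <= avg mu k g x.
Proof.
move=> fi gi fg; apply: le_Rint; [exact: itg_row|exact: itg_row|].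
by apply: filterS fg => y; apply: ler_wpM2l; exact: (markov_ge0 mk).
Qed.

Lemma avg_cst c x : avg mu k (fun=> c) x = c.
Proof.
rewrite /avg; under eq_Rintegral do rewrite mulrC.
by rewrite RintZ ?(markov_row mk) ?mulr1//; exact: itg_kernel_row.
Qed.

Lemma avg_range (f : X -> R) a b x : measurable_fun setT f ->
  {ae mu, forall y, a <= f y <= b} -> a <= avg mu k f x <= b.
Proof.
move=> mf fab.
have fi : itg mu f.
  apply: (itg_bounded (C := `|a| + `|b|)) => //.
  apply: filterS fab => y /andP[af fb].
  rewrite ler_norml; apply/andP; split.
    apply: le_trans af.
    by have := ler_norm (- a); rewrite normrN; have := normr_ge0 b; lra.
  by apply: (le_trans fb); have := ler_norm b; have := normr_ge0 a; lra.
apply/andP; split.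
  rewrite -{1}(avg_cst a x) le_avg//; first exact: itg_cst.
  by apply: filterS fab => y /andP[].
rewrite -{1}(avg_cst b x) le_avg//; first exact: itg_cst.
by apply: filterS fab => y /andP[].
Qed.

Lemma norm_avg_le (f : X -> R) x : itg mu f ->
  `|avg mu k f x| <= avg mu k (fun y => `|f y|) x.
Proof.
move=> fi; rewrite (le_trans (Rint_norm _))//; first exact: itg_row.
rewrite le_eqVlt; apply/orP; left; apply/eqP; apply: eq_Rintegral => y _.
by rewrite normrM ger0_norm// (markov_ge0 mk).
Qed.

(** The variance of f under k(x, .) is nonnegative. *)
Lemma avg_jensen (f : X -> R) x : measurable_fun setT f ->
  itg mu (fun y => f y ^+ 2) ->
  avg mu k f x ^+ 2 <= avg mu k (fun y => f y ^+ 2) x.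
Proof.
move=> mf f2; have fi := itg_sqr mf f2; set m := avg mu k f x.
have : 0 <= avg mu k (fun y => (f y - m) ^+ 2) x.
  by apply: Rint_ge0 => y; rewrite mulr_ge0 ?sqr_ge0// (markov_ge0 mk).
have -> : (fun y => (f y - m) ^+ 2) =
    (fun y => f y ^+ 2 - (2 * m * f y - m ^+ 2)).
  by apply/funext => y; ring.
rewrite avgB//; last by apply: itgB; [exact: itgZ|exact: itg_cst].
rewrite avgB; [|exact: itgZ|exact: itg_cst].
rewrite avg_cst.
have -> : avg mu k (fun x0 => 2 * m * f x0) x = 2 * m * m.
  rewrite {3}/m /avg -RintZ; last exact: itg_row.
  by apply: eq_Rintegral => y _; rewrite mulrCA.
rewrite -/m; lra.
Qed.

Lemma measurable_avg (f : X -> R) : measurable_fun setT f ->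
  measurable_fun setT (avg mu k f).
Proof.
move=> mf.
apply: (measurable_Rint2 mu (f := fun z : X * X => k z.1 z.2 * f z.2)).
apply: measurable_funM; first exact: markov_meas mk.
exact: measurableT_comp mf measurable_snd.
Qed.

Lemma itg_kernel2 (f : X -> R) : itg mu f ->
  itg (prodm mu mu) (fun z => k z.1 z.2 * f z.2).
Proof.
move=> fi; have [C kC] := kernel_norm; apply: (itg_bM (C := C)).
- exact: markov_meas mk.
- exact: aeW.
- have := itg_tensor (is_prod_prodm mu mu) (itg_cst mu 1) fi.
  by apply: eq_itg => z; rewrite mul1r.
Qed.

Lemma itg_avg (f : X -> R) : itg mu f -> itg mu (avg mu k f).
Proof. by move=> fi; exact: itg_Rint1 (is_prod_prodm mu mu) _ (itg_kernel2 fi). Qed.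

Lemma Rint_avg (f : X -> R) : itg mu f ->
  \int[mu]_x avg mu k f x = \int[mu]_x f x.
Proof.
move=> fi; rewrite /avg.
rewrite -(Rfubini1 (is_prod_prodm mu mu) (itg_kernel2 fi)).
rewrite (Rfubini2 (is_prod_prodm mu mu) (itg_kernel2 fi)).
apply: eq_Rintegral => y _ /=; under eq_Rintegral do rewrite mulrC.
rewrite RintZ ?(markov_col mk) ?mulr1//.
have [C kC] := kernel_norm; apply: (itg_bounded (C := C)); last exact: aeW.
have := markov_meas mk => m.
exact: measurable_fun_pair1 y m.
Qed.

Lemma avg_contraction (f : X -> R) : itg mu f ->
  \int[mu]_x `|avg mu k f x| <= \int[mu]_x `|f x|.
Proof.
move=> fi; rewrite -[leRHS](Rint_avg (itg_abs fi)); apply: le_Rint.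
- exact/itg_abs/itg_avg.
- exact/itg_avg/itg_abs.
- by apply: aeW => x; exact: norm_avg_le.
Qed.

End Markov.

Section Parametric.
Context d1 d2 (X : measurableType d1) (Y : measurableType d2) (R : realType).
Variables (rho : {finite_measure set (X * Y)%type -> \bar R})
  (mu : {finite_measure set X -> \bar R})
  (nu : {finite_measure set Y -> \bar R}).
Hypothesis rhoE : is_prod rho mu nu.
Variable k : X -> X -> R.
Hypothesis mk : markov_kernel mu k.

Lemma measurable_avgp (f : X * Y -> R) : measurable_fun setT f ->
  measurable_fun setT (avgp mu k f).
Proof.
move=> mf; apply: (measurable_Rint2 mu
  (f := fun z : (X * Y) * X => k z.1.1 z.2 * f (z.2, z.1.2))).
have m1 : measurable_fun setT (fun z : (X * Y) * X => z.1.1).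
  exact: measurableT_comp measurable_fst measurable_fst.
have m2 : measurable_fun setT (fun z : (X * Y) * X => z.1.2).
  exact: measurableT_comp measurable_snd measurable_fst.
apply: measurable_funM.
  have := markov_meas mk => m.
  exact: measurableT_comp m (measurable_fun_pair m1 measurable_snd).
exact: measurableT_comp mf (measurable_fun_pair measurable_snd m2).
Qed.

Lemma itg_avgp (f : X * Y -> R) : itg rho f -> itg rho (avgp mu k f).
Proof.
move=> fi; have mf := itgM fi; have ma := measurable_avgp mf.
have maf : measurable_fun setT (fun z => `|(EFin \o avgp mu k f) z|%E).
  by apply: measurableT_comp => //; exact/measurable_EFinP.
have mff : measurable_fun setT (fun z => `|(EFin \o f) z|%E).
  by apply: measurableT_comp => //; exact/measurable_EFinP.
apply/integrableP; split; first exact/measurable_EFinP.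
move/integrableP : (fi) => [_].
rewrite (tonelli2 rhoE maf (fun=> abse_ge0 _)).
rewrite (tonelli2 rhoE mff (fun=> abse_ge0 _)).
apply: le_lt_trans; apply: ae_ge0_le_integral => //.
- by move=> y _; exact: integral_ge0.
- exact: measurable_fun_fubini_tonelli_G maf _.
- by move=> y _; exact: integral_ge0.
- exact: measurable_fun_fubini_tonelli_G mff _.
- apply: filterS (itg_slice2 rhoE fi) => y fy _ /=.
  rewrite (Rint_EFin (itg_abs (itg_avg mk fy))) (Rint_EFin (itg_abs fy)).
  by rewrite lee_fin; exact: (avg_contraction mk fy).
Qed.

Lemma avgp_contraction (f : X * Y -> R) : itg rho f ->
  \int[rho]_z `|avgp mu k f z| <= \int[rho]_z `|f z|.
Proof.
move=> fi; have ai := itg_avgp fi.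
rewrite !(Rfubini2 rhoE); try exact: itg_abs.
apply: le_Rint.
- have := itg_Rint1 (is_prod_prodm nu mu) (itg_swap rhoE (itg_abs ai)).
  by apply: eq_itg.
- have := itg_Rint1 (is_prod_prodm nu mu) (itg_swap rhoE (itg_abs fi)).
  by apply: eq_itg.
- apply: filterS (itg_slice2 rhoE fi) => y fy.
  exact: (avg_contraction mk fy).
Qed.

Lemma ae_snd (P : Y -> Prop) : {ae nu, forall y, P y} ->
  {ae rho, forall z, P z.2}.
Proof.
move=> [N [mN N0 PN]]; exists (setT `*` N); split.
- exact: measurableX.
- rewrite rhoE; last exact: measurableX.
  by rewrite product_measure1E//= [X in (_ * X)%E]N0 mule0.
- by move=> z Pz; split => //; exact: PN.
Qed.

Lemma avgpB_ae (f g : X * Y -> R) : itg rho f -> itg rho g ->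
  {ae rho, forall z, avgp mu k (fun w => f w - g w) z =
                     avgp mu k f z - avgp mu k g z}.
Proof.
move=> fi gi; have fs := ae_snd (itg_slice2 rhoE fi).
have gs := ae_snd (itg_slice2 rhoE gi).
by apply: filterS2 fs gs => z fz gz; rewrite /avgp (avgB mk).
Qed.

Lemma avgp_sqr_le (f : X * Y -> R) : measurable_fun setT f ->
  itg rho (fun z => f z ^+ 2) -> 
  {ae rho, forall z, avgp mu k f z ^+ 2 <= avgp mu k (fun w => f w ^+ 2) z}.
Proof.
move=> mf f2; apply: filterS (ae_snd (itg_slice2 rhoE f2)) => z fz.
by apply: (avg_jensen mk) => //; exact: measurable_fun_pair1 z.2 mf.
Qed.

Lemma Rint_avgp (f : X * Y -> R) : itg rho f ->
  \int[rho]_z avgp mu k f z = \int[rho]_z f z.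
Proof.
move=> fi; rewrite (Rfubini2 rhoE fi) (Rfubini2 rhoE (itg_avgp fi)).
apply: eq_Rintegral_ae; apply: filterS (itg_slice2 rhoE fi) => y fy.
by rewrite -(Rint_avg mk fy).
Qed.

End Parametric.
(** * Approximate identities *)

Record mollifier d (X : measurableType d) (R : realType)
    (mu : {finite_measure set X -> \bar R}) (k : nat -> X -> X -> R) : Prop :=
  Mollifier {
  mol_markov : forall N, markov_kernel mu (k N);
  mol_cvg : forall f, itg mu f ->
    \int[mu]_x `|avg mu (k N) f x - f x| @[N --> \oo] --> (0 : R) }.

Section MollifierParametric.
Context d1 d2 (X : measurableType d1) (Y : measurableType d2) (R : realType).
Variables (rho : {finite_measure set (X * Y)%type -> \bar R})
  (mu : {finite_measure set X -> \bar R})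
  (nu : {finite_measure set Y -> \bar R}).
Hypothesis rhoE : is_prod rho mu nu.
Variable k : nat -> X -> X -> R.
Hypothesis mk : mollifier mu k.

Let kN N : markov_kernel mu (k N). Proof. exact: mol_markov mk N. Qed.

(** Slicewise convergence, dominated because the averages are contractions. *)
Lemma avgp_cvg (f : X * Y -> R) : itg rho f ->
  \int[rho]_z `|avgp mu (k N) f z - f z| @[N --> \oo] --> (0 : R).
Proof.
move=> fi; have mf := itgM fi.
have ii N : itg rho (fun z => `|avgp mu (k N) f z - f z|).
  by apply/itg_abs/itgB => //; exact: (itg_avgp rhoE (kN N) fi).
pose phi N y := \int[mu]_x `|avgp mu (k N) f (x, y) - f (x, y)|.
have -> : (fun N => \int[rho]_z `|avgp mu (k N) f z - f z|) =
    (fun N => \int[nu]_y phi N y).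
  by apply/funext => N; rewrite (Rfubini2 rhoE)//; exact: ii.
have fs := itg_slice2 rhoE fi.
have [] := @Rint_dominated _ _ _ nu phi (cst 0)
    (fun y => 2 * \int[mu]_x `|f (x, y)|).
- by move=> N; exact: (measurable_Rint1 mu (itgM (ii N))).
- exact: measurable_cst.
- apply: itgZ.
  have := itg_Rint1 (is_prod_prodm nu mu) (itg_swap rhoE (itg_abs fi)).
  by apply: eq_itg.
- by apply: filterS fs => y fy; exact: (mol_cvg mk fy).
- apply: filterS fs => y fy N; rewrite /phi ger0_norm; last exact: Rint_ge0.
  have ai := itg_avg (kN N) fy.
  apply: (@le_trans _ _ (\int[mu]_x (`|avg mu (k N) (fun x => f (x, y)) x| +
    `|f (x, y)|))).
    apply: le_Rint; first exact: itg_abs (itgB ai fy).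
      by apply: itgD; exact: itg_abs.
    by apply: aeW => x; exact: ler_normB.
  rewrite RintD; try exact: itg_abs.
  by rewrite mulr_natl mulr2n lerD2r; exact: avg_contraction.
by move=> _ _; rewrite Rintegral_cst// mul0r.
Qed.

Let clamp (m x : R) : R := Num.min (Num.max x (- m)) m.

Let clamp_norm m x : 0 <= m -> `|clamp m x| <= m.
Proof.
move=> m0; rewrite /clamp ler_norml.
by case: (leP (Num.max x (- m)) m) => h2; move: h2; case: (leP x (- m)) => h1 h2; apply/andP; split; lra.
Qed.

Let clamp_res m x : 0 <= m -> `|x - clamp m x| <= `|x|.
Proof.
move=> m0; rewrite /clamp ler_norml.
case: (ger0P x) => x0; case: (leP (Num.max x (- m)) m) => h2; move: h2; case: (leP x (- m)) => h1 h2;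
  apply/andP; split; lra.
Qed.

Let clamp_id m x : `|x| <= m -> clamp m x = x.
Proof.
rewrite ler_norml => /andP[h1 h2]; rewrite /clamp.
by rewrite (max_idPl h1) (min_idPl h2).
Qed.

(** Bounded functions converge in the mean square because they converge in the
    mean; Jensen's inequality controls the remainder of a truncation. *)
Lemma avgp_cvg_sqr (f : X * Y -> R) : measurable_fun setT f ->
  itg rho (fun z => f z ^+ 2) ->
  (forall N, itg rho (fun z => avgp mu (k N) f z ^+ 2)) /\
  \int[rho]_z (avgp mu (k N) f z - f z) ^+ 2 @[N --> \oo] --> (0 : R).
Proof.
move=> mf f2; have fi := itg_sqr mf f2.
have a2 (g : X * Y -> R) N : measurable_fun setT g ->
    itg rho (fun z => g z ^+ 2) -> itg rho (fun z => avgp mu (k N) g z ^+ 2).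
  move=> mg g2; apply: (itg_le (g := avgp mu (k N) (fun w => g w ^+ 2))).
  - by apply: measurable_funX; exact: (measurable_avgp (kN N)).
  - exact: (itg_avgp rhoE (kN N)).
  - apply: filterS (avgp_sqr_le rhoE (kN N) mg g2) => z gz.
    by rewrite ger0_norm ?sqr_ge0.
split; first by move=> N; exact: a2.
(* Truncation at height m, and its remainder. *)
pose t m z := clamp m%:R (f z); pose r m z := f z - t m z.
have mt m : measurable_fun setT (t m).
  apply: measurable_minr => //; apply: measurable_maxr => //.
have mr m : measurable_fun setT (r m) by exact: measurable_funB.
have ti m : itg rho (t m).
  by apply: (itg_bounded (C := m%:R)) => //; apply: aeW => z; exact: clamp_norm.
have r2 m : itg rho (fun z => r m z ^+ 2).
  apply: (itg_le (g := fun z => f z ^+ 2)) => //; first exact: measurable_funX.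
  apply: aeW => z; rewrite ger0_norm ?sqr_ge0// -[leRHS]real_normK ?num_real//.
  rewrite -[leLHS]real_normK ?num_real// ler_pXn2r ?nnegrE//.
  exact: clamp_res.
have ri m := itg_sqr (mr m) (r2 m).
have rcv : \int[rho]_z (r m z ^+ 2) @[m --> \oo] --> (0 : R).
  have [] := @Rint_dominated _ _ _ rho (fun m z => r m z ^+ 2) (cst 0)
    (fun z => f z ^+ 2).
  - by move=> m; exact: measurable_funX.
  - exact: measurable_cst.
  - by [].
  - apply: aeW => z; apply: cvg_near_cst.
    have [m0 _ hm0] : \forall m \near \oo, `|f z| <= m%:R :> R.
      exact: nbhs_infty_ger.
    by exists m0 => // m /hm0 fm; rewrite /r /t clamp_id// subrr expr0n.
  - apply: aeW => z m; rewrite ger0_norm ?sqr_ge0//.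
    rewrite -[leRHS]real_normK ?num_real//.
    rewrite -[leLHS]real_normK ?num_real// ler_pXn2r ?nnegrE//.
    exact: clamp_res.
  by move=> _ _; rewrite Rintegral_cst// mul0r.
have dif2 N : itg rho (fun z => (avgp mu (k N) f z - f z) ^+ 2).
  apply: (itg_le (g := fun z => 2 * avgp mu (k N) f z ^+ 2 + 2 * f z ^+ 2)).
  - apply: measurable_funX; apply: measurable_funB => //.
    exact: (measurable_avgp (kN N)).
  - by apply: itgD; apply: itgZ => //; exact: a2.
  - apply: aeW => z; rewrite ger0_norm ?sqr_ge0//.
    by have := sqr_ge0 (avgp mu (k N) f z + f z); nra.
have key N m : \int[rho]_z (avgp mu (k N) f z - f z) ^+ 2 <=
    (4 * m%:R) * \int[rho]_z `|avgp mu (k N) (t m) z - t m z| +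
    8 * \int[rho]_z (r m z ^+ 2).
  have i1 : itg rho (fun z => (4 * m%:R) * `|avgp mu (k N) (t m) z - t m z|).
    by apply/itgZ/itg_abs/itgB => //; exact: (itg_avgp rhoE (kN N)).
  have i2 : itg rho (fun z => 4 * (avgp mu (k N) (fun w => r m w ^+ 2) z)).
    by apply/itgZ; exact: (itg_avgp rhoE (kN N)).
  have i3 : itg rho (fun z => 4 * (r m z ^+ 2)) by exact/itgZ.
  apply: (@le_trans _ _ (\int[rho]_z
    ((4 * m%:R) * `|avgp mu (k N) (t m) z - t m z| +
      (4 * (avgp mu (k N) (fun w => r m w ^+ 2) z) + 4 * (r m z ^+ 2))))).
    apply: le_Rint => //; first by apply: itgD => //; exact: itgD.
    have lin := avgpB_ae rhoE (kN N) fi (ti m).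
    have jen := avgp_sqr_le rhoE (kN N) (mr m) (r2 m).
    have bnd : {ae rho, forall z, `|avgp mu (k N) (t m) z| <= m%:R}.
      apply: aeW => z; rewrite ler_norml; apply: (avg_range (kN N)).
        exact: measurable_fun_pair1 z.2 (mt m).
      by apply: aeW => x; rewrite -ler_norml; exact: clamp_norm.
    apply: filterS3 lin jen bnd => z.
    have := @clamp_norm m%:R (f z) (ler0n _ _).
    rewrite -/(t m z) -/(r m) => tz -> jen bnd.
    set A := avgp mu (k N) f z in jen *; set B := avgp mu (k N) (t m) z in jen bnd *.
    have E : (A - f z) ^+ 2 <= 2 * (B - t m z) ^+ 2 + 4 * (A - B) ^+ 2 +
        4 * (r m z) ^+ 2.
      rewrite /r; have := sqr_ge0 ((B - t m z) - ((A - B) - (f z - t m z))).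
      by have := sqr_ge0 ((A - B) + (f z - t m z)); nra.
    have F : (B - t m z) ^+ 2 <= 2 * m%:R * `|B - t m z|.
      rewrite -[leLHS]real_normK ?num_real// expr2 ler_wpM2r//.
      by rewrite (le_trans (ler_normB _ _))// mulr_natl mulr2n lerD.
    by move: jen E F => /=; lra.
  rewrite (RintD i1 (itgD i2 i3)) (RintD i2 i3).
  have j1 := itg_abs (itgB (itg_avgp rhoE (kN N) (ti m)) (ti m)).
  rewrite (RintZ _ j1) (RintZ _ (itg_avgp rhoE (kN N) (r2 m))) (RintZ _ (r2 m)).
  by rewrite (Rint_avgp rhoE (kN N) (r2 m)); lra.
apply/cvgrPdist_lt => e e0.
have [m _ /(_ m (leqnn m))] : \forall m \near \oo,
    `|0 - \int[rho]_z (r m z ^+ 2)| < e / 16.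
  by move/cvgrPdist_lt : rcv; apply; rewrite divr_gt0.
rewrite sub0r normrN ger0_norm; last by apply: Rint_ge0 => z; exact: sqr_ge0.
move=> rm.
have /cvgrPdist_lt/(_ (e / (8 * m.+1%:R))) := avgp_cvg (ti m).
have em : 0 < e / (8 * m.+1%:R) by rewrite divr_gt0// mulr_gt0.
move=> /(_ em); apply: filterS => N; rewrite !sub0r !normrN ger0_norm; last exact: Rint_ge0.
rewrite ger0_norm; last by apply: Rint_ge0 => z; exact: sqr_ge0.
rewrite ltr_pdivlMr; last by rewrite mulr_gt0.
move=> tm; apply: le_lt_trans (key N m) _.
have := @Rint_ge0 _ _ _ rho (fun z => `|avgp mu (k N) (t m) z - t m z|)
  (fun=> normr_ge0 _).
move: tm rm; rewrite -natr1; set I := \int[rho]_z _; set J := \int[rho]_z _.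
by move=> h1 h2 h3; nra.
Qed.

End MollifierParametric.
Section Tensor.
Context d1 d2 (X : measurableType d1) (Y : measurableType d2) (R : realType).
Variables (rho : {finite_measure set (X * Y)%type -> \bar R})
  (mu : {finite_measure set X -> \bar R})
  (nu : {finite_measure set Y -> \bar R}).
Hypothesis rhoE : is_prod rho mu nu.
Variables (k : nat -> X -> X -> R) (l : nat -> Y -> Y -> R).
Hypotheses (mk : mollifier mu k) (ml : mollifier nu l).

Definition tensor_kernel N (z w : X * Y) : R := k N z.1 w.1 * l N z.2 w.2.

Let kN N : markov_kernel mu (k N). Proof. exact: mol_markov mk N. Qed.
Let lN N : markov_kernel nu (l N). Proof. exact: mol_markov ml N. Qed.

Lemma tensor_markov N : markov_kernel rho (tensor_kernel N).
Proof.
split.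
- apply: measurable_funM.
    apply: (measurableT_comp (markov_meas (kN N)) (measurable_fun_pair _ _)).
      exact: measurableT_comp measurable_fst measurable_fst.
    exact: measurableT_comp measurable_fst measurable_snd.
  apply: (measurableT_comp (markov_meas (lN N)) (measurable_fun_pair _ _)).
    exact: measurableT_comp measurable_snd measurable_fst.
  exact: measurableT_comp measurable_snd measurable_snd.
- move=> z w; apply: mulr_ge0.
    exact: (markov_ge0 (kN N)).
  exact: (markov_ge0 (lN N)).
- have [C kC] := kernel_norm (kN N); have [D lD] := kernel_norm (lN N).
  exists (C * D) => z w; apply: (le_trans (ler_norm _)).
  by rewrite normrM ler_pM.
- move=> [x y]; have ki := itg_kernel_row (kN N) x.
  have li := itg_kernel_row (lN N) y.
  rewrite (Rfubini1 rhoE); last exact: (itg_tensor rhoE ki li).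
  rewrite /tensor_kernel/=.
  under eq_Rintegral do rewrite RintZ// (markov_row (lN N)) mulr1.
  exact: (markov_row (kN N)).
- move=> [x y].
  have ki : itg mu (k N ^~ x).
    have [C kC] := kernel_norm (kN N); apply: (itg_bounded (C := C)).
      exact: measurable_fun_pair1 x (markov_meas (kN N)).
    exact: aeW.
  have li : itg nu (l N ^~ y).
    have [C lC] := kernel_norm (lN N); apply: (itg_bounded (C := C)).
      exact: measurable_fun_pair1 y (markov_meas (lN N)).
    exact: aeW.
  rewrite (Rfubini1 rhoE); last exact: (itg_tensor rhoE ki li).
  rewrite /tensor_kernel/=.
  under eq_Rintegral do rewrite RintZ// (markov_col (lN N)) mulr1.
  exact: (markov_col (kN N)).
Qed.

Let swp (f : X * Y -> R) (w : Y * X) := f (w.2, w.1).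

Let itg_unswap (g : Y * X -> R) : itg (prodm nu mu) g ->
  itg rho (fun z => g (z.2, z.1)).
Proof.
move=> gi; have := itg_swap (is_prod_prodm nu mu) gi.
by move/(itg_prod (is_prod_prodm mu nu) _).1 => /(itg_prod rhoE _).2.
Qed.

(** Averaging over a product is averaging over one factor after the other, and
    averages are contractions. *)
Lemma tensor_mollifier : mollifier rho tensor_kernel.
Proof.
split; first exact: tensor_markov.
move=> f fi.
have sfi := itg_swap rhoE fi.
pose B N (z : X * Y) := avgp nu (l N) (swp f) (z.2, z.1).
have Bi N : itg rho (B N).
  exact: itg_unswap (itg_avgp (is_prod_prodm nu mu) (lN N) sfi).
have Bcv : \int[rho]_z `|B N z - f z| @[N --> \oo] --> (0 : R).
  have := avgp_cvg (is_prod_prodm nu mu) ml sfi.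
  apply: cvg_trans; apply: near_eq_cvg; apply: nearW => N /=.
  by rewrite (Rint_swap rhoE); [|exact/itg_abs/itgB].
have E N : {ae rho, forall z, avg rho (tensor_kernel N) f z =
    avgp mu (k N) (fun z => B N z - f z) z + avgp mu (k N) f z}.
  apply: filterS (avgpB_ae rhoE (kN N) (Bi N) fi) => z ->; rewrite subrK.
  case: z => x y.
  rewrite /avg (Rfubini1 rhoE); last exact: (itg_row (tensor_markov N)).
  rewrite /avgp/=; apply: eq_Rintegral_ae.
  apply: filterS (itg_slice1 rhoE fi) => x' fx'.
  rewrite /tensor_kernel /B /avgp /avg /swp/= -RintZ; last exact: (itg_row (lN N)).
  by apply: eq_Rintegral => y' _; rewrite mulrA.
have Ai N : itg rho (avg rho (tensor_kernel N) f).
  exact: (itg_avg (tensor_markov N)).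
apply: (@squeeze_cvgr _ _ _ _ (cst 0) (fun N =>
    \int[rho]_z `|B N z - f z| + \int[rho]_z `|avgp mu (k N) f z - f z|)).
- apply: nearW => N; rewrite Rint_ge0//=.
  have Gi := itgB (Bi N) fi.
  have g1 := itg_avgp rhoE (kN N) Gi; have g2 := itg_avgp rhoE (kN N) fi.
  apply: (le_trans _ (lerD (avgp_contraction rhoE (kN N) Gi) (lexx _))).
  rewrite -RintD; [|exact: itg_abs|exact/itg_abs/itgB].
  apply: le_Rint.
  + exact/itg_abs/itgB.
  + by apply: itgD; [exact: itg_abs|exact/itg_abs/itgB].
  + by apply: filterS (E N) => z ->; rewrite -addrA ler_normD.
- exact: cvg_cst.
- rewrite -[X in _ --> X]addr0; apply: cvgD => //.
  exact: (avgp_cvg rhoE mk fi).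
Qed.

End Tensor.

(** * Limits of integrals of products *)

Section Limits.
Context d (T : measurableType d) (R : realType).
Variable mu : {finite_measure set T -> \bar R}.

(** With a and b the two errors, the error of the product is ab + fb + ag, and
    |uv| <= e u^2 + v^2 / e bounds the mixed terms. *)
Lemma L2_mul_cvg (f_ g_ : nat -> T -> R) (f g : T -> R) :
  (forall N, measurable_fun setT (f_ N)) -> (forall N, measurable_fun setT (g_ N)) ->
  measurable_fun setT f -> measurable_fun setT g ->
  (forall N, itg mu (fun x => f_ N x ^+ 2)) ->
  (forall N, itg mu (fun x => g_ N x ^+ 2)) ->
  itg mu (fun x => f x ^+ 2) -> itg mu (fun x => g x ^+ 2) ->
  \int[mu]_x (f_ N x - f x) ^+ 2 @[N --> \oo] --> (0 : R) ->
  \int[mu]_x (g_ N x - g x) ^+ 2 @[N --> \oo] --> (0 : R) ->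
  \int[mu]_x `|f_ N x * g_ N x - f x * g x| @[N --> \oo] --> (0 : R).
Proof.
move=> mf_ mg_ mf mg if_ ig_ fi gi fcv gcv.
have sqB (u v : T -> R) : measurable_fun setT u -> measurable_fun setT v ->
    itg mu (fun x => u x ^+ 2) -> itg mu (fun x => v x ^+ 2) ->
    itg mu (fun x => (u x - v x) ^+ 2).
  move=> mu' mv iu iv; apply: (itg_le (g := fun x => 2 * u x ^+ 2 + 2 * v x ^+ 2)).
  - by apply: measurable_funX; exact: measurable_funB.
  - by apply: itgD; exact: itgZ.
  - apply: aeW => x; rewrite ger0_norm ?sqr_ge0//.
    by have := sqr_ge0 (u x + v x); nra.
have iF N : itg mu (fun x => (f_ N x - f x) ^+ 2) by exact: sqB.
have iG N : itg mu (fun x => (g_ N x - g x) ^+ 2) by exact: sqB.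
pose F := \int[mu]_x f x ^+ 2; pose G := \int[mu]_x g x ^+ 2.
have F0 : 0 <= F by apply: Rint_ge0 => x; exact: sqr_ge0.
have G0 : 0 <= G by apply: Rint_ge0 => x; exact: sqr_ge0.
have key N e : 0 < e -> \int[mu]_x `|f_ N x * g_ N x - f x * g x| <=
    (1 + e^-1) * \int[mu]_x (f_ N x - f x) ^+ 2 +
    ((1 + e^-1) * \int[mu]_x (g_ N x - g x) ^+ 2 + e * (F + G)).
  move=> e0; have e1 : 0 < e^-1 by rewrite invr_gt0.
  have j1 := itgZ (1 + e^-1) (iF N); have j2 := itgZ (1 + e^-1) (iG N).
  have j3 := itgZ e (itgD fi gi).
  rewrite /F /G -(RintD fi gi) -(RintZ e (itgD fi gi)) -(RintZ _ (iF N)).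
  rewrite -(RintZ _ (iG N)) -(RintD j2 j3) -(RintD j1 (itgD j2 j3)).
  apply: le_Rint.
  - by apply/itg_abs/itgB; exact: itg_sqrM.
  - exact: itgD j1 (itgD j2 j3).
  - apply: aeW => x.
    set a := f_ N x - f x; set b := g_ N x - g x.
    have -> : f_ N x * g_ N x - f x * g x = a * b + (f x * b + a * g x).
      by rewrite /a /b; ring.
    have Y u v : `|u * v| <= u ^+ 2 + v ^+ 2 :> R.
      rewrite normrM -[u ^+ 2]real_normK ?num_real// -[v ^+ 2]real_normK ?num_real//.
      by have := normr_ge0 u; have := normr_ge0 v; nra.
    have Z u v : `|u * v| <= e * u ^+ 2 + e^-1 * v ^+ 2 :> R.
      have : 0 <= e * (`|u| - e^-1 * `|v|) ^+ 2 by rewrite mulr_ge0 ?sqr_ge0// ltW.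
      rewrite normrM -[u ^+ 2]real_normK ?num_real// -[v ^+ 2]real_normK ?num_real//.
      have -> : e * (`|u| - e^-1 * `|v|) ^+ 2 =
          e * `|u| ^+ 2 - 2 * (`|u| * `|v|) + e^-1 * `|v| ^+ 2.
        by field; rewrite gt_eqF.
      by have := normr_ge0 u; have := normr_ge0 v; nra.
    apply: (le_trans (ler_normD _ _)); have := Y a b; have := Z (f x) b.
    have := Z (g x) a; rewrite (mulrC (g x)); have := ler_normD (f x * b) (a * g x).
    lra.
apply/cvgrPdist_lt => e e0.
(* The mixed terms contribute h (F + G), which must stay below e / 2. *)
pose h := e / (2 * (F + G + 1)).
have FG : 0 < 2 * (F + G + 1) by nra.
have h0 : 0 < h by rewrite divr_gt0.
have hFG : h * (F + G) < e / 2.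
  rewrite /h; have -> : e / (2 * (F + G + 1)) * (F + G) = e / 2 * ((F + G) / (F + G + 1)).
    by field; rewrite gt_eqF//; nra.
  rewrite gtr_pMr ?divr_gt0// ltr_pdivrMr; nra.
have c0 : 0 < e / (4 * (1 + h^-1)).
  by rewrite divr_gt0// mulr_gt0// addr_gt0// invr_gt0.
move/cvgrPdist_lt/(_ _ c0) : fcv => fcv; move/cvgrPdist_lt/(_ _ c0) : gcv => gcv.
apply: filterS2 fcv gcv => N; rewrite !sub0r !normrN.
rewrite ger0_norm; last by apply: Rint_ge0 => x; exact: sqr_ge0.
rewrite ger0_norm; last by apply: Rint_ge0 => x; exact: sqr_ge0.
rewrite ger0_norm; last exact: Rint_ge0.
have h1 : 0 < 4 * (1 + h^-1) by rewrite mulr_gt0// addr_gt0// invr_gt0.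
rewrite !ltr_pdivlMr// => fN gN; apply: le_lt_trans (key N h h0) _.
lra.
Qed.

(** Uniform continuity on a square, in a form that integrates: the slope C is
    found by compactness, since away from the diagonal the distance is positive. *)
Lemma affine_modulus (G : R * R -> R) (m : R) : continuous G ->
  forall e, 0 < e -> exists2 C, 0 <= C & forall a b a' b' : R,
    `|a| <= m -> `|b| <= m -> `|a'| <= m -> `|b'| <= m ->
    `|G (a, b) - G (a', b')| <= e + C * (`|a - a'| + `|b - b'|).
Proof.
move=> cG e e0.
pose I : set R := `[- m, m]%classic; pose K := (I `*` I) `*` (I `*` I).
have cK : compact K.
  by do 2![apply: compact_setX]; exact: segment_compact.
pose V (z : (R * R) * (R * R)) := `|G z.1 - G z.2|.
pose D (z : (R * R) * (R * R)) := `|z.1.1 - z.2.1| + `|z.1.2 - z.2.2|.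
have cV : continuous V.
  move=> z; apply: cvg_norm; apply: cvgB.
    by apply: continuous_comp; [exact: cvg_fst|exact: cG].
  by apply: continuous_comp; [exact: cvg_snd|exact: cG].
have cD : continuous D.
  have c1 (h : (R * R) * (R * R) -> R) (h' : (R * R) * (R * R) -> R) :
      continuous h -> continuous h' -> continuous (fun z => `|h z - h' z|).
    by move=> ch ch' z; apply: cvg_norm; apply: cvgB; [exact: ch|exact: ch'].
  move=> z; apply: cvgD; apply: c1 => {}z.
  - by apply: (@continuous_comp _ _ _ fst fst); exact: cvg_fst.
  - by apply: (@continuous_comp _ _ _ snd fst); [exact: cvg_snd|exact: cvg_fst].
  - by apply: (@continuous_comp _ _ _ fst snd); [exact: cvg_fst|exact: cvg_snd].
  - by apply: (@continuous_comp _ _ _ snd snd); exact: cvg_snd.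
have D0 z : 0 <= D z by rewrite addr_ge0.
have /compact_near_coveringP cov := cK.
have [n _ /(_ n (leqnn n)) Kn] : \forall n \near \oo, K `<=` (fun z => V z <= e + n%:R * D z).
  apply: cov => z Kz.
  have [Ve|Ve] := ltP (V z) e.
    near=> z' n => /=; have : V z' < e.
      by near: z'; apply: (cvgr_lt (V z)) => //; exact: cV.
    by have := D0 z'; have : 0 <= n%:R :> R by []; nra.
  have Dz : 0 < D z.
    rewrite lt_neqAle D0 andbT eq_sym; apply/eqP => Dz.
    have : z.1 = z.2.
      move: Dz => /eqP; rewrite paddr_eq0// !normr_eq0 !subr_eq0 => /andP[/eqP h1 /eqP h2].
      by case: (z) h1 h2 => -[? ?] [? ?] /= -> ->.
    by move=> zz; move: Ve; rewrite /V zz subrr normr0 leNgt e0.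
  near=> z' n => /=.
  have h1 : V z' < V z + 1.
    near: z'; apply: (cvgr_lt (V z)); [exact: cV|by rewrite ltrDl].
  have h2 : D z / 2 < D z'.
    near: z'; apply: (cvgr_gt (D z)); [exact: cD|by rewrite gtr_pMr// invf_lt1// ltr1n].
  have h3 : (V z + 1) / (D z / 2) <= n%:R by near: n; exact: nbhs_infty_ger.
  move: h3; rewrite ler_pdivrMr ?divr_gt0// => h3.
  by have : 0 <= n%:R :> R by []; nra.
exists n%:R => // a b a' b' ha hb ha' hb'.
by apply: (Kn ((a, b), (a', b'))); do 2?split => /=;
  rewrite /I/= in_itv/= -ler_norml.
Unshelve. all: by end_near.
Qed.

Let scaled_bound (e A C : R) : 0 <= A -> A * (32 * (C + 1)) < e -> C * A < e / 32.
Proof. by move=> A0; rewrite (_ : A * _ = 32 * (C * A) + 32 * A); [lra|ring]. Qed.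

(** Continuous functions of sequences converging in the mean within a bounded
    range: uniform continuity gives an affine modulus, and a truncation of the
    weight makes it bounded. *)
Lemma Rint_comp_cvg (a_ b_ w_ : nat -> T -> R) (a b w : T -> R)
    (G : R * R -> R) (m : R) :
  (forall N, measurable_fun setT (a_ N)) -> (forall N, measurable_fun setT (b_ N)) ->
  measurable_fun setT a -> measurable_fun setT b ->
  (forall N x, `|a_ N x| <= m) -> (forall N x, `|b_ N x| <= m) ->
  (forall x, `|a x| <= m) -> (forall x, `|b x| <= m) ->
  \int[mu]_x `|a_ N x - a x| @[N --> \oo] --> (0 : R) ->
  \int[mu]_x `|b_ N x - b x| @[N --> \oo] --> (0 : R) ->
  continuous G -> measurable_fun setT G ->
  (forall N, itg mu (w_ N)) -> itg mu w ->
  \int[mu]_x `|w_ N x - w x| @[N --> \oo] --> (0 : R) ->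
  \int[mu]_x (G (a_ N x, b_ N x) * w_ N x) @[N --> \oo] -->
    \int[mu]_x (G (a x, b x) * w x).
Proof.
move=> ma_ mb_ ma mb a_m b_m am bm acv bcv cG mG wi_ wi wcv.
have pm (u v : T -> R) : measurable_fun setT u -> measurable_fun setT v ->
    measurable_fun setT (fun x => G (u x, v x)).
  by move=> mu' mv; exact: (measurableT_comp mG (measurable_fun_pair mu' mv)).
have [C1 C10 GC1] := affine_modulus m cG ltr01.
pose M := `|G (0, 0)| + 1 + C1 * (m + m).
have GM u v : `|u| <= m -> `|v| <= m -> `|G (u, v)| <= M.
  move=> um vm; have m0 : 0 <= m := le_trans (normr_ge0 _) um.
  have := GC1 u v 0 0 um vm; rewrite normr0 !subr0 => /(_ m0 m0) h.
  have := ler_normD (G (u, v) - G (0, 0)) (G (0, 0)); rewrite subrK => h'.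
  by apply: (le_trans h'); rewrite /M; nra.
have {}GM u v : `|u| <= m -> `|v| <= m -> `|G (u, v)| <= `|M|.
  by move=> um vm; rewrite (le_trans (GM _ _ um vm))// ler_norm.
set M' := `|M| in GM; have M0 : 0 <= M' by exact: normr_ge0.
pose g_ N x := G (a_ N x, b_ N x); pose g x := G (a x, b x).
have mg_ N : measurable_fun setT (g_ N) by exact: pm.
have mg : measurable_fun setT g by exact: pm.
have g_M N x : `|g_ N x| <= M' by exact: GM.
have gM x : `|g x| <= M' by exact: GM.
have ig_w N : itg mu (fun x => g_ N x * w_ N x).
  by apply: (itg_bM (C := M')) => //; exact: aeW.
have igw : itg mu (fun x => g x * w x).
  by apply: (itg_bM (C := M')) => //; exact: aeW.
have ai N : itg mu (fun x => `|a_ N x - a x|).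
  apply: (itg_bounded (C := m + m)).
    by apply: measurableT_comp => //; exact: measurable_funB.
  by apply: aeW => x; rewrite normr_id (le_trans (ler_normB _ _))// lerD.
have bi N : itg mu (fun x => `|b_ N x - b x|).
  apply: (itg_bounded (C := m + m)).
    by apply: measurableT_comp => //; exact: measurable_funB.
  by apply: aeW => x; rewrite normr_id (le_trans (ler_normB _ _))// lerD.
(* The part of the weight above the level L. *)
pose r L x := Num.max (`|w x| - L%:R) 0.
have mw := itgM wi.
have mr L : measurable_fun setT (r L).
  apply: measurable_maxr => //; apply: measurable_funB => //.
  exact: measurableT_comp.
have rw L x : `|r L x| <= `|w x|.
  rewrite ger0_norm /r ?le_max ?lexx ?orbT// ge_max normr_ge0 andbT.
  by have : 0 <= L%:R :> R by []; lra.
have ri L : itg mu (r L).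
  by apply: itg_le (itg_abs wi) _ => //; exact: aeW.
have rcv : \int[mu]_x r L x @[L --> \oo] --> (0 : R).
  have [] := @Rint_dominated _ _ _ mu r (cst 0) (fun x => `|w x|).
  - by [].
  - exact: measurable_cst.
  - exact: itg_abs.
  - apply: aeW => x; apply: cvg_near_cst.
    have [L0 _ hL] : \forall L \near \oo, `|w x| <= L%:R :> R.
      exact: nbhs_infty_ger.
    by exists L0 => // L /hL h; rewrite /r max_r// subr_le0.
  - by apply: aeW => x n.
  by move=> _ _; rewrite Rintegral_cst// mul0r.
pose V := fine (mu setT).
have V0 : 0 <= V by exact: fine_ge0.
have key N L e C : 0 <= C -> (forall p q p' q' : R,
    `|p| <= m -> `|q| <= m -> `|p'| <= m -> `|q'| <= m ->
    `|G (p, q) - G (p', q')| <= e + C * (`|p - p'| + `|q - q'|)) ->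
    `|\int[mu]_x (g_ N x * w_ N x) - \int[mu]_x (g x * w x)| <=
    M' * \int[mu]_x `|w_ N x - w x| +
    (L%:R * (e * V + C * (\int[mu]_x `|a_ N x - a x| + \int[mu]_x `|b_ N x - b x|)) +
    2 * M' * \int[mu]_x r L x).
  move=> C0 Gmod.
  have j1 := itgZ M' (itg_abs (itgB (wi_ N) wi)).
  have j2 := itgZ C (itgD (ai N) (bi N)).
  have j3 := itgZ L%:R (itgD (itg_cst mu e) j2).
  have j4 := itgZ (2 * M') (ri L).
  have -> : e * V = \int[mu]_x e by rewrite Rintegral_cst.
  rewrite -(RintD (ai N) (bi N)) -(RintZ C (itgD (ai N) (bi N))).
  rewrite -(RintD (itg_cst mu e) j2) -(RintZ _ (itgD (itg_cst mu e) j2)).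
  rewrite -(RintZ _ (ri L)) -(RintZ _ (itg_abs (itgB (wi_ N) wi))).
  rewrite -(RintD j3 j4) -(RintD j1 (itgD j3 j4)) -(RintB (ig_w N) igw).
  apply: (le_trans (Rint_norm (itgB (ig_w N) igw))).
  apply: le_Rint; first exact: itg_abs (itgB (ig_w N) igw).
    exact: itgD j1 (itgD j3 j4).
  apply: aeW => x.
  have -> : g_ N x * w_ N x - g x * w x =
      g_ N x * (w_ N x - w x) + (g_ N x - g x) * w x by ring.
  apply: (le_trans (ler_normD _ _)); rewrite !normrM; apply: lerD.
    by rewrite ler_wpM2r.
  have h1 := Gmod _ _ _ _ (a_m N x) (b_m N x) (am x) (bm x).
  rewrite -/(g_ N x) -/(g x) in h1.
  have h2 : `|g_ N x - g x| <= 2 * M'.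
    by rewrite (le_trans (ler_normB _ _))// mulr_natl mulr2n lerD.
  have h3 : `|w x| <= L%:R + r L x.
    by rewrite -lerBlDl /r le_max lexx.
  have h4 : 0 <= r L x by rewrite /r le_max lexx orbT.
  have L0 : 0 <= L%:R :> R by [].
  apply: (le_trans (ler_wpM2l (normr_ge0 _) h3)).
  by rewrite mulrDr lerD// ?(mulrC _ L%:R) ?ler_wpM2l// ler_wpM2r.
apply/cvgrPdist_lt => e e0.
have [L _ /(_ L (leqnn L))] : \forall L \near \oo,
    `|0 - \int[mu]_x r L x| < e / (8 * (M' + 1)).
  by move/cvgrPdist_lt : rcv; apply; rewrite divr_gt0// mulr_gt0// ltr_wpDl.
rewrite sub0r normrN ltr_pdivlMr; last by rewrite mulr_gt0// ltr_wpDl.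
move=> rL; have {}rL : 2 * M' * \int[mu]_x r L x < e / 2.
  have r0 : 0 <= \int[mu]_x r L x.
    by apply: Rint_ge0 => x; rewrite /r le_max lexx orbT.
  by move: rL; rewrite ger0_norm//; nra.
have LV : 0 < 8 * (L%:R * V + 1) :> R by rewrite mulr_gt0// ltr_wpDl// mulr_ge0.
pose e' := e / (8 * (L%:R * V + 1)).
have e'0 : 0 < e' by rewrite divr_gt0.
have Le' : L%:R * (e' * V) < e / 8.
  rewrite /e' (_ : _ * _ = (e / 8) * (L%:R * V / (L%:R * V + 1))); last first.
    by field; move: LV; rewrite pmulr_rgt0// => /gt_eqF ->.
  rewrite gtr_pMr ?divr_gt0// ltr_pdivrMr; last by move: LV; rewrite pmulr_rgt0.
  by rewrite mul1r ltrDl.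
have [C C0 Gmod] := affine_modulus m cG e'0.
have LC : 0 < 32 * (L%:R * C + 1) :> R by rewrite mulr_gt0// ltr_wpDl// mulr_ge0.
have c1 : 0 < e / (32 * (L%:R * C + 1)) by rewrite divr_gt0.
have MC : 0 < 32 * (M' + 1) by rewrite mulr_gt0// ltr_wpDl.
have c2 : 0 < e / (32 * (M' + 1)) by rewrite divr_gt0.
move/cvgrPdist_lt/(_ _ c1) : acv => acv; move/cvgrPdist_lt/(_ _ c1) : bcv => bcv.
move/cvgrPdist_lt/(_ _ c2) : wcv => wcv.
apply: filterS3 acv bcv wcv => N; rewrite !sub0r !normrN.
do 3![rewrite ger0_norm; last exact: Rint_ge0]; rewrite !ltr_pdivlMr//.
have A0 : 0 <= \int[mu]_x `|a_ N x - a x| by exact: Rint_ge0.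
have B0 : 0 <= \int[mu]_x `|b_ N x - b x| by exact: Rint_ge0.
have W0 : 0 <= \int[mu]_x `|w_ N x - w x| by exact: Rint_ge0.
move: A0 B0 W0; set A := \int[mu]_x _; set B := \int[mu]_x _.
set W := \int[mu]_x _ => A0 B0 W0 hA hB hW.
rewrite distrC; apply: le_lt_trans (key N L e' C C0 Gmod) _; rewrite -/A -/B -/W.
have L0 : 0 <= L%:R :> R by [].
have h1 := scaled_bound W0 hW; have h2 := scaled_bound A0 hA; have h3 := scaled_bound B0 hB.
move: Le' rL h1 h2 h3; set J := \int[mu]_x _; lra.
Qed.

End Limits.
(** * Smooth functions of one variable *)

Section OneVariable.
Variable R : realType.
Implicit Types (f g : R -> R).

Definition deriv1 f f' : Prop := forall x : R, is_derive x 1 f (f' x).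

Lemma deriv1_continuous f f' : deriv1 f f' -> continuous f.
Proof.
move=> df x; apply/differentiable_continuous/derivable1_diffP.
by have [] := df x.
Qed.

Lemma deriv1D f f' g g' : deriv1 f f' -> deriv1 g g' ->
  deriv1 (fun x => f x + g x) (fun x => f' x + g' x).
Proof. by move=> df dg x; have := is_deriveD (df x) (dg x). Qed.

Lemma deriv1M f f' g g' : deriv1 f f' -> deriv1 g g' ->
  deriv1 (fun x => f x * g x) (fun x => f' x * g x + f x * g' x).
Proof.
move=> df dg x; have := is_deriveM (df x) (dg x).
by move=> /is_derive_eq; apply; rewrite /GRing.scale/= addrC (mulrC (g x)).
Qed.

Lemma deriv1_comp f f' g g' : deriv1 f f' -> deriv1 g g' ->
  deriv1 (fun x => f (g x)) (fun x => f' (g x) * g' x).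
Proof. by move=> df dg x; exact: is_derive1_comp. Qed.

Lemma deriv1_cst c : deriv1 (fun=> c) (fun=> 0).
Proof. by move=> x; exact: is_derive_cst. Qed.

Lemma deriv1_id : deriv1 (fun x => x) (fun=> 1).
Proof. by move=> x; exact: is_derive_id. Qed.

Lemma deriv1Z k f f' : deriv1 f f' -> deriv1 (fun x => k * f x) (fun x => k * f' x).
Proof.
move=> df x; have := deriv1M (deriv1_cst k) df x.
by move/is_derive_eq; apply; rewrite mul0r add0r.
Qed.

Lemma deriv1N f f' : deriv1 f f' -> deriv1 (fun x => - f x) (fun x => - f' x).
Proof. by move=> df x; have := is_deriveN (df x). Qed.

Lemma eq_deriv1 f g f' g' : f =1 g -> f' =1 g' -> deriv1 f f' -> deriv1 g g'.
Proof. by move=> /funext -> /funext ->. Qed.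

Fixpoint Cn (m : nat) f : Prop := continuous f /\
  if m is m'.+1 then exists2 f', deriv1 f f' & Cn m' f' else True.

Lemma CnS m f f' : deriv1 f f' -> Cn m f' -> Cn m.+1 f.
Proof. by move=> df cf'; split; [exact: deriv1_continuous df|exists f']. Qed.

Lemma Cn_pred m f : Cn m.+1 f -> Cn m f.
Proof.
elim: m f => [|m IH] f [cf [f' df cf']]; first by split.
by split => //; exists f' => //; exact: IH.
Qed.

Lemma Cn_cst m c : Cn m (fun=> c).
Proof.
elim: m c => [|m IH] c; first by split => // x; exact: cvg_cst.
by apply: CnS (deriv1_cst c) _; exact: IH.
Qed.

Lemma CnD m f g : Cn m f -> Cn m g -> Cn m (fun x => f x + g x).
Proof.
elim: m f g => [|m IH] f g [cf df] [cg dg].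
  by split => // x; exact: cvgD (cf x) (cg x).
move: df dg => [f' df cf'] [g' dg cg'].
by apply: CnS (deriv1D df dg) _; exact: IH.
Qed.

Lemma CnM m f g : Cn m f -> Cn m g -> Cn m (fun x => f x * g x).
Proof.
elim: m f g => [|m IH] f g Cf Cg.
  by split => // x; exact: cvgM (Cf.1 x) (Cg.1 x).
move: (Cf) (Cg) => [_ [f' df cf']] [_ [g' dg cg']].
apply: CnS (deriv1M df dg) _.
by apply: CnD; apply: IH => //; exact: Cn_pred.
Qed.

Lemma Cn_comp m f g : Cn m f -> Cn m g -> Cn m (fun x => f (g x)).
Proof.
elim: m f g => [|m IH] f g Cf Cg.
  by split => // x; exact: (continuous_comp (Cg.1 x) (Cf.1 (g x))).
move: (Cf) (Cg) => [_ [f' df cf']] [_ [g' dg cg']].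
apply: CnS (deriv1_comp df dg) _.
by apply: CnM => //; apply: IH => //; exact: Cn_pred.
Qed.

Definition smooth1 f : Prop := forall m, Cn m f.

Lemma smooth1_deriv f f' : deriv1 f f' -> smooth1 f -> smooth1 f'.
Proof.
move=> df sf m; have [_ [g dg cg]] := sf m.+1.
rewrite (_ : f' = g)//; apply/funext => x.
by rewrite -(@derive_val _ _ _ _ _ _ _ (df x)) -(@derive_val _ _ _ _ _ _ _ (dg x)).
Qed.

Lemma smooth1_ex f : smooth1 f -> exists2 f', deriv1 f f' & smooth1 f'.
Proof.
move=> sf; have [_ [f' df _]] := sf 1%N; exists f' => //.
exact: smooth1_deriv df sf.
Qed.

Lemma smooth1_cst c : smooth1 (fun=> c). Proof. by move=> m; exact: Cn_cst. Qed.

Lemma smooth1D f g : smooth1 f -> smooth1 g -> smooth1 (fun x => f x + g x).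
Proof. by move=> sf sg m; exact: CnD. Qed.

Lemma smooth1M f g : smooth1 f -> smooth1 g -> smooth1 (fun x => f x * g x).
Proof. by move=> sf sg m; exact: CnM. Qed.

Lemma smooth1_comp f g : smooth1 f -> smooth1 g -> smooth1 (fun x => f (g x)).
Proof. by move=> sf sg m; exact: Cn_comp. Qed.

Lemma smooth1_id : smooth1 (fun x => x).
Proof.
case=> [|m]; first by split => // x; exact: cvg_id.
by apply: CnS deriv1_id _; exact: Cn_cst.
Qed.

Lemma smooth1_expR : smooth1 expR.
Proof.
elim=> [|m IH]; first by split => //; exact: continuous_expR.
by apply: CnS IH => x; exact: is_derive_expR.
Qed.

Lemma smooth1_cos : smooth1 cos.
Proof.
suff H : forall m, Cn m (cos : R -> R) /\ Cn m (sin : R -> R) by move=> m; have [] := H m.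
elim=> [|m [IH1 IH2]].
  by split; split => //; [exact: continuous_cos|exact: continuous_sin].
split; last by apply: CnS IH1 => x; exact: is_derive_sin.
apply: (@CnS _ _ (fun x => -1 * sin x)).
  by move=> x; rewrite mulN1r; exact: is_derive_cos.
by apply: CnM => //; exact: Cn_cst.
Qed.

(** The functions x^(-p) exp(-1/x), extended by 0: this family is closed under
    differentiation, which is how exp(-1/x) is seen to be smooth. *)
Definition flatp (p : nat) (x : R) : R :=
  if 0 < x then x^-1 ^+ p * expR (- x^-1) else 0.

Definition flat : R -> R := flatp 0.

Lemma flatp_gt0 p x : 0 < x -> 0 < flatp p x.
Proof. by move=> x0; rewrite /flatp x0 mulr_gt0 ?expR_gt0// exprn_gt0 ?invr_gt0. Qed.

Lemma flatp_le0 p x : x <= 0 -> flatp p x = 0.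
Proof. by move=> x0; rewrite /flatp ltNge x0. Qed.

Lemma flatp_ge0 p x : 0 <= flatp p x.
Proof.
by have [x0|x0] := lerP x 0; [rewrite flatp_le0|exact/ltW/flatp_gt0].
Qed.

Lemma flatp_small p : exists2 C, 0 < C & forall x, flatp p x <= C * `|x|.
Proof.
exists ((p.+1)`!%:R); first by rewrite ltr0n fact_gt0.
move=> x; have [x0|x0] := lerP x 0.
  by rewrite flatp_le0// mulr_ge0.
rewrite /flatp x0 gtr0_norm//.
have y0 : 0 < x^-1 by rewrite invr_gt0.
have F0 : 0 < (p.+1)`!%:R :> R by rewrite ltr0n fact_gt0.
have h : x^-1 ^+ p.+1 <= (p.+1)`!%:R * expR x^-1.
  rewrite mulrC -ler_pdivrMr//.
  by apply: le_trans (expR_ge1Dxn p (ltW y0)); rewrite lerDr.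
rewrite expRN ler_pdivrMr ?expR_gt0// mulrAC.
have -> : x^-1 ^+ p = x^-1 ^+ p.+1 * x by rewrite exprSr mulfVK// gt_eqF.
by rewrite ler_wpM2r// ltW.
Qed.

Lemma flatp_deriv p : deriv1 (flatp p) (fun x => flatp p.+2 x - p%:R * flatp p.+1 x).
Proof.
move=> x; have [x0|x0|->] := ltgtP x 0.
- rewrite !flatp_le0 ?ltW// mulr0 subr0.
  apply: (@near_eq_is_derive _ _ _ (cst 0)).
  near=> y; rewrite flatp_le0// ltW//; near: y; exact: lt_nbhsl.
- have xN : x != 0 by rewrite gt_eqF.
  have nE : \near x, (fun x => x^-1 ^+ p * expR (- x^-1)) x = flatp p x.
    near=> y; rewrite /flatp ifT//; near: y; exact: lt_nbhsr.
  have dV : is_derive x 1 (fun y : R => y^-1) (- x^-1 ^+ 2).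
    have := is_deriveV xN (is_derive_id x (1 : R)).
    by move/is_derive_eq; apply; rewrite /GRing.scale/= mulr1 exprVn.
  have dE : is_derive x 1 (fun y : R => expR (- y^-1)) (expR (- x^-1) * (x^-1 ^+ 2)).
    have dN : is_derive x 1 (fun y : R => - y^-1) (x^-1 ^+ 2).
      by have := is_deriveN dV; rewrite opprK.
    by have := @is_derive1_comp R expR (fun y => - y^-1) x _ _
      (is_derive_expR (- x^-1)) dN.
  have dX := is_deriveX p dV.
  apply: (near_eq_is_derive nE).
  have H := is_deriveM dX dE.
  rewrite (_ : (fun x => x^-1 ^+ p * expR (- x^-1)) =
    (fun y : R => y^-1) ^+ p * (fun y : R => expR (- y^-1))); last first.
    by apply/funext => y; rewrite !fctE.
  apply: (is_derive_eq H).
  rewrite /flatp x0 /GRing.scale/= /GRing.scale/=.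
  rewrite [X in X * _ + _](_ : _ = x^-1 ^+ p); last by rewrite !fctE.
  case: p {dX H nE} => [|p]; first by rewrite !mul0r expr0 !mul1r; ring.
  by rewrite /= !exprS; ring.
- rewrite !flatp_le0// mulr0 subr0.
  suff H : h^-1 *: ((flatp p \o shift 0) (h *: (1 : R)) - flatp p 0) @[h --> 0^'] --> (0 : R).
    by apply: DeriveDef; [apply/cvg_ex; exists 0|exact/cvg_lim].
  have [C C0 hC] := flatp_small p.+1.
  apply/cvgrPdist_le => e e0; near=> h.
  rewrite sub0r normrN /= addr0 (flatp_le0 p (lexx 0)) subr0 /GRing.scale/= mulr1.
  have [h0|h0] := lerP h 0; first by rewrite flatp_le0// mulr0 normr0 ltW.
  rewrite (_ : h^-1 * _ = flatp p.+1 h); last by rewrite /flatp h0 exprS mulrA.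
  rewrite ger0_norm ?flatp_ge0// (le_trans (hC h))// mulrC -ler_pdivlMr//.
  near: h; apply: dnbhs0_le; exact: divr_gt0.
Unshelve. all: by end_near.
Qed.

Lemma smooth1_flat : smooth1 flat.
Proof.
suff H : forall m p, Cn m (flatp p) by move=> m; exact: H.
elim=> [|m IH] p; first by split => //; exact: deriv1_continuous (flatp_deriv p).
apply: CnS (flatp_deriv p) _.
apply: (@CnD _ (flatp p.+2) (fun x => - (p%:R * flatp p.+1 x))); first exact: IH.
rewrite (_ : (fun x => _) = (fun x => (- p%:R) * flatp p.+1 x)).
  by apply: CnM; [exact: Cn_cst|exact: IH].
by apply/funext => x; rewrite mulNr.
Qed.

Lemma flat_nondecreasing x y : x <= y -> flat x <= flat y.
Proof.
move=> xy; have [x0|x0] := lerP x 0; first by rewrite /flat flatp_le0// flatp_ge0.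
have y0 : 0 < y := lt_le_trans x0 xy.
by rewrite /flat /flatp x0 y0 !expr0 !mul1r ler_expR lerN2 lef_pV2.
Qed.

End OneVariable.
(** * The circle and its smooth averaging kernels *)

Section IntervalMeasures.
Variable R : realType.
Notation leb := (@lebesgue_measure R).

Lemma leb_itv_fin (b0 b1 : bool) (a b : R) :
  (leb [set` Interval (BSide b0 a) (BSide b1 b)] < +oo)%E.
Proof.
by rewrite lebesgue_measure_itv/=; case: ifP => // _; rewrite -EFinB ltry.
Qed.

Definition leb_itv (b0 b1 : bool) (a b : R) :
    {finite_measure set (measurableTypeR R) -> \bar R} :=
  @mfrestr _ (measurableTypeR R) R [set` Interval (BSide b0 a) (BSide b1 b)]
    (@lebesgue_measure R) (measurable_itv _) (leb_itv_fin b0 b1 a b).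

Definition circle : {finite_measure set (measurableTypeR R) -> \bar R} :=
  leb_itv true true 0 1.

#[global] Instance leb_itv_ae_filter b0 b1 a b :
  Filter (nbhs (almost_everywhere (leb_itv b0 b1 a b))).
Proof. exact: ae_filter_ringOfSetsType. Qed.

#[global] Instance circle_ae_filter : Filter (nbhs (almost_everywhere circle)).
Proof. exact: ae_filter_ringOfSetsType. Qed.

Lemma ae_leb_itv b0 b1 a b (P : R -> Prop) :
  (forall x, x \in Interval (BSide b0 a) (BSide b1 b) -> P x) ->
  {ae leb_itv b0 b1 a b, forall x, P x}.
Proof. by move=> H; apply/ae_restrP; apply: aeW => x /= xi; exact: H. Qed.

Lemma continuous_itg_itv b0 b1 a b (f : R -> R) : continuous f ->
  itg (leb_itv b0 b1 a b) f.
Proof.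
move=> cf; have mf : measurable_fun setT f by exact: continuous_measurable_fun.
have [ab|ba] := leP a b; last first.
  apply: (itg_bounded (C := 0)) => //; apply: ae_leb_itv => x.
  by rewrite in_itv; case: b0 b1 => -[]/= /andP[h1 h2]; exfalso; lra.
have cfab : {within `[a, b], continuous f} by exact: continuous_subspaceT.
have [c _ hc] := EVT_max ab cfab; have [d _ hd] := EVT_min ab cfab.
apply: (itg_bounded (C := `|f c| + `|f d|)) => //; apply: ae_leb_itv => x xab.
have {}xab : x \in `[a, b].
  by move: xab; rewrite !in_itv; case: b0 b1 => -[]/= /andP[h1 h2]; lra.
have := hc _ xab; have := hd _ xab; have := ler_norm (f c); have := ler_norm (- f d).
rewrite normrN ler_norml; have := normr_ge0 (f c); have := normr_ge0 (f d).
by move=> *; apply/andP; split; lra.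
Qed.

Lemma Rint_itv_sides b0 b1 a b (f : R -> R) : continuous f ->
  \int[leb_itv b0 b1 a b]_x f x = \int[leb]_(x in `[a, b]) f x.
Proof.
move=> cf; have mf : measurable_fun setT f by exact: continuous_measurable_fun.
have H c0 c1 : integrable leb [set` Interval (BSide c0 a) (BSide c1 b)] (EFin \o f).
  by have /itg_restr := @continuous_itg_itv c0 c1 a b f cf; exact.
rewrite Rint_restr//; case: b0; case: b1 => //.
- by rewrite Rintegral_itv_bndo_bndc.
- by rewrite Rintegral_itv_obnd_cbnd// Rintegral_itv_bndo_bndc.
- by rewrite Rintegral_itv_obnd_cbnd.
Qed.

Lemma FTC_itv b0 b1 a b (f f' : R -> R) : a <= b ->
  deriv1 f f' -> continuous f' -> \int[leb_itv b0 b1 a b]_x f' x = f b - f a.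
Proof.
move=> ab df cf'; rewrite Rint_itv_sides//.
move: ab; rewrite le_eqVlt => /predU1P[->|ab].
  by rewrite set_itv1 Rintegral_set1 subrr.
have cf := deriv1_continuous df.
rewrite /Rintegral (@continuous_FTC2 _ f' f)//.
- exact: continuous_subspaceT.
- split; first by move=> x _; have [] := df x.
    by apply: cvg_at_right_filter; exact: cf.
  by apply: cvg_at_left_filter; exact: cf.
- by move=> x _; rewrite derive1E; exact: (@derive_val _ _ _ _ _ _ _ (df x)).
Qed.

End IntervalMeasures.

Section UnderIntegral.
Context d (T : measurableType d) (R : realType).
Variable mu : {measure set T -> \bar R}.

Lemma itg_conv (q : R -> R) C (p : T -> R) (w : T -> R) s : continuous q ->
  (forall x, `|q x| <= C) -> measurable_fun setT p -> itg mu w ->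
  itg mu (fun y => q (s - p y) * w y).
Proof.
move=> cq qC mp wi; apply: (itg_bM (C := C)) => //; last exact: aeW.
have mq : measurable_fun setT q by exact: continuous_measurable_fun.
by apply: (measurableT_comp mq); exact: measurable_funB.
Qed.

Lemma deriv1_conv (q q' : R -> R) C (p : T -> R) (w : T -> R) : deriv1 q q' ->
  continuous q' -> (forall x, `|q x| <= C) -> (forall x, `|q' x| <= C) ->
  measurable_fun setT p -> itg mu w ->
  deriv1 (fun s => \int[mu]_y (q (s - p y) * w y))
         (fun s => \int[mu]_y (q' (s - p y) * w y)).
Proof.
move=> dq cq' qC q'C mp wi s.
pose f s y := q (s - p y) * w y.
have df (x : R) y : is_derive x 1 (f^~ y) (q' (x - p y) * w y).
  have ds : deriv1 (fun s => s - p y) (fun=> 1).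
    have := deriv1D (@deriv1_id R) (deriv1_cst (- p y)).
    by apply: eq_deriv1 => // z; rewrite addr0.
  have := deriv1M (deriv1_comp dq ds) (deriv1_cst (w y)) x.
  by move/is_derive_eq; apply; rewrite mulr0 addr0 mulr1.
have cq := deriv1_continuous dq.
have sI : `](s - 1), (s + 1)[%classic s.
  by rewrite /= in_itv/= ltrDl ltrBlDr ltrDl ltr01.
have fi x : `](s - 1), (s + 1)[%classic x -> itg mu (f x).
  by move=> _; exact: (itg_conv _ cq qC mp wi).
have dfi x y : `](s - 1), (s + 1)[%classic x -> [set: T] y -> derivable (f^~ y) x 1.
  by move=> _ _; have [] := df x y.
have G0 y : 0 <= C * `|w y|.
  by rewrite mulr_ge0// (le_trans _ (qC 0)).
have Gi : itg mu (fun y => C * `|w y|) by exact/itgZ/itg_abs.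
have d1 x y : partial1of2 f x y = q' (x - p y) * w y.
  by rewrite partial1of2E; exact: (@derive_val _ _ _ _ _ _ _ (df x y)).
have Gub x y : `](s - 1), (s + 1)[%classic x -> [set: T] y ->
    `|partial1of2 f x y| <= C * `|w y|.
  by move=> _ _; rewrite d1 normrM ler_wpM2r.
apply: DeriveDef.
  exact: (derivable_under_integral measurableT sI fi dfi G0 Gi Gub).
rewrite -derive1E (differentiation_under_integral measurableT sI fi dfi G0 Gi Gub).
by apply: eq_Rintegral => y _; rewrite d1.
Qed.

End UnderIntegral.

Section Circle.
Variable R : realType.
Notation circle := (circle R).
Implicit Types q : R -> R.

Definition periodic1 q : Prop := forall x, q (x + 1) = q x.

Lemma periodic1_deriv q q' : deriv1 q q' -> periodic1 q -> periodic1 q'.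
Proof.
move=> dq pq x.
have ds : deriv1 (fun s : R => s + 1) (fun=> 1).
  have := deriv1D (@deriv1_id R) (deriv1_cst 1).
  by apply: eq_deriv1 => // z; rewrite addr0.
have := deriv1_comp dq ds x; rewrite mulr1.
rewrite (_ : (fun x => q (x + 1)) = q); last by apply/funext.
move=> d2; rewrite -(@derive_val _ _ _ _ _ _ _ (dq x)).
by rewrite -(@derive_val _ _ _ _ _ _ _ d2).
Qed.

Lemma periodic1_int q (z : int) x : periodic1 q -> q (x + z%:~R) = q x.
Proof.
move=> pq.
have N (n : nat) y : q (y + n%:R) = q y.
  elim: n => [|n IH]; first by rewrite addr0.
  by rewrite -natr1 addrA pq.
case: z => n; first by rewrite -pmulrn N.
by rewrite NegzE mulrNz -pmulrn -[in RHS](subrK n.+1%:R x) N.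
Qed.

Lemma periodic1_bounded q : continuous q -> periodic1 q ->
  exists C, forall x, `|q x| <= C.
Proof.
move=> cq pq; have c01 : {within `[0, 1], continuous (fun x => `|q x|)}.
  apply: continuous_subspaceT => x; apply: cvg_norm; exact: cq.
have [c _ hc] := EVT_max ler01 c01.
exists `|q c| => x.
rewrite -(periodic1_int (- Num.floor x) x pq); apply: (hc (x + _)).
have := floor_itv x; rewrite intrD => /andP[h1 h2].
by rewrite mulrNz in_itv/=; apply/andP; split; lra.
Qed.

Lemma periodic1_shift q q' : deriv1 q q' -> continuous q' -> periodic1 q ->
  forall x, \int[circle]_y q (x - y) = \int[circle]_y q (- y).
Proof.
move=> dq cq' pq x.
have [C qC] := periodic1_bounded (deriv1_continuous dq) pq.
have [C' q'C] := periodic1_bounded cq' (periodic1_deriv dq pq).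
have qM y : `|q y| <= Num.max C C' by rewrite le_max qC.
have q'M y : `|q' y| <= Num.max C C' by rewrite le_max q'C orbT.
have mid : measurable_fun setT (fun y : measurableTypeR R => y : R).
  exact: measurable_id.
have dG := deriv1_conv dq cq' qM q'M mid (itg_cst circle 1).
have E0 s : \int[circle]_y (q' (s - y) * 1) = 0.
  under eq_Rintegral do rewrite mulr1.
  have ds : deriv1 (fun y : R => s - y) (fun=> -1).
    have := deriv1D (deriv1_cst s) (deriv1N (@deriv1_id R)).
    by apply: eq_deriv1 => // z; rewrite add0r.
  have dd : deriv1 (fun y => - q (s - y)) (fun y => q' (s - y)).
    have := deriv1N (deriv1_comp dq ds).
    by apply: eq_deriv1 => // z; rewrite mulrN1 opprK.
  rewrite (FTC_itv _ _ ler01 dd).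
    by rewrite subr0 -[X in - - q X](subrK 1 s) pq opprK addNr.
  move=> y; apply: continuous_comp; last exact: cq'.
  exact: deriv1_continuous ds y.
have H : deriv1 (fun s => \int[circle]_y (q (s - y) * 1)) (fun=> 0).
  by apply: eq_deriv1 dG => // s; rewrite E0.
have := is_derive_0_is_cst x 0 H.
under eq_Rintegral do rewrite mulr1; move=> ->.
by apply: eq_Rintegral => y _; rewrite mulr1 sub0r.
Qed.

(** Supported where cos(2 pi s) > 1 - 1/(N+1), a neighbourhood of the integers
    that shrinks as N grows. *)
Definition bump (N : nat) (s : R) : R :=
  flat (cos (pi *+ 2 * s) - 1 + N.+1%:R^-1).

Definition bump_mass N := \int[circle]_s bump N s.

Definition kap N s := (bump_mass N)^-1 * bump N s.

Lemma smooth1_bump N : smooth1 (bump N).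
Proof.
apply: smooth1_comp; first exact: smooth1_flat.
apply: (@smooth1D _ (fun s => cos (pi *+ 2 * s) - 1)); last exact: smooth1_cst.
apply: (@smooth1D _ (fun s => cos (pi *+ 2 * s))); last exact: smooth1_cst.
apply: smooth1_comp; first exact: smooth1_cos.
by apply: smooth1M; [exact: smooth1_cst|exact: smooth1_id].
Qed.

Lemma bump_periodic N : periodic1 (bump N).
Proof.
by move=> s; rewrite /bump mulrDr mulr1 cosD2pi.
Qed.

Lemma bumpN N s : bump N (- s) = bump N s.
Proof. by rewrite /bump mulrN cosN. Qed.

Lemma bump_ge0 N s : 0 <= bump N s. Proof. exact: flatp_ge0. Qed.

Lemma bump_mass_gt0 N : 0 < bump_mass N.
Proof.
rewrite lt_neqAle [X in _ && X]Rint_ge0 ?andbT; last exact: bump_ge0.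
apply/eqP => M0.
have cb : continuous (bump N) by have [] := smooth1_bump N 0%N.
have bi : itg circle (bump N) by exact: continuous_itg_itv.
have b0 : {ae circle, forall s, bump N s = 0}.
  apply: (Rint_eq0 bi); rewrite M0; apply: eq_Rintegral => s _.
  by rewrite ger0_norm ?bump_ge0.
have b00 : 0 < bump N 0.
  by rewrite /bump mulr0 cos0 subrr add0r flatp_gt0// invr_gt0.
have [e e0 he] : exists2 e, 0 < e & forall s, `|s| < e -> 0 < bump N s.
  have := cb 0 => /cvgrPdist_lt/(_ _ b00)/nbhs_ballP[e /= e0 he].
  exists e => // s se; have /= := he s; rewrite /ball/= sub0r normrN => /(_ se).
  by rewrite ltr_distlC subrr => /andP[].
move/ae_restrP : b0 => [Z [mZ Z0 bZ]].
pose e' := Num.min e 1; have e'0 : 0 < e' by rewrite lt_min e0 ltr01.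
have : (lebesgue_measure (`[0%R, e'[ : set R) <= lebesgue_measure Z)%E.
  apply: le_measure; rewrite ?inE//; apply: subset_trans bZ.
  move=> s; rewrite /= in_itv/= => /andP[s0 se] H.
  move: se; rewrite lt_min => /andP[se s1].
  have := H; rewrite in_itv/= s0 s1 => /(_ isT) bs0.
  by have := he s; rewrite ger0_norm// bs0 ltxx => /(_ se).
by rewrite Z0 lebesgue_measure_itv/= lte_fin e'0 -EFinB subr0 lee_fin leNgt e'0.
Qed.

Lemma smooth1_kap N : smooth1 (kap N).
Proof. by apply: smooth1M; [exact: smooth1_cst|exact: smooth1_bump]. Qed.

Lemma kap_periodic N : periodic1 (kap N).
Proof. by move=> s; rewrite /kap bump_periodic. Qed.

Lemma kapN N s : kap N (- s) = kap N s. Proof. by rewrite /kap bumpN. Qed.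

Lemma kap_ge0 N s : 0 <= kap N s.
Proof. by rewrite mulr_ge0 ?bump_ge0// invr_ge0 ltW ?bump_mass_gt0. Qed.

Lemma kap_continuous N : continuous (kap N).
Proof. by have [] := smooth1_kap N 0%N. Qed.

Lemma kap_mass N x : \int[circle]_y kap N (x - y) = 1.
Proof.
have [k' dk sk'] := smooth1_ex (smooth1_kap N).
rewrite (periodic1_shift dk)//; [|by have [] := sk' 0%N|exact: kap_periodic].
under eq_Rintegral do rewrite kapN.
rewrite /kap RintZ ?mulVf ?gt_eqF ?bump_mass_gt0//.
by apply: continuous_itg_itv; have [] := smooth1_bump N 0%N.
Qed.

Lemma kap_markov N : markov_kernel circle (fun x y => kap N (x - y)).
Proof.
split.
- apply: (measurableT_comp (continuous_measurable_fun (@kap_continuous N))).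
  by apply: measurable_funB; [exact: measurable_fst|exact: measurable_snd].
- by move=> x y; exact: kap_ge0.
- have [C kC] := periodic1_bounded (@kap_continuous N) (@kap_periodic N).
  by exists C => x y; rewrite (le_trans (ler_norm _)).
- exact: kap_mass.
- by move=> y; rewrite -(kap_mass N y); apply: eq_Rintegral => x _; rewrite -kapN opprB.
Qed.

(** The cosine decreases on a half period, so it is bounded away from 1 away from
    the integers. *)
Lemma kap_far (e : R) : 0 < e -> e <= 2^-1 ->
  \forall N \near \oo, forall s, e <= `|s| -> `|s| <= 1 - e -> kap N s = 0.
Proof.
move=> e0 e2; have pi0 := @pi_gt0 R.
have [P piP PE] : exists2 P : R, pi *+ 2 = P & P = 2 * pi.
  by exists (pi *+ 2) => //; rewrite mulr_natl.
have P0 : 0 < P by rewrite PE mulr_gt0.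
have inP t : 0 <= t -> t <= 2^-1 -> P * t \in `[0, pi].
  move=> t0 t2; rewrite in_itv/=; apply/andP; split.
    by apply: mulr_ge0 => //; exact: ltW.
  have : P * t <= P * 2^-1 by rewrite ler_pM2l.
  by move: PE; lra.
have cosP s : e <= `|s| -> `|s| <= 1 - e -> cos (P * s) <= cos (P * e).
  move=> es se.
  have H t : e <= t -> t <= 2^-1 -> cos (P * t) <= cos (P * e).
    move=> et t2; have [->//|nt] := eqVneq t e.
    have elt : e < t by rewrite lt_neqAle eq_sym nt.
    apply: ltW; rewrite ltr_cos ?inP//; last by lra.
      by rewrite ltr_pM2l.
    exact: ltW.
  have -> : cos (P * s) = cos (P * `|s|).
    by case: (ger0P s) => // _; rewrite mulrN cosN.
  have [s2|s2] := lerP `|s| 2^-1; first exact: H.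
  have -> : cos (P * `|s|) = cos (P * (1 - `|s|)).
    by rewrite -cosN -mulrN -(cosD2pi (P * - `|s|)) piP mulrBr mulr1 mulrN addrC.
  by apply: H; lra.
have c1 : cos (P * e) < 1.
  rewrite -cos0 -{1}(mulr0 P) ltr_cos ?inP//; first by rewrite ltr_pM2l.
  exact: ltW.
have g0 : 0 < 1 - cos (P * e) by rewrite subr_gt0.
near=> N => s es se; rewrite /kap /bump /flat flatp_le0 ?mulr0//.
have : N.+1%:R^-1 <= 1 - cos (P * e).
  near: N; by have := near_infty_natSinv_lt (PosNum g0); apply: filterS => n /ltW.
rewrite piP; have := cosP s es se.
by move: (cos _) (cos _) (_^-1) => A B C; lra.
Unshelve. all: by end_near.
Qed.

Lemma kap_cvg_continuous (g : R -> R) (x : R) : continuous g -> 0 < x < 1 ->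
  avg circle (fun x y => kap N (x - y)) g x @[N --> \oo] --> g x.
Proof.
move=> cg /andP[x0 x1]; apply/cvgrPdist_le => e e0.
have := cg x => /cvgrPdist_le/(_ _ e0)/nbhs_ballP[r /= r0 hr].
(* Within distance h of x one stays in the ball of continuity and does not
   cross the ends of the period. *)
pose h := Num.min (r / 2) (Num.min x (1 - x)).
have h0 : 0 < h by rewrite !lt_min divr_gt0//= x0 subr_gt0.
have hx : h <= x by rewrite !ge_min lexx orbT.
have h1x : h <= 1 - x by rewrite !ge_min lexx !orbT.
have hrr : h <= r / 2 by rewrite ge_min lexx.
have h2 : h <= 2^-1 by lra.
have gi : itg circle g by exact: continuous_itg_itv.
near=> N. have mkN := kap_markov N.
rewrite -[X in X - _](avg_cst mkN (g x) x) -(avgB mkN) ?itg_cst//.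
rewrite (le_trans (norm_avg_le mkN _ _))//; first by apply: itgB => //; exact: itg_cst.
rewrite -[leRHS](avg_cst mkN e x) /avg.
have ii : itg circle (fun y => `|g x - g y|).
  by apply/itg_abs/itgB => //; exact: itg_cst.
apply: le_Rint; [exact: (itg_row mkN x ii)|by apply: (itg_row mkN); exact: itg_cst|].
apply: ae_leb_itv => y; rewrite in_itv/= => /andP[y0 y1].
have [xy|xy] := ltP `|x - y| h.
  rewrite ler_wpM2l ?kap_ge0//; apply: hr; rewrite /ball/=; lra.
suff -> : kap N (x - y) = 0 by rewrite !mul0r.
have H : forall s, h <= `|s| -> `|s| <= 1 - h -> kap N s = 0.
  by near: N; exact: kap_far.
by apply: H => //; rewrite ler_norml; apply/andP; split; lra.
Unshelve. all: by end_near.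
Qed.

(** Pointwise convergence on continuous functions, their density in the mean,
    and the contraction property. *)
Lemma kap_mollifier : mollifier circle (fun N x y => kap N (x - y)).
Proof.
split; first exact: kap_markov.
move=> f fi; apply/cvgrPdist_lt => e e0.
have e4 : 0 < e / 4 by rewrite divr_gt0.
have [g [cg gi fg]] : exists g, [/\ continuous g, itg circle g &
    \int[circle]_x `|f x - g x| < e / 4].
  have mf := itgM fi.
  have fi' : integrable lebesgue_measure `[0%R, 1%R[ (EFin \o f).
    by have /itg_restr := fi; exact.
  have [g_ [cg gi]] := approximation_continuous_integrable
    (measurable_itv _) (leb_itv_fin true true 0 1) fi'.
  move=> /fine_cvgP[_] /cvgrPdist_lt/(_ _ e4)[n _ /(_ n (leqnn n))] H.
  have mg : measurable_fun setT (g_ n) by exact: continuous_measurable_fun.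
  exists (g_ n); split => //; first exact: continuous_itg_itv.
  rewrite Rint_restr//; last first.
    by apply: measurableT_comp => //; exact: measurable_funB.
  by move: H; rewrite sub0r normrN; apply: le_lt_trans; exact: ler_norm.
have mkN N := kap_markov N.
have gcv : \int[circle]_x `|avg circle (fun x y => kap N (x - y)) g x - g x|
    @[N --> \oo] --> (0 : R).
  have [C gC] : exists C, {ae circle, forall x, `|g x| <= C}.
    have c01 : {within `[0, 1], continuous (fun x => `|g x|)}.
      apply: continuous_subspaceT => x; apply: cvg_norm; exact: cg.
    have [c _ hc] := EVT_max ler01 c01; exists `|g c|.
    apply: ae_leb_itv => x; rewrite in_itv/= => /andP[h1 h2].
    by apply: (hc x); rewrite in_itv/= h1 ltW.
  have mg := itgM gi.
  have [] := @Rint_dominated _ _ _ circle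
    (fun N x => `|avg circle (fun x y => kap N (x - y)) g x - g x|) (cst 0)
    (fun=> C + C).
  - move=> N; apply: measurableT_comp => //; apply: measurable_funB => //.
    exact: measurable_avg.
  - exact: measurable_cst.
  - exact: itg_cst.
  - have x0 : {ae circle, forall x : R, x != 0}.
      apply/ae_restrP; exists [set 0]; split => //.
        exact: lebesgue_measure_set1.
      by move=> x /= /not_implyP[_ /negP]; rewrite negbK => /eqP.
    have x1 : {ae circle, forall x : R, 0 <= x < 1}.
      by apply: ae_leb_itv => x; rewrite in_itv.
    apply: filterS2 x0 x1 => x x0 /andP[x0' x1].
    have x01 : 0 < x < 1 by rewrite x1 andbT lt_neqAle eq_sym x0.
    have /cvgrPdist_lt H := kap_cvg_continuous cg x01.
    apply/cvgrPdist_lt => r r0; apply: filterS (H r r0) => N.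
    by rewrite /= sub0r normrN normr_id distrC.
  - apply: filterS (gC) => x gx N; rewrite normr_id (le_trans (ler_normB _ _))// lerD//.
    rewrite ler_norml; apply: (avg_range (mkN N)) => //.
    by apply: filterS gC => y; rewrite ler_norml.
  by move=> _ _; rewrite Rintegral_cst// mul0r.
move/cvgrPdist_lt/(_ _ e4) : gcv; apply: filterS => N; rewrite !sub0r !normrN.
rewrite ger0_norm; last exact: Rint_ge0.
rewrite ger0_norm; last exact: Rint_ge0.
move=> gN.
have dfi := itgB fi gi.
have i1 := itg_abs (itg_avg (mkN N) dfi).
have i2 := itg_abs (itgB (itg_avg (mkN N) gi) gi).
have i3 := itg_abs dfi.
apply: (@le_lt_trans _ _ (\int[circle]_x
  (`|avg circle (fun x y => kap N (x - y)) (fun x => f x - g x) x| +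
  (`|avg circle (fun x y => kap N (x - y)) g x - g x| + `|f x - g x|)))).
  apply: le_Rint.
  - exact: itg_abs (itgB (itg_avg (mkN N) fi) fi).
  - exact: itgD i1 (itgD i2 i3).
  - have T (a b c g' : R) : `|a - c| <= `|a - b| + (`|b - g'| + `|c - g'|).
      have -> : a - c = (a - b) + ((b - g') + - (c - g')) by ring.
      rewrite (le_trans (ler_normD _ _))// lerD2l (le_trans (ler_normD _ _))//.
      by rewrite normrN.
    by apply: aeW => x; rewrite (avgB (mkN N)) //=; exact: T.
rewrite (RintD i1 (itgD i2 i3)) (RintD i2 i3).
have := avg_contraction (mkN N) dfi; move: gN fg.
set A := \int[_]_x _; set B := \int[_]_x _; set C := \int[_]_x _; lra.
Qed.

End Circle.
(** * Test functions in product form *)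

Section ClassC.
Variables (R : realType) (V : normedModType R).
Implicit Types f g : V -> R.

Lemma class_C_pred m f : class_C m.+1 f -> class_C m f.
Proof.
elim: m f => [|m IH] f [cf df]; first by split.
by split => // v; have [dfv cfv] := df v; split => //; exact: IH.
Qed.

Lemma class_C_cst m (c : R) : class_C m (fun _ : V => c).
Proof.
elim: m c => [|m IH] c; split => //; try by move=> z; exact: cvg_cst.
move=> v; split; first by move=> z; exact: derivable_cst.
rewrite (_ : 'D_v _ = fun=> 0); first exact: IH.
by apply/funext => z; exact: derive_cst.
Qed.

Lemma class_CD m f g : class_C m f -> class_C m g ->
  class_C m (fun z => f z + g z).
Proof.
elim: m f g => [|m IH] f g [cf df] [cg dg].
  by split => // z; exact: cvgD (cf z) (cg z).
split; first by move=> z; exact: cvgD (cf z) (cg z).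
move=> v; have [dfv cfv] := df v; have [dgv cgv] := dg v.
split; first by move=> z; exact: derivableD.
rewrite (_ : 'D_v _ = fun z => 'D_v f z + 'D_v g z); first exact: IH.
by apply/funext => z; rewrite (deriveD (dfv z) (dgv z)).
Qed.

Lemma class_CM m f g : class_C m f -> class_C m g ->
  class_C m (fun z => f z * g z).
Proof.
elim: m f g => [|m IH] f g Cf Cg.
  by split => // z; exact: cvgM (Cf.1 z) (Cg.1 z).
move: (Cf) (Cg) => [cf df] [cg dg].
split; first by move=> z; exact: cvgM (cf z) (cg z).
move=> v; have [dfv cfv] := df v; have [dgv cgv] := dg v.
split; first by move=> z; exact: derivableM.
rewrite (_ : 'D_v _ = fun z => f z * 'D_v g z + g z * 'D_v f z).
  by apply: class_CD; apply: IH => //; exact: class_C_pred.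
by apply/funext => z; rewrite (deriveM (dfv z) (dgv z)).
Qed.

Variable p : V -> R.
Hypothesis cp : continuous p.
Hypothesis linp : forall h v z, p (h *: v + z) = h * p v + p z.

Lemma is_derive_pull (a a' : R -> R) v z : deriv1 a a' ->
  is_derive z v (fun z => a (p z)) (a' (p z) * p v).
Proof.
move=> da; have dfa : differentiable a (p z).
  by apply/derivable1_diffP; have [] := da (p z).
have E : (fun h => h^-1 *: (((fun z => a (p z)) \o shift z) (h *: v) - a (p z))) =
    (fun h => h^-1 *: ((a \o shift (p z)) (h *: p v) - a (p z))).
  by apply/funext => h; rewrite /= linp.
have dd : derivable a (p z) (p v) by exact: diff_derivable.
apply: DeriveDef; first by rewrite /derivable E.
rewrite /derive E -/(derive a (p z) (p v)) (deriveE _ dfa).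
rewrite [X in 'd a (p z) X](_ : _ = p v *: (1 : R)); last first.
  by rewrite /GRing.scale/= mulr1.
rewrite linearZ/= -(deriveE _ dfa) (@derive_val _ _ _ _ _ _ _ (da (p z))).
by rewrite /GRing.scale/= mulrC.
Qed.

Lemma class_C_pull m (a : R -> R) : Cn m a -> class_C m (fun z => a (p z)).
Proof.
elim: m a => [|m IH] a.
  by move=> [ca _]; split => // z; exact: (continuous_comp (@cp z) (ca (p z))).
move=> [ca [a' da ca']].
split; first by move=> z; exact: (continuous_comp (@cp z) (ca (p z))).
move=> v; split; first by move=> z; have [] := is_derive_pull v z da.
rewrite (_ : 'D_v _ = fun z => a' (p z) * p v).
  by apply: class_CM; [exact: IH|exact: class_C_cst].
apply/funext => z; exact: (@derive_val _ _ _ _ _ _ _ (is_derive_pull v z da)).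
Qed.

End ClassC.

Section ProductTest.
Variable R : realType.
Notation RT := (R * R * R * R)%type.

Definition prod4 (a b c d : R -> R) (z : RT) : R :=
  a z.1.1.1 * b z.1.1.2 * c z.1.2 * d z.2.

Let cpr1 : continuous (fun z : RT => z.1.1.1).
Proof.
move=> z; apply: (@continuous_comp _ _ _ fst (fun w : R * R * R => w.1.1)).
  exact: cvg_fst.
by apply: (@continuous_comp _ _ _ fst fst); exact: cvg_fst.
Qed.

Let cpr2 : continuous (fun z : RT => z.1.1.2).
Proof.
move=> z; apply: (@continuous_comp _ _ _ fst (fun w : R * R * R => w.1.2)).
  exact: cvg_fst.
by apply: (@continuous_comp _ _ _ fst snd); [exact: cvg_fst|exact: cvg_snd].
Qed.

Let cpr3 : continuous (fun z : RT => z.1.2).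
Proof.
by move=> z; apply: (@continuous_comp _ _ _ fst snd); [exact: cvg_fst|exact: cvg_snd].
Qed.

Let cpr4 : continuous (fun z : RT => z.2).
Proof. by move=> z; exact: cvg_snd. Qed.

Lemma smooth_prod4 a b c d : smooth1 a -> smooth1 b -> smooth1 c -> smooth1 d ->
  smooth (prod4 a b c d).
Proof.
move=> sa sb sc sd m; rewrite /prod4.
have H1 := @class_C_pull _ _ _ cpr1 (fun _ _ _ => erefl) m a (sa m).
have H2 := @class_C_pull _ _ _ cpr2 (fun _ _ _ => erefl) m b (sb m).
have H3 := @class_C_pull _ _ _ cpr3 (fun _ _ _ => erefl) m c (sc m).
have H4 := @class_C_pull _ _ _ cpr4 (fun _ _ _ => erefl) m d (sd m).
exact: class_CM (class_CM (class_CM H1 H2) H3) H4.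
Qed.

Lemma derive_prod4 a b c d a' b' c' d' (v z : RT) :
  deriv1 a a' -> deriv1 b b' -> deriv1 c c' -> deriv1 d d' ->
  'D_v (prod4 a b c d) z =
    prod4 a' b c d z * v.1.1.1 + prod4 a b' c d z * v.1.1.2 +
    prod4 a b c' d z * v.1.2 + prod4 a b c d' z * v.2.
Proof.
move=> da db dc dd.
have H1 := @is_derive_pull _ _ (fun z : RT => z.1.1.1) (fun _ _ _ => erefl) a a' v z da.
have H2 := @is_derive_pull _ _ (fun z : RT => z.1.1.2) (fun _ _ _ => erefl) b b' v z db.
have H3 := @is_derive_pull _ _ (fun z : RT => z.1.2) (fun _ _ _ => erefl) c c' v z dc.
have H4 := @is_derive_pull _ _ (fun z : RT => z.2) (fun _ _ _ => erefl) d d' v z dd.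
have H := is_deriveM (is_deriveM (is_deriveM H1 H2) H3) H4.
transitivity ('D_v ((((fun z : RT => a z.1.1.1) * (fun z : RT => b z.1.1.2)) *
  (fun z : RT => c z.1.2)) * (fun z : RT => d z.2)) z); first by [].
rewrite (@derive_val _ _ _ _ _ _ _ H) /GRing.scale/= !fctE /prod4.
ring.
Qed.

Lemma time_deriv_prod4 a b c d d' z :
  smooth1 a -> smooth1 b -> smooth1 c -> deriv1 d d' ->
  time_deriv (prod4 a b c d) z = prod4 a b c d' z.
Proof.
move=> /smooth1_ex[a' da _] /smooth1_ex[b' db _] /smooth1_ex[c' dc _] dd.
by rewrite /time_deriv (derive_prod4 _ _ da db dc dd)/= !mulr0 mulr1 !add0r.
Qed.

Lemma space_deriv_prod4 a b c d a' b' c' k z :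
  deriv1 a a' -> deriv1 b b' -> deriv1 c c' -> smooth1 d ->
  space_deriv k (prod4 a b c d) z =
    prod4 a' b c d z * (k == 0 :> nat)%:R + prod4 a b' c d z * (k == 1 :> nat)%:R +
    prod4 a b c' d z * (k == 2 :> nat)%:R.
Proof.
move=> da db dc /smooth1_ex[d' dd _].
by rewrite /space_deriv (derive_prod4 _ _ da db dc dd)/= !mulr0 addr0.
Qed.

Lemma test_fun_prod4 a b c d M :
  smooth1 a -> smooth1 b -> smooth1 c -> smooth1 d ->
  periodic1 a -> periodic1 b -> periodic1 c -> (forall t, M <= t -> d t = 0) ->
  test_fun (prod4 a b c d).
Proof.
move=> sa sb sc sd pa pb pc dM; split; first exact: smooth_prod4.
  have P (q : R -> R) (m : bool) (x : R) : periodic1 q -> q (x + m%:R) = q x.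
    by case: m => pq; rewrite ?pq ?addr0.
  by move=> k x t; rewrite /prod4/= !P.
by exists M => x t Mt; rewrite /prod4 dM// mulr0.
Qed.

End ProductTest.

Section KernelTest.
Variable R : realType.
Notation X := (R * R * R)%type.
Implicit Types (x y : X) (N : nat).

Definition kap3 N x y : R :=
  kap N (x.1.1 - y.1.1) * kap N (x.1.2 - y.1.2) * kap N (x.2 - y.2).

Definition dkap N : R -> R := projT1 (cid2 (smooth1_ex (@smooth1_kap R N))).

Lemma deriv1_kap N : deriv1 (@kap R N) (dkap N).
Proof. by rewrite /dkap; case: cid2. Qed.

Lemma smooth1_dkap N : smooth1 (dkap N).
Proof. by rewrite /dkap; case: cid2. Qed.

Lemma dkap_periodic N : periodic1 (dkap N).
Proof. exact: periodic1_deriv (@deriv1_kap N) (@kap_periodic R N). Qed.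

(** The derivative is taken in the first point, where averages are evaluated;
    in the second point, where test functions live, it changes sign. *)
Definition dkap3 N (k : 'I_3) x y : R :=
  dkap N (x.1.1 - y.1.1) * kap N (x.1.2 - y.1.2) * kap N (x.2 - y.2) *
    (k == 0 :> nat)%:R +
  kap N (x.1.1 - y.1.1) * dkap N (x.1.2 - y.1.2) * kap N (x.2 - y.2) *
    (k == 1 :> nat)%:R +
  kap N (x.1.1 - y.1.1) * kap N (x.1.2 - y.1.2) * dkap N (x.2 - y.2) *
    (k == 2 :> nat)%:R.

Definition kernel_test N x (eta : R -> R) : X * R -> R :=
  prod4 (fun s => kap N (x.1.1 - s)) (fun s => kap N (x.1.2 - s))
    (fun s => kap N (x.2 - s)) eta.

Let deriv1_refl (q q' : R -> R) (s : R) : deriv1 q q' ->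
  deriv1 (fun r => q (s - r)) (fun r => - q' (s - r)).
Proof.
move=> dq; have ds : deriv1 (fun r : R => s - r) (fun=> -1).
  have := deriv1D (deriv1_cst s) (deriv1N (@deriv1_id R)).
  by apply: eq_deriv1 => // z; rewrite add0r.
by have := deriv1_comp dq ds; apply: eq_deriv1 => // r; rewrite mulrN1.
Qed.

Let smooth1_refl (q : R -> R) (s : R) : smooth1 q -> smooth1 (fun r => q (s - r)).
Proof.
move=> sq; apply: smooth1_comp => //.
apply: (@smooth1D _ (fun=> s) (fun r => - r)); first exact: smooth1_cst.
rewrite (_ : -%R = fun r : R => -1 * r); last by apply/funext => r; rewrite mulN1r.
by apply: smooth1M; [exact: smooth1_cst|exact: smooth1_id].
Qed.

Let periodic1_refl (q : R -> R) (s : R) : periodic1 q ->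
  periodic1 (fun r => q (s - r)).
Proof. by move=> pq r; rewrite -[in RHS](subrK 1 (s - r)) pq opprD addrA. Qed.

Lemma kernel_test_fun N x eta M : smooth1 eta -> (forall t, M <= t -> eta t = 0) ->
  test_fun (kernel_test N x eta).
Proof.
move=> se eM; have sk := @smooth1_kap R N; have pk := @kap_periodic R N.
by apply: test_fun_prod4 eM => //;
  try (exact: smooth1_refl); exact: periodic1_refl.
Qed.

Lemma kernel_test_time N x eta eta' y t : deriv1 eta eta' ->
  time_deriv (kernel_test N x eta) (y, t) = kap3 N x y * eta' t.
Proof.
move=> de; have sk := @smooth1_kap R N.
by rewrite (time_deriv_prod4 _ _ _ _ de)//; exact: smooth1_refl.
Qed.

Lemma kernel_test_space N x eta y t k : smooth1 eta ->
  space_deriv k (kernel_test N x eta) (y, t) = - (dkap3 N k x y * eta t).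
Proof.
move=> se; have dk s := deriv1_refl s (@deriv1_kap N).
rewrite (space_deriv_prod4 _ _ (dk _) (dk _) (dk _) se) /prod4 /dkap3/=.
ring.
Qed.

Lemma kernel_testE N x eta y t : kernel_test N x eta (y, t) = kap3 N x y * eta t.
Proof. by []. Qed.

End KernelTest.
(** * Calculus on the torus *)

Section TorusMeasures.
Variable R : realType.
Notation mR := (measurableTypeR R).
Notation X := (mR * mR * mR)%type.
Notation circle := (circle R).

Let I01 : set mR := `[0, 1[%classic.
Let mI01 : measurable I01. Proof. exact: measurable_itv. Qed.
Let mI2 : measurable (I01 `*` I01). Proof. exact: measurableX. Qed.

Lemma measurable_torus : measurable (torus R : set X).
Proof. by apply: measurableX => //; exact: mI2. Qed.

Let lebI01 : (@lebesgue_measure R I01 < +oo)%E.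
Proof. exact: (leb_itv_fin true true 0 1). Qed.

Let leb2_fin : (leb2 R (I01 `*` I01) < +oo)%E.
Proof.
rewrite [X in (X < _)%E](product_measure1E lebesgue_measure lebesgue_measure mI01 mI01).
by rewrite lte_mul_pinfty// ge0_fin_numE.
Qed.

Lemma leb3_torus_fin : (leb3 R (torus R) < +oo)%E.
Proof.
rewrite [X in (X < _)%E](product_measure1E (leb2 R) lebesgue_measure mI2 mI01).
by rewrite lte_mul_pinfty// ge0_fin_numE.
Qed.

Definition tor2 : {finite_measure set (mR * mR)%type -> \bar R} :=
  @mfrestr _ (mR * mR)%type R (I01 `*` I01) (leb2 R) mI2 leb2_fin.

Definition tor : {finite_measure set X -> \bar R} :=
  @mfrestr _ X R (torus R) (leb3 R) measurable_torus leb3_torus_fin.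

Lemma tor2E : is_prod tor2 circle circle.
Proof.
exact: (@is_prod_restr _ _ mR mR R lebesgue_measure lebesgue_measure (leb2 R)
  I01 I01 mI01 mI01 mI2 lebI01 lebI01 leb2_fin (fun=> erefl)).
Qed.

Lemma torE : is_prod tor tor2 circle.
Proof.
exact: (@is_prod_restr _ _ (mR * mR)%type mR R (leb2 R) lebesgue_measure (leb3 R)
  (I01 `*` I01) I01 mI2 mI01 measurable_torus leb2_fin lebI01 leb3_torus_fin
  (fun=> erefl)).
Qed.

Definition cyl_set (a b : R) : set (X * mR) := torus R `*` `]a, b[%classic.

Lemma measurable_cyl a b : measurable (cyl_set a b).
Proof.
by apply: measurableX; [exact: measurable_torus|exact: measurable_itv].
Qed.

Lemma leb4_cyl_fin a b : (leb4 R (cyl_set a b) < +oo)%E.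
Proof.
rewrite [X in (X < _)%E](product_measure1E (leb3 R) lebesgue_measure
  measurable_torus (measurable_itv _)).
rewrite lte_mul_pinfty ?ge0_fin_numE ?leb3_torus_fin//.
exact: (leb_itv_fin false true a b).
Qed.

Definition cyl a b : {finite_measure set (X * mR)%type -> \bar R} :=
  @mfrestr _ (X * mR)%type R (cyl_set a b) (leb4 R) (measurable_cyl a b)
    (leb4_cyl_fin a b).

#[global] Instance tor_ae_filter : Filter (nbhs (almost_everywhere tor)).
Proof. exact: ae_filter_ringOfSetsType. Qed.

#[global] Instance cyl_ae_filter a b :
  Filter (nbhs (almost_everywhere (cyl a b))).
Proof. exact: ae_filter_ringOfSetsType. Qed.

Lemma cylE a b : is_prod (cyl a b) tor (leb_itv false true a b).
Proof.
exact: (@is_prod_restr _ _ X mR R (leb3 R) lebesgue_measure (leb4 R)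
  (torus R) (`]a, b[%classic : set mR) measurable_torus (measurable_itv _)
  (measurable_cyl a b) leb3_torus_fin (leb_itv_fin false true a b)
  (leb4_cyl_fin a b) (fun=> erefl)).
Qed.

Lemma tor_mollifier : mollifier tor (@kap3 R).
Proof.
have := tensor_mollifier torE (tensor_mollifier tor2E (kap_mollifier R)
  (kap_mollifier R)) (kap_mollifier R).
by [].
Qed.

Lemma Rint0 d (T : measurableType d) (mu : {measure set T -> \bar R}) :
  \int[mu]_x (0 : R) = 0.
Proof. by rewrite Rintegral_cst// mul0r. Qed.

End TorusMeasures.

Section TorusCalculus.
Variable R : realType.
Notation mR := (measurableTypeR R).
Notation X := (mR * mR * mR)%type.
Notation circle := (circle R).
Notation tor := (tor R).
Implicit Types (x y : X) (k : 'I_3).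

Definition shiftk k x (s : R) : X :=
  (x.1.1 + s * (k == 0 :> nat)%:R, x.1.2 + s * (k == 1 :> nat)%:R,
   x.2 + s * (k == 2 :> nat)%:R).

Definition bounded_fun (T : Type) (f : T -> R) := exists C : R, forall t : T, `|f t| <= C.

(** Periodicity in one direction does not extend bounds from the fundamental
    domain to the whole space. *)
Definition torus_bounded (f : X -> R) :=
  exists C : R, forall x, torus R x -> `|f x| <= C.

Lemma ae_torus (P : X -> Prop) : (forall x, torus R x -> P x) -> {ae tor, forall x, P x}.
Proof.
by move=> H; apply/ae_restrP; apply: aeW => x /= xT; exact: H.
Qed.

Record C1per k (u u' : X -> R) : Prop := MkC1per {
  C1per_meas : measurable_fun setT u;
  C1per_meas' : measurable_fun setT u';
  C1per_bnd : torus_bounded u;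
  C1per_bnd' : torus_bounded u';
  C1per_per : forall x, u (shiftk k x 1) = u x;
  C1per_deriv : forall x,
    deriv1 (fun s => u (shiftk k x s)) (fun s => u' (shiftk k x s));
  C1per_cont : forall x, continuous (fun s => u' (shiftk k x s)) }.

Let Rint_line (f f' : R -> R) : deriv1 f f' -> continuous f' -> f 1 = f 0 ->
  \int[circle]_s f' s = 0.
Proof. by move=> df cf' f10; rewrite (FTC_itv _ _ ler01 df cf') f10 subrr. Qed.

(** Periodicity cancels the boundary terms. *)
Lemma C1per_Rint0 k u u' : C1per k u u' -> \int[tor]_x u' x = 0.
Proof.
move=> [mu mu' _ [C u'C] per du cu'].
have ui : itg tor u' by apply: (itg_bounded (C := C)) => //; exact: ae_torus.
have L x : \int[circle]_s u' (shiftk k x s) = 0.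
  apply: (Rint_line (du x) (cu' x)); rewrite -[RHS]per; congr u.
  by rewrite /shiftk/= !mul0r !addr0.
case: k per du cu' L => [[|[|[|//]]] ik] per du cu' L.
- rewrite (Rfubini2 (@torE R) ui) -[RHS](Rint0 circle).
  apply: eq_Rintegral_ae; apply: filterS (itg_slice2 (@torE R) ui) => x3 ui2.
  rewrite (Rfubini2 (@tor2E R) ui2) -[RHS](Rint0 circle).
  apply: eq_Rintegral => x2 _; rewrite -[RHS](L ((0, x2), x3)).
  by apply: eq_Rintegral => s _; rewrite /shiftk/= !mulr0 mulr1 !addr0 add0r.
- rewrite (Rfubini2 (@torE R) ui) -[RHS](Rint0 circle).
  apply: eq_Rintegral_ae; apply: filterS (itg_slice2 (@torE R) ui) => x3 ui2.
  rewrite (Rfubini1 (@tor2E R) ui2) -[RHS](Rint0 circle).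
  apply: eq_Rintegral => x1 _; rewrite -[RHS](L ((x1, 0), x3)).
  by apply: eq_Rintegral => s _; rewrite /shiftk/= !mulr0 mulr1 !addr0 add0r.
- rewrite (Rfubini1 (@torE R) ui) -[RHS](Rint0 (tor2 R)).
  apply: eq_Rintegral => -[x1 x2] _; rewrite -[RHS](L ((x1, x2), 0)).
  by apply: eq_Rintegral => s _; rewrite /shiftk/= !mulr0 mulr1 !addr0 add0r.
Qed.

Lemma C1perM k u u' v v' : C1per k u u' -> C1per k v v' ->
  C1per k (fun x => u x * v x) (fun x => u' x * v x + u x * v' x).
Proof.
move=> [mu mu' [C uC] [C' uC'] pu du cu] [mv mv' [D vD] [D' vD'] pv dv cv].
split.
- exact: measurable_funM.
- by apply: measurable_funD; exact: measurable_funM.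
- by exists (C * D) => x xT; rewrite normrM ler_pM// ?uC ?vD.
- exists (C' * D + C * D') => x xT; rewrite (le_trans (ler_normD _ _))//.
  by rewrite !normrM lerD// ler_pM// ?uC ?vD ?uC' ?vD'.
- by move=> x; rewrite pu pv.
- by move=> x; exact: deriv1M.
- have cu1 x := deriv1_continuous (du x); have cv1 x := deriv1_continuous (dv x).
  move=> x s; apply: cvgD; apply: cvgM; [exact: cu|exact: cv1|exact: cu1|exact: cv].
Qed.

Lemma C1per_ibp k u u' v v' : C1per k u u' -> C1per k v v' ->
  \int[tor]_x (u x * v' x) = - \int[tor]_x (u' x * v x).
Proof.
move=> Cu Cv; have := C1per_Rint0 (C1perM Cu Cv).
have [C1 uC] := C1per_bnd Cu; have [C2 uC'] := C1per_bnd' Cu.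
have [C3 vC] := C1per_bnd Cv; have [C4 vC'] := C1per_bnd' Cv.
rewrite RintD; first by move/eqP; rewrite addr_eq0 => /eqP ->; rewrite opprK.
- apply: (itg_bM (C := C2)); [exact: C1per_meas' Cu|exact: ae_torus|].
  by apply: (itg_bounded (C := C3)); [exact: C1per_meas Cv|exact: ae_torus].
- apply: (itg_bM (C := C1)); [exact: C1per_meas Cu|exact: ae_torus|].
  by apply: (itg_bounded (C := C4)); [exact: C1per_meas' Cv|exact: ae_torus].
Qed.

(** A function of two variables with its partial derivatives, through the chain
    rule they satisfy. *)
Record C1pair (P P1 P2 : R * R -> R) : Prop := MkC1pair {
  C1pair_c : continuous P; C1pair_m : measurable_fun setT P;
  C1pair_c1 : continuous P1; C1pair_m1 : measurable_fun setT P1;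
  C1pair_c2 : continuous P2; C1pair_m2 : measurable_fun setT P2;
  C1pair_chain : forall (p q : R -> R) (s p' q' : R),
    is_derive s 1 p p' -> is_derive s 1 q q' ->
    is_derive s 1 (fun s => P (p s, q s))
      (P1 (p s, q s) * p' + P2 (p s, q s) * q') }.

Lemma continuous_bounded_square (G : R * R -> R) (m : R) : continuous G ->
  exists C, forall a b : R, `|a| <= m -> `|b| <= m -> `|G (a, b)| <= C.
Proof.
move=> cG; have [C C0 GC] := affine_modulus m cG (ltr01 : 0 < 1 :> R).
exists (`|G (0, 0)| + 1 + C * (m + m)) => a b am bm.
have m0 : 0 <= m := le_trans (normr_ge0 _) am.
have := GC a b 0 0 am bm; rewrite normr0 !subr0 => /(_ m0 m0) h.
have := ler_normD (G (a, b) - G (0, 0)) (G (0, 0)); rewrite subrK => h'.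
by apply: (le_trans h'); nra.
Qed.

Lemma C1per_comp k P P1 P2 u u' v v' : C1pair P P1 P2 ->
  C1per k u u' -> C1per k v v' ->
  C1per k (fun x => P (u x, v x))
          (fun x => P1 (u x, v x) * u' x + P2 (u x, v x) * v' x).
Proof.
move=> [cP mP cP1 mP1 cP2 mP2 chain].
move=> [mu mu' [C uC] [C' uC'] pu du cu] [mv mv' [D vD] [D' vD'] pv dv cv].
have muv : measurable_fun setT (fun x => (u x, v x)) by exact: measurable_fun_pair.
have M := Num.max C D.
have uM x : torus R x -> `|u x| <= Num.max C D by move=> xT; rewrite le_max uC.
have vM x : torus R x -> `|v x| <= Num.max C D by move=> xT; rewrite le_max vD ?orbT.
have cu1 x := deriv1_continuous (du x); have cv1 x := deriv1_continuous (dv x).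
have cuv x : continuous (fun s => (u (shiftk k x s), v (shiftk k x s))).
  by move=> s; exact: (cvg_pair (cu1 x s) (cv1 x s)).
split.
- exact: (measurableT_comp mP muv).
- apply: measurable_funD; apply: measurable_funM => //.
    exact: (measurableT_comp mP1 muv).
  exact: (measurableT_comp mP2 muv).
- have [B PB] := continuous_bounded_square (Num.max C D) cP.
  by exists B => x xT; apply: PB; [exact: uM|exact: vM].
- have [B1 PB1] := continuous_bounded_square (Num.max C D) cP1.
  have [B2 PB2] := continuous_bounded_square (Num.max C D) cP2.
  exists (B1 * C' + B2 * D') => x xT; rewrite (le_trans (ler_normD _ _))//.
  by rewrite !normrM lerD// ler_pM// ?PB1 ?PB2 ?uM ?vM ?uC' ?vD'.
- by move=> x; rewrite pu pv.
- by move=> x s; exact: (chain _ _ _ _ _ (du x s) (dv x s)).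
- move=> x s; apply: cvgD; apply: cvgM; [|exact: cu| |exact: cv].
    exact: (continuous_comp (cuv x s) (cP1 _)).
  exact: (continuous_comp (cuv x s) (cP2 _)).
Qed.

Definition co k x : R :=
  if k == 0 :> nat then x.1.1 else if k == 1 :> nat then x.1.2 else x.2.

Definition rest N k x y : R :=
  if k == 0 :> nat then kap N (x.1.2 - y.1.2) * kap N (x.2 - y.2)
  else if k == 1 :> nat then kap N (x.1.1 - y.1.1) * kap N (x.2 - y.2)
  else kap N (x.1.1 - y.1.1) * kap N (x.1.2 - y.1.2).

Lemma kap3_split N k x y : kap3 N x y = kap N (co k x - co k y) * rest N k x y.
Proof. by rewrite /kap3 /co /rest; case: k => [[|[|[|//]]] ?]/=; ring. Qed.

Lemma dkap3_split N k x y :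
  dkap3 N k x y = dkap N (co k x - co k y) * rest N k x y.
Proof. by rewrite /dkap3 /co /rest; case: k => [[|[|[|//]]] ?]/=; ring. Qed.

Lemma co_shiftk k x s : co k (shiftk k x s) = co k x + s.
Proof. by rewrite /co; case: k => [[|[|[|//]]] ?]/=; rewrite mulr1. Qed.

Lemma rest_shiftk N k x s y : rest N k (shiftk k x s) y = rest N k x y.
Proof.
by rewrite /rest; case: k => [[|[|[|//]]] ?]/=; rewrite !mulr0 !addr0.
Qed.

Lemma kap_bounded N : bounded_fun (@kap R N).
Proof. exact: periodic1_bounded (@kap_continuous R N) (@kap_periodic R N). Qed.

Lemma dkap_continuous N : continuous (@dkap R N).
Proof. by have [] := @smooth1_dkap R N 0%N. Qed.

Lemma dkap_bounded N : bounded_fun (@dkap R N).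
Proof. exact: periodic1_bounded (@dkap_continuous N) (@dkap_periodic R N). Qed.

Let mx1 : measurable_fun setT (fun z : X => z.1.1 : R).
Proof. exact: measurableT_comp measurable_fst measurable_fst. Qed.
Let mx2 : measurable_fun setT (fun z : X => z.1.2 : R).
Proof. exact: measurableT_comp measurable_snd measurable_fst. Qed.
Let mx3 : measurable_fun setT (fun z : X => z.2 : R).
Proof. exact: measurable_snd. Qed.

Lemma measurable_co k : measurable_fun setT (co k).
Proof. by rewrite /co; case: k => [[|[|[|//]]] ?]/=. Qed.

Let mdiff (q : R -> R) (f g : X * X -> R) : continuous q ->
  measurable_fun setT f -> measurable_fun setT g ->
  measurable_fun setT (fun z => q (f z - g z)).
Proof.
move=> cq mf mg; apply: (measurableT_comp (continuous_measurable_fun cq)).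
exact: measurable_funB.
Qed.

Lemma measurable_rest N k : measurable_fun setT (fun z : X * X => rest N k z.1 z.2).
Proof.
have m1 (f : X -> R) : measurable_fun setT f -> measurable_fun setT (fun z : X * X => f z.1).
  by move=> mf; exact: measurableT_comp mf measurable_fst.
have m2 (f : X -> R) : measurable_fun setT f -> measurable_fun setT (fun z : X * X => f z.2).
  by move=> mf; exact: measurableT_comp mf measurable_snd.
have ck := @kap_continuous R N.
have k1 := mdiff ck (m1 _ mx1) (m2 _ mx1).
have k2 := mdiff ck (m1 _ mx2) (m2 _ mx2).
have k3 := mdiff ck (m1 _ mx3) (m2 _ mx3).
by rewrite /rest; case: k => [[|[|[|//]]] ?]/=; exact: measurable_funM.
Qed.

Lemma measurable_dkap3 N k : measurable_fun setT (fun z : X * X => dkap3 N k z.1 z.2).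
Proof.
rewrite (_ : (fun z => _) = (fun z : X * X =>
    dkap N (co k z.1 - co k z.2) * rest N k z.1 z.2)); last first.
  by apply/funext => z; rewrite dkap3_split.
apply: measurable_funM; last exact: measurable_rest.
apply: mdiff; first exact: dkap_continuous.
  exact: measurableT_comp (measurable_co k) measurable_fst.
exact: measurableT_comp (measurable_co k) measurable_snd.
Qed.

Lemma rest_bounded N k : exists C, forall x y, `|rest N k x y| <= C.
Proof.
have [C kC] := kap_bounded N; exists (C * C) => x y.
by rewrite /rest; do 2?case: ifP => _; rewrite normrM ler_pM.
Qed.

Lemma dkap3_bounded N k : exists C, forall x y, `|dkap3 N k x y| <= C.
Proof.
have [C kC] := dkap_bounded N; have [D rD] := rest_bounded N k.
by exists (C * D) => x y; rewrite dkap3_split normrM ler_pM.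
Qed.

Definition davg N k (v : X -> R) x : R := \int[tor]_y (dkap3 N k x y * v y).

Lemma itg_dkap3 N k x (v : X -> R) : itg tor v -> itg tor (fun y => dkap3 N k x y * v y).
Proof.
have [C kC] := dkap3_bounded N k; apply: (itg_bM (C := C)); last exact: aeW.
exact: measurable_fun_pair2 x (measurable_dkap3 N k).
Qed.

(** The kernel is the product of a kernel in the k-th coordinate and a function
    of the others: along that direction the average is a convolution. *)
Lemma C1per_avg N k (v : X -> R) : itg tor v ->
  C1per k (avg tor (kap3 N) v) (davg N k v).
Proof.
move=> vi; have mv := itgM vi.
have mk := mol_markov (tor_mollifier R) N.
have mr x : measurable_fun setT (rest N k x).
  exact: measurable_fun_pair2 x (measurable_rest N k).
pose w x y := rest N k x y * v y.
have wi x : itg tor (w x).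
  have [C rC] := rest_bounded N k.
  by apply: (itg_bM (C := C)) => //; exact: aeW.
pose p x y := co k y - co k x.
have mp x : measurable_fun setT (p x).
  by apply: measurable_funB => //; exact: measurable_co.
have Eu x : (fun s => avg tor (kap3 N) v (shiftk k x s)) =
    (fun s => \int[tor]_y (kap N (s - p x y) * w x y)).
  apply/funext => s; apply: eq_Rintegral => y _.
  rewrite (kap3_split N k) rest_shiftk co_shiftk /w mulrA; congr (kap N _ * _ * _).
  by rewrite /p; ring.
have Eu' x : (fun s => davg N k v (shiftk k x s)) =
    (fun s => \int[tor]_y (dkap N (s - p x y) * w x y)).
  apply/funext => s; apply: eq_Rintegral => y _.
  rewrite (dkap3_split N k) rest_shiftk co_shiftk /w mulrA; congr (dkap N _ * _ * _).
  by rewrite /p; ring.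
have [C1 kC1] := kap_bounded N; have [C2 kC2] := dkap_bounded N.
have kM s : `|kap N s| <= Num.max C1 C2 by rewrite le_max kC1.
have dkM s : `|dkap N s| <= Num.max C1 C2 by rewrite le_max kC2 orbT.
split.
- exact: measurable_avg.
- apply: (measurable_Rint2 tor (f := fun z : X * X => dkap3 N k z.1 z.2 * v z.2)).
  apply: measurable_funM; first exact: measurable_dkap3.
  exact: measurableT_comp mv measurable_snd.
- have [C kC] := kernel_norm mk; exists (C * \int[tor]_y `|v y|) => x _.
  rewrite (le_trans (Rint_norm (itg_row mk x vi)))// -(RintZ _ (itg_abs vi)).
  apply: le_Rint; [exact: itg_abs (itg_row mk x vi)|exact: itgZ _ (itg_abs vi)|].
  by apply: aeW => y; rewrite normrM ler_wpM2r.
- have [C kC] := dkap3_bounded N k; exists (C * \int[tor]_y `|v y|) => x _.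
  rewrite (le_trans (Rint_norm (itg_dkap3 N k x vi)))// -(RintZ _ (itg_abs vi)).
  apply: le_Rint; [exact: itg_abs (itg_dkap3 N k x vi)|exact: itgZ _ (itg_abs vi)|].
  by apply: aeW => y; rewrite normrM ler_wpM2r.
- move=> x; apply: eq_Rintegral => y _; congr (_ * _).
  rewrite !(kap3_split N k) rest_shiftk co_shiftk; congr (_ * _).
  by rewrite addrAC kap_periodic.
- move=> x; rewrite Eu Eu'.
  exact: (deriv1_conv (@deriv1_kap R N) (@dkap_continuous N) kM dkM (mp x) (wi x)).
- move=> x; rewrite Eu'.
  have [d2 dd sd2] := smooth1_ex (@smooth1_dkap R N).
  have cd2 : continuous d2 by have [] := sd2 0%N.
  have [C3 kC3] := periodic1_bounded cd2 (periodic1_deriv dd (@dkap_periodic R N)).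
  have dkM' s : `|dkap N s| <= Num.max C2 C3 by rewrite le_max kC2.
  have d2M s : `|d2 s| <= Num.max C2 C3 by rewrite le_max kC3 orbT.
  exact: deriv1_continuous (deriv1_conv dd cd2 dkM' d2M (mp x) (wi x)).
Qed.

End TorusCalculus.
(** * One-dimensional lemmas in time *)

Section TimeLemmas.
Variable R : realType.
Notation leb := (@lebesgue_measure R).
Notation lam := (leb_itv false true).
Implicit Types (a b t s : R) (f g d : R -> R).

(** Decreasing smooth functions tending to the indicator of t < r. *)
Definition cutoff (j : nat) (r t : R) : R := 1 - expR (- (j%:R * flat (r - t))).

Definition dcutoff (j : nat) (r t : R) : R :=
  - (j%:R * flatp 2 (r - t) * expR (- (j%:R * flat (r - t)))).

Lemma deriv1_sub r : deriv1 (fun t : R => r - t) (fun=> -1).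
Proof.
have := deriv1D (deriv1_cst r) (deriv1N (@deriv1_id R)).
by apply: eq_deriv1 => // z; rewrite add0r.
Qed.

Lemma smooth1_sub r : smooth1 (fun t : R => r - t).
Proof.
apply: (@smooth1D _ (fun=> r) (fun r => - r)); first exact: smooth1_cst.
rewrite (_ : -%R = fun r : R => -1 * r); last by apply/funext => s; rewrite mulN1r.
by apply: smooth1M; [exact: smooth1_cst|exact: smooth1_id].
Qed.

Lemma deriv1_cutoff j r : deriv1 (cutoff j r) (dcutoff j r).
Proof.
have dfl : deriv1 (fun t => flat (r - t)) (fun t => - flatp 2 (r - t)).
  have := deriv1_comp (@flatp_deriv R 0) (deriv1_sub r).
  by apply: eq_deriv1 => // z; rewrite mul0r subr0 mulrN1.
have dE := deriv1_comp (fun x => is_derive_expR x) (deriv1N (deriv1Z j%:R dfl)).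
have := deriv1D (deriv1_cst 1) (deriv1N dE).
by apply: eq_deriv1 => // z; rewrite /dcutoff add0r; ring.
Qed.

Lemma smooth1_cutoff j r : smooth1 (cutoff j r).
Proof.
apply: (@smooth1D _ (fun=> 1)); first exact: smooth1_cst.
have sN g : smooth1 g -> smooth1 (fun t => - g t).
  move=> sg; rewrite (_ : (fun t => _) = (fun t => -1 * g t)).
    by apply: smooth1M => //; exact: smooth1_cst.
  by apply/funext => t; rewrite mulN1r.
apply: (sN); apply: smooth1_comp; first exact: smooth1_expR.
apply: (sN); apply: smooth1M; first exact: smooth1_cst.
by apply: smooth1_comp; [exact: smooth1_flat|exact: smooth1_sub].
Qed.

Lemma smooth1_dcutoff j r : smooth1 (dcutoff j r).
Proof. exact: smooth1_deriv (deriv1_cutoff j r) (smooth1_cutoff j r). Qed.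

Lemma cutoff_ge j r t : r <= t -> cutoff j r t = 0.
Proof. by move=> rt; rewrite /cutoff /flat flatp_le0 ?subr_le0// mulr0 oppr0 expR0 subrr. Qed.

Lemma cutoff_itv j r t : 0 <= cutoff j r t <= 1.
Proof.
have : expR (- (j%:R * flat (r - t))) <= 1.
  by rewrite -[leRHS]expR0 ler_expR lerNl oppr0 mulr_ge0 ?flatp_ge0.
rewrite /cutoff; have := expR_ge0 (- (j%:R * flat (r - t))).
by move: (expR _) => E E0 E1; apply/andP; split; lra.
Qed.

Lemma dcutoff_le0 j r t : dcutoff j r t <= 0.
Proof. by rewrite oppr_le0 !mulr_ge0 ?flatp_ge0 ?expR_ge0. Qed.

Lemma dcutoff_ge j r t : r <= t -> dcutoff j r t = 0.
Proof. by move=> rt; rewrite /dcutoff flatp_le0 ?subr_le0// mulr0 mul0r oppr0. Qed.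

Lemma expR_inv_bound (c : R) (j : nat) : 0 < c -> (0 < j)%N ->
  j%:R * expR (- (j%:R * c)) <= 2 / c ^+ 2 / j%:R.
Proof.
move=> c0 j0; have jp : 0 < j%:R :> R by rewrite ltr0n.
have x0 : 0 < j%:R * c by exact: mulr_gt0.
have := expR_ge1Dxn 1 (ltW x0).
move=> H; have {}H : (j%:R * c) ^+ 2 / 2 <= expR (j%:R * c).
  by apply: le_trans H; rewrite -[2`!%:R]/(2%:R) lerDr.
rewrite expRN ler_pdivrMr ?expR_gt0//.
apply: (@le_trans _ _ (2 / c ^+ 2 / j%:R * ((j%:R * c) ^+ 2 / 2))).
  rewrite le_eqVlt; apply/orP; left; apply/eqP; field.
  by rewrite !gt_eqF.
by rewrite ler_wpM2l// !mulr_ge0 ?invr_ge0 ?sqr_ge0.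
Qed.

Lemma cutoff_cvg_gen (f : nat -> R) (x e : R) : 0 < e ->
  (\forall j \near \oo, e <= f j) ->
  1 - expR (- (j%:R * f j)) @[j --> \oo] --> (1 : R).
Proof.
move=> e0 fe; apply/cvgrPdist_le => r r0; near=> j.
have -> : 1 - (1 - expR (- (j%:R * f j))) = expR (- (j%:R * f j)) by ring.
rewrite ger0_norm ?expR_ge0//.
have ej : e <= f j by near: j.
have jr : (r * e)^-1 <= j%:R by near: j; exact: nbhs_infty_ger.
have re0 : 0 < r * e by exact: mulr_gt0.
have h1 : r^-1 <= j%:R * f j.
  have : (r * e)^-1 * e <= j%:R * f j.
    by apply: ler_pM => //; rewrite ?invr_ge0 ltW.
  by rewrite invfM mulfVK// gt_eqF.
have h2 : r^-1 <= expR (j%:R * f j).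
  by apply: (le_trans h1); have := expR_ge1Dx (j%:R * f j); lra.
by rewrite expRN -[leRHS]invrK lef_pV2// ?posrE ?expR_gt0 ?invr_gt0.
Unshelve. all: by end_near.
Qed.

Lemma cutoff_cvg r t : cutoff j r t @[j --> \oo] --> ((t < r)%R%:R : R).
Proof.
have [tr|rt] := ltP t r; last first.
  by apply: cvg_near_cst; apply: nearW => j; rewrite cutoff_ge.
apply: (@cutoff_cvg_gen (fun=> flat (r - t)) 0 (flat (r - t))).
  by apply: flatp_gt0; rewrite subr_gt0.
by apply: nearW.
Qed.

Lemma measurable_lt r : measurable_fun setT (fun t : measurableTypeR R => (t < r)%R%:R : R).
Proof.
rewrite (_ : (fun t => _) = \1_(`]-oo, r[%classic : set (measurableTypeR R))).
  by apply: measurable_indic; exact: measurable_itv.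
apply/funext => t; rewrite indicE; congr (_%:R); congr nat_of_bool.
by apply/idP/idP; rewrite inE/= in_itv.
Qed.

(** The indicator makes the integrand jointly measurable in the endpoint and the
    variable. *)
Definition prim a b d (t : R) : R := \int[lam a b]_s ((s < t)%R%:R * d s).

Lemma itg_prim a b d t : itg (lam a b) d -> itg (lam a b) (fun s => (s < t)%R%:R * d s).
Proof.
apply: (itg_bM (C := 1)); first exact: measurable_lt.
by apply: aeW => s; case: (s < t)%R; rewrite ?normr1 ?normr0.
Qed.

Lemma prim_norm a b d t : itg (lam a b) d -> `|prim a b d t| <= \int[lam a b]_s `|d s|.
Proof.
move=> di; have pi := itg_prim t di; rewrite (le_trans (Rint_norm pi))//.
apply: le_Rint; [exact: itg_abs pi|exact: itg_abs di|].
by apply: aeW => s; case: (s < t)%R; rewrite ?mul1r ?mul0r ?normr0.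
Qed.

Lemma measurable_prim a b d : itg (lam a b) d -> measurable_fun setT (prim a b d).
Proof.
move=> di; apply: (measurable_Rint2 (lam a b)
  (f := fun z : measurableTypeR R * measurableTypeR R => (z.2 < z.1)%R%:R * d z.2)).
apply: measurable_funM; last first.
  exact: measurableT_comp (itgM di) measurable_snd.
have mB : measurable_fun setT
    (fun z : measurableTypeR R * measurableTypeR R => z.2 - z.1 : R).
  by apply: measurable_funB; [exact: measurable_snd|exact: measurable_fst].
rewrite (_ : (fun z => _) = (fun z => (z.2 - z.1 < 0)%R%:R)).
  exact: measurableT_comp (measurable_lt 0) mB.
by apply/funext => z; rewrite subr_lt0.
Qed.

(** A weak derivative in time of a function that is continuous from the left at
    the final time: testing with cutoffs that fall from 1 to 0 just before r. *)
Lemma weak_time_derivative a b r h0 hr C (h d : R -> R) :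
  a < r -> r <= b -> itg (lam a b) d ->
  measurable_fun (setT : set (measurableTypeR R)) h ->
  {ae lam a b, forall t, `|h t| <= C} ->
  (forall e, 0 < e -> exists2 dl, 0 < dl &
     {ae lam a b, forall t, r - dl < t -> t < r -> `|h t - hr| <= e}) ->
  (forall j, h0 * cutoff j r a + \int[lam a b]_t (h t * dcutoff j r t) +
     \int[lam a b]_t (cutoff j r t * d t) = 0) ->
  hr = h0 + prim a b d r.
Proof.
move=> ar rb di mh hC hleft weak.
have cutc j : continuous (cutoff j r) by have [] := smooth1_cutoff j r 0%N.
have dcutc j : continuous (dcutoff j r) by have [] := smooth1_dcutoff j r 0%N.
have mdc j : measurable_fun setT (dcutoff j r) by exact: continuous_measurable_fun.
have dci j : itg (lam a b) (dcutoff j r) by exact: continuous_itg_itv.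
have hdi j : itg (lam a b) (fun t => h t * dcutoff j r t).
  exact: (itg_bM mh hC (dci j)).
have E1 : cutoff j r a @[j --> \oo] --> (1 : R).
  by have := @cutoff_cvg r a; rewrite ar.
have E3 : \int[lam a b]_t (cutoff j r t * d t) @[j --> \oo] --> prim a b d r.
  have [] := @Rint_dominated _ _ _ (lam a b) (fun j t => cutoff j r t * d t)
    (fun t => (t < r)%R%:R * d t) (fun t => `|d t|).
  - move=> j; apply: measurable_funM; last exact: itgM di.
    exact: continuous_measurable_fun.
  - by apply: measurable_funM; [exact: measurable_lt|exact: itgM di].
  - exact: itg_abs.
  - by apply: aeW => t; apply: cvgM; [exact: cutoff_cvg|exact: cvg_cst].
  - apply: aeW => t j; rewrite normrM ler_piMl//.
    by have /andP[c0 c1] := cutoff_itv j r t; rewrite ger0_norm.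
  by [].
have FTCd j : \int[lam a b]_t dcutoff j r t = - cutoff j r a.
  have ab : a <= b by rewrite (le_trans (ltW ar)).
  rewrite (FTC_itv _ _ ab (@deriv1_cutoff j r) (@dcutc j)).
  by rewrite (cutoff_ge _ rb) sub0r.
pose B := `|C| + `|hr|.
have hB : {ae lam a b, forall t, `|h t - hr| <= B}.
  apply: filterS hC => t ht; rewrite (le_trans (ler_normB _ _))// lerD//.
  by rewrite (le_trans ht)// ler_norm.
have [F2 F20 F2b] : exists2 F2, 0 <= F2 & forall t, a <= t -> t <= r -> flatp 2 (r - t) <= F2.
  have [K K0 HK] := @flatp_small R 2; exists (K * (r - a)).
    by rewrite mulr_ge0 ?ltW// subr_gt0.
  move=> t at' tr; rewrite (le_trans (HK _))// ler_wpM2l ?(ltW K0)//.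
  by rewrite ger0_norm ?subr_ge0// lerD2l lerN2.
pose V := fine (lam a b setT).
have V0 : 0 <= V by exact: fine_ge0.
(* The mass of the derivative of the cutoff concentrates just before r, where h
   is close to hr; elsewhere it is of order 1 / j. *)
have E2 : \int[lam a b]_t ((h t - hr) * dcutoff j r t) @[j --> \oo] --> (0 : R).
  apply/cvgrPdist_le => e e0; have e2 : 0 < e / 2 by rewrite divr_gt0.
  have [dl dl0 hdl] := hleft _ e2.
  pose c := flat dl; have c0 : 0 < c by exact: flatp_gt0.
  pose K := B * (F2 * (2 / c ^+ 2)) * V.
  have K0 : 0 <= K.
    by rewrite /K !mulr_ge0 ?addr_ge0 ?invr_ge0 ?sqr_ge0.
  near=> j.
  have j0 : (0 < j)%N by near: j; exact: nbhs_infty_gt.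
  have jp : 0 < j%:R :> R by rewrite ltr0n.
  have jK : 2 * K / e <= j%:R by near: j; exact: nbhs_infty_ger.
  have ii : itg (lam a b) (fun t => (h t - hr) * dcutoff j r t).
    apply: (itg_bM (C := B)) => //; apply: measurable_funB => //.
  rewrite sub0r normrN (le_trans (Rint_norm ii))//.
  pose k := B * (F2 * (2 / c ^+ 2)) / j%:R.
  have i1 : itg (lam a b) (fun t => (e / 2) * (- dcutoff j r t)) by exact/itgZ/itgN.
  apply: (@le_trans _ _ (\int[lam a b]_t ((e / 2) * (- dcutoff j r t) + k))).
    apply: le_Rint; first exact: itg_abs.
      by apply: itgD => //; exact: itg_cst.
    have tab : {ae lam a b, forall t, a < t < b} by apply: ae_leb_itv => t; rewrite in_itv.
    apply: filterS3 hB hdl tab => t hBt hdlt /andP[ta tb].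
    have k0 : 0 <= k by rewrite /k !mulr_ge0 ?addr_ge0 ?invr_ge0 ?sqr_ge0.
    have dn : `|dcutoff j r t| = - dcutoff j r t by rewrite ler0_norm ?dcutoff_le0.
    have dn0 : 0 <= - dcutoff j r t by rewrite oppr_ge0 dcutoff_le0.
    rewrite normrM dn.
    have [rt|tr] := leP r t; first by rewrite dcutoff_ge// oppr0 !mulr0 add0r.
    have [tdl|tdl] := ltP (r - dl) t.
      by have := ler_wpM2r dn0 (hdlt tdl tr); lra.
    have m0 : 0 <= e / 2 * - dcutoff j r t by rewrite mulr_ge0// ltW.
    suff : `|h t - hr| * - dcutoff j r t <= k by lra.
    rewrite /k -mulrA; apply: ler_pM => //.
    rewrite /dcutoff opprK mulrAC mulrC -mulrA; apply: ler_pM.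
    + exact: flatp_ge0.
    + by rewrite mulr_ge0 ?expR_ge0.
    + by apply: F2b; rewrite ltW.
    + apply: le_trans (expR_inv_bound c0 j0); rewrite ler_pM2l// ler_expR lerN2.
      by rewrite ler_pM2l//; apply: flat_nondecreasing; lra.
  rewrite (RintD i1 (itg_cst _ _)) (RintZ _ (itgN (dci j))) (RintN (dci j)) FTCd opprK.
  rewrite Rintegral_cst// -/V.
  have /andP[_ cut1] := cutoff_itv j r a.
  have kV : k * V <= e / 2.
    rewrite /k (_ : _ * V = K / j%:R); last by rewrite /K; ring.
    rewrite ler_pdivrMr//; move: jK; rewrite ler_pdivrMr//; lra.
  have : e / 2 * cutoff j r a <= e / 2 by rewrite ler_piMr// ltW.
  lra.
have : (fun j => h0 * cutoff j r a + \int[lam a b]_t (h t * dcutoff j r t) +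
     \int[lam a b]_t (cutoff j r t * d t)) @ \oo --> h0 * 1 + (0 - hr * 1) + prim a b d r.
  apply: cvgD => //; apply: cvgD; first by apply: cvgM => //; exact: cvg_cst.
  rewrite (_ : (fun j => \int[lam a b]_t (h t * dcutoff j r t)) =
    (fun j => \int[lam a b]_t ((h t - hr) * dcutoff j r t) - hr * cutoff j r a)).
    by apply: cvgB => //; apply: cvgM => //; exact: cvg_cst.
  apply/funext => j; have := FTCd j => F.
  rewrite -[cutoff j r a]opprK -F mulrN opprK -(RintZ _ (dci j)).
  rewrite -RintD; last exact: itgZ.
    by apply: eq_Rintegral => t _; ring.
  apply: (itg_bM (C := B)) => //; exact: measurable_funB.
rewrite (_ : (fun j => _) = fun=> 0); last by apply/funext => j; exact: weak.
move/cvg_lim => /(_ (@Rhausdorff R)); rewrite lim_cst; last exact: Rhausdorff.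
lra.
Unshelve. all: by end_near.
Qed.

End TimeLemmas.
Section TimeCalculus.
Variable R : realType.
Notation leb := (@lebesgue_measure R).
Notation lam := (leb_itv false true).
Notation mR := (measurableTypeR R).
Implicit Types (a b t s r : R).

(** An integrable function is almost everywhere the derivative of its primitive. *)
Lemma prim_eq0_ae a b (q : mR -> R) : itg (lam a b) q ->
  (forall r, prim a b q r = 0) -> {ae lam a b, forall t, q t = 0}.
Proof.
move=> qi q0; have mq := itgM qi.
pose I : set mR := `]a, b[%classic.
have mI : measurable I by exact: measurable_itv.
pose f : R -> R := q \_ I.
have fi : integrable leb setT (EFin \o f).
  have /itg_restr := qi => /(_ mq); rewrite integrable_mkcond//.
  by rewrite /f restrict_EFin.
have mf : measurable_fun (setT : set mR) f by exact: itgM fi.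
have F0 x : \int[leb]_(t in `]-oo, x]) f t = 0.
  rewrite -(q0 x) /prim Rint_restr; last by apply: measurable_funM => //; exact: measurable_lt.
  rewrite Rintegral_mkcond [RHS]Rintegral_mkcond.
  apply: eq_Rintegral_ae; exists [set x]; split => //.
    exact: lebesgue_measure_set1.
  move=> t /= H; apply: contrapT => tx; apply: H.
  rewrite !patchE /I/= !mem_setE !in_itv/=.
  have {}tx : t != x by apply/eqP.
  have -> : (t <= x) = (t < x)%R by rewrite le_eqVlt (negPf tx).
  rewrite /f patchE mem_setE in_itv/=.
  by case: (t < x)%R; case: (a < t < b)%R; rewrite ?mul1r ?mul0r.
have fiS (y : R) : integrable leb (`]-oo, y]%classic : set mR) (EFin \o f).
  exact: integrableS fi.
have L : {ae leb, forall x, f x = 0}.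
  have := @FTC1Ny R f.
  have fl := integrable_locally measurableT fi; rewrite patch_setT in fl.
  move=> /(_ fiS fl).
  apply: (@filterS _ _ (ae_filter_ringOfSetsType leb)) => x [_ <-].
  rewrite (_ : (fun x => _) = cst 0); last by apply/funext => y; exact: F0.
  by rewrite derive1E derive_cst.
apply/ae_restrP; apply: (@filterS _ _ (ae_filter_ringOfSetsType leb) _ _ _ L) => x fx xI.
by move: fx; rewrite /f patchE mem_set.
Qed.

(** Fundamental lemma of the calculus of variations: products of cutoffs tend to
    indicators of subintervals, so the primitive vanishes. *)
Lemma time_fundamental a b (q : mR -> R) : itg (lam a b) q ->
  (forall eta, smooth1 eta -> (exists2 s, a < s & forall t, t <= s -> eta t = 0) ->
     (forall t, b <= t -> eta t = 0) -> \int[lam a b]_t (q t * eta t) = 0) ->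
  {ae lam a b, forall t, q t = 0}.
Proof.
move=> qi test; apply: prim_eq0_ae => // r.
wlog rb : r / r <= b.
  move=> W; have [/W//|br] := leP r b; rewrite -[RHS](W b (lexx b)).
  apply: eq_Rintegral_ae; apply: ae_leb_itv => t; rewrite in_itv/= => /andP[_ tb].
  by rewrite tb (lt_trans tb br).
pose sj (j : nat) := a + j.+1%:R^-1.
pose eta j t := cutoff j r t * cutoff j (- sj j) (- t).
have smN : smooth1 (fun t : R => - t).
  rewrite (_ : (fun t => _) = (fun t : R => -1 * t)).
    by apply: smooth1M; [exact: smooth1_cst|exact: smooth1_id].
  by apply/funext => t; rewrite mulN1r.
have se j : smooth1 (eta j).
  apply: smooth1M; first exact: smooth1_cutoff.
  by apply: smooth1_comp => //; exact: smooth1_cutoff.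
have e0 j : \int[lam a b]_t (q t * eta j t) = 0.
  apply: test => //.
    exists (sj j); first by rewrite ltrDl invr_gt0.
    by move=> t ts; rewrite /eta [X in _ * X]cutoff_ge ?mulr0// lerN2.
  by move=> t bt; rewrite /eta cutoff_ge ?mul0r// (le_trans rb).
have etab j t : `|eta j t| <= 1.
  have /andP[h1 h2] := cutoff_itv j r t.
  have /andP[h3 h4] := cutoff_itv j (- sj j) (- t).
  by rewrite /eta normrM (ger0_norm h1) (ger0_norm h3); exact: mulr_ile1 h1 h3 h2 h4.
have [] := @Rint_dominated _ _ _ (lam a b) (fun j t => q t * eta j t)
   (fun t => (t < r)%R%:R * q t) (fun t => `|q t|).
- move=> j; apply: measurable_funM; first exact: itgM qi.
  by apply: continuous_measurable_fun; have [] := se j 0%N.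
- by apply: measurable_funM; [exact: measurable_lt|exact: itgM qi].
- exact: itg_abs.
- apply: ae_leb_itv => t; rewrite in_itv/= => /andP[at_ tb].
  rewrite mulrC; apply: cvgM; first exact: cvg_cst.
  rewrite -[X in _ --> X]mulr1; apply: cvgM; first exact: cutoff_cvg.
  apply: (@cutoff_cvg_gen R (fun j => flat (- sj j - - t)) t (flat ((t - a) / 2))).
    by apply: flatp_gt0; rewrite divr_gt0// subr_gt0.
  have ta : 0 < (t - a) / 2 by rewrite divr_gt0// subr_gt0.
  have := near_infty_natSinv_lt (PosNum ta); apply: filterS => j /= hj.
  by apply: flat_nondecreasing; rewrite /sj; move: hj; move: (_^-1) => z; lra.
- by apply: aeW => t j; rewrite normrM ler_piMr.
move=> _ _; rewrite (_ : (fun j => _) = fun=> 0); last exact/funext.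
by move/cvg_lim => /(_ (@Rhausdorff R)); rewrite lim_cst; last exact: Rhausdorff.
Qed.

Lemma antiderivative (g : R -> R) m : continuous g ->
  (forall x, m < `|x| -> g x = 0) -> exists G, deriv1 G g.
Proof.
move=> cg g0; pose I : set mR := `[- m, m]%classic.
have mI : measurable I by exact: measurable_itv.
have mg : measurable_fun (setT : set mR) g by exact: continuous_measurable_fun.
have gE : g \_ I = g.
  apply/funext => x; rewrite patchE; case: ifPn => //.
  rewrite notin_setE /I/= in_itv/= -ler_norml => /negP; rewrite -ltNge => h.
  by rewrite g0.
have gi : integrable leb setT (EFin \o g).
  have /itg_restr := @continuous_itg_itv R true false (- m) m g cg.
  by move=> /(_ mg); rewrite integrable_mkcond// restrict_EFin gE.
have giS (y : R) : integrable leb (`]-oo, y]%classic : set mR) (EFin \o g).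
  exact: integrableS gi.
exists (fun x => \int[leb]_(t in `]-oo, x]) g t) => x.
have [dG G'] := @continuous_FTC1 R g -oo%O x (x + 1) (ltr_pwDr ltr01 (lexx x))
  (giS (x + 1)) (ltNyr _) (cg x).
by apply: DeriveDef; [exact: dG|rewrite -derive1E].
Qed.

Lemma itv_approx a b (d : mR -> R) : itg (lam a b) d ->
  exists g_ D_ : nat -> R -> R, [/\ forall j, continuous (g_ j),
    forall j, deriv1 (D_ j) (g_ j),
    forall j, \int[lam a b]_t `|g_ j t - d t| <= 1 &
    \int[lam a b]_t `|g_ j t - d t| @[j --> \oo] --> (0 : R)].
Proof.
move=> di; have md := itgM di.
have di' : integrable leb `]a, b[ (EFin \o d) by have /itg_restr := di; exact.
have [f_ [cf fi fcv]] := approximation_continuous_integrable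
  (measurable_itv _) (leb_itv_fin false true a b) di'.
pose m := `|a| + `|b|.
(* A plateau equal to 1 on the interval, so that the product has an
   antiderivative on the whole line. *)
pose c (x : R) : R := Num.max 0 (Num.min 1 (m + 1 - `|x|)).
have cc : continuous c.
  rewrite (_ : c = fun x => (`|(1 + (m + 1 - `|x|) - `|1 - (m + 1 - `|x|)|) / 2| +
      (1 + (m + 1 - `|x|) - `|1 - (m + 1 - `|x|)|) / 2) / 2).
    have cn : continuous (fun x : R => m + 1 - `|x|).
      by move=> x; apply: cvgB; [exact: cvg_cst|exact: cvg_norm].
    have ci : continuous (fun x : R => (1 + (m + 1 - `|x|) - `|1 - (m + 1 - `|x|)|) / 2).
      move=> x; apply: cvgM; last exact: cvg_cst.
      apply: cvgB; first by apply: cvgD; [exact: cvg_cst|exact: cn].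
      by apply: cvg_norm; apply: cvgB; [exact: cvg_cst|exact: cn].
    move=> x; apply: cvgM; last exact: cvg_cst.
    by apply: cvgD; [apply: cvg_norm|]; exact: ci.
  apply/funext => x; rewrite /c; set y := m + 1 - `|x|.
  have -> : (1 + y - `|1 - y|) / 2 = Num.min 1 y.
    by case: (leP 1 y) => h; [rewrite ler0_norm|rewrite gtr0_norm]; lra.
  by case: (leP 0 (Num.min 1 y)) => h; [rewrite ger0_norm|rewrite ltr0_norm]; lra.
have c1 t : a < t < b -> c t = 1.
  move=> /andP[h1 h2]; have tm : `|t| <= m.
    rewrite ler_norml /m; have := ler_norm (- a); have := ler_norm b.
    rewrite normrN; have := normr_ge0 a; have := normr_ge0 b.
    by move=> *; apply/andP; split; lra.
  by rewrite /c (min_idPl _) ?(max_idPr _)//; lra.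
have c0 x : m + 1 < `|x| -> c x = 0.
  by move=> h; rewrite /c; apply/max_idPl; rewrite ge_min; apply/orP; right; lra.
pose e_ j t := f_ j t * c t.
have ce j : continuous (e_ j) by move=> t; apply: cvgM; [exact: cf|exact: cc].
have /choice[D_ dD] : forall j, exists G, deriv1 G (e_ j).
  move=> j; apply: (antiderivative (m := m + 1)) => // x h.
  by rewrite /e_ c0// mulr0.
have ecv : \int[lam a b]_t `|e_ j t - d t| @[j --> \oo] --> (0 : R).
  have H := fine_cvg fcv.
  rewrite (_ : (fun j => _) = fine \o (fun n => \int[leb]_(z in `]a, b[)
      `|(d z - f_ n z)%:E|)%E); first exact: H.
  apply/funext => j.
  transitivity (\int[lam a b]_t `|d t - f_ j t|).
    apply: eq_Rintegral_ae; apply: ae_leb_itv => t; rewrite in_itv/= => /c1 h.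
    by rewrite /e_ h mulr1 distrC.
  rewrite Rint_restr//; apply: measurableT_comp => //.
  by apply: measurable_funB => //; exact: continuous_measurable_fun.
have [n _ hn] : \forall j \near \oo, \int[lam a b]_t `|e_ j t - d t| <= 1.
  move/cvgrPdist_le : ecv => /(_ _ ltr01); apply: filterS => j.
  by rewrite sub0r normrN ger0_norm//; exact: Rint_ge0.
exists (fun j => e_ (j + n)%N), (fun j => D_ (j + n)%N); split => //.
- by move=> j; apply: hn; rewrite /= leq_addl.
- by rewrite (cvg_shiftn n (fun j => \int[lam a b]_t `|e_ j t - d t|)).
Qed.

Lemma prim_itv T t (f : R -> R) : continuous f -> 0 <= t -> t <= T ->
  prim 0 T f t = \int[lam 0 t]_s f s.
Proof.
move=> cf t0 tT; have mf : measurable_fun (setT : set mR) f.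
  exact: continuous_measurable_fun.
rewrite /prim Rint_restr; last by apply: measurable_funM => //; exact: measurable_lt.
rewrite Rint_restr// Rintegral_mkcond [RHS]Rintegral_mkcond.
apply: eq_Rintegral => s _; rewrite !patchE !mem_setE !in_itv/=.
case: (ltP 0 s) => //= s0; case: (ltP s t) => [st|ts].
  by rewrite (lt_le_trans st tT) mul1r.
by case: ifP => _; rewrite ?mul0r.
Qed.

Lemma primB a b (d e : mR -> R) t : itg (lam a b) d -> itg (lam a b) e ->
  prim a b (fun s => d s - e s) t = prim a b d t - prim a b e t.
Proof.
move=> di ei; rewrite /prim -(RintB (itg_prim t di) (itg_prim t ei)).
by apply: eq_Rintegral => s _; rewrite mulrBr.
Qed.

(** The chain rule for absolutely continuous functions, by density of the
    continuously differentiable ones. *)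
Lemma chain_time (T : R) (P P1 P2 : R * R -> R) (h0 k0 : R) (d e : mR -> R) :
  0 < T -> C1pair P P1 P2 -> itg (lam 0 T) d -> itg (lam 0 T) e ->
  let h t := h0 + prim 0 T d t in let k t := k0 + prim 0 T e t in
  P (h T, k T) - P (h0, k0) =
    \int[lam 0 T]_t (P1 (h t, k t) * d t) + \int[lam 0 T]_t (P2 (h t, k t) * e t).
Proof.
move=> T0 CP di ei h k.
have [d_ [D_ [cd dD d1 dcv]]] := itv_approx di.
have [e_ [E_ [ce dE e1 ecv]]] := itv_approx ei.
have di_ j : itg (lam 0 T) (d_ j) by exact: continuous_itg_itv.
have ei_ j : itg (lam 0 T) (e_ j) by exact: continuous_itg_itv.
pose hj j t := h0 + (D_ j t - D_ j 0); pose kj j t := k0 + (E_ j t - E_ j 0).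
have dhj j : deriv1 (hj j) (d_ j).
  have := deriv1D (deriv1_cst h0) (deriv1D (dD j) (deriv1_cst (- D_ j 0))).
  by apply: eq_deriv1 => // z; rewrite add0r addr0.
have dkj j : deriv1 (kj j) (e_ j).
  have := deriv1D (deriv1_cst k0) (deriv1D (dE j) (deriv1_cst (- E_ j 0))).
  by apply: eq_deriv1 => // z; rewrite add0r addr0.
have gap (g : mR -> R) (g_ G_ : nat -> R -> R) (g0 : R) (j : nat) (t : R) : continuous (g_ j) -> deriv1 (G_ j) (g_ j) ->
    itg (lam 0 T) g -> itg (lam 0 T) (g_ j) -> 0 <= t -> t <= T ->
    `|(g0 + (G_ j t - G_ j 0)) - (g0 + prim 0 T g t)| <= \int[lam 0 T]_s `|g_ j s - g s|.
  move=> cg dG gi gi_ t0 tT.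
  rewrite -(FTC_itv false true t0 dG cg) -(prim_itv cg t0 tT).
  rewrite opprD addrACA subrr add0r -primB//; apply: prim_norm; exact: itgB.
have hjT j : P (hj j T, kj j T) - P (h0, k0) =
    \int[lam 0 T]_t (P1 (hj j t, kj j t) * d_ j t) +
    \int[lam 0 T]_t (P2 (hj j t, kj j t) * e_ j t).
  have chj := deriv1_continuous (dhj j); have ckj := deriv1_continuous (dkj j).
  have cP1 := C1pair_c1 CP; have cP2 := C1pair_c2 CP.
  have cpj : continuous (fun t => (hj j t, kj j t)).
    by move=> t; exact: (cvg_pair (chj t) (ckj t)).
  have c1 : continuous (fun t => P1 (hj j t, kj j t) * d_ j t).
    move=> t; apply: cvgM; last exact: cd.
    exact: (continuous_comp (cpj t) (cP1 _)).
  have c2 : continuous (fun t => P2 (hj j t, kj j t) * e_ j t).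
    move=> t; apply: cvgM; last exact: ce.
    exact: (continuous_comp (cpj t) (cP2 _)).
  rewrite -RintD; [|exact: continuous_itg_itv|exact: continuous_itg_itv].
  have dP : deriv1 (fun t => P (hj j t, kj j t))
      (fun t => P1 (hj j t, kj j t) * d_ j t + P2 (hj j t, kj j t) * e_ j t).
    by move=> t; exact: (C1pair_chain CP (dhj j t) (dkj j t)).
  rewrite (FTC_itv _ _ (ltW T0) dP); last by move=> t; exact: cvgD (c1 t) (c2 t).
  by rewrite /hj /kj !subrr !addr0.
(* Outside the interval the approximations are not controlled. *)
pose chi (t : mR) : R := \1_(`]0, T[%classic : set mR) t.
have mchi : measurable_fun setT chi by apply: measurable_indic; exact: measurable_itv.
have chiE : {ae lam 0 T, forall t, chi t = 1}.
  by apply: ae_leb_itv => t tI; rewrite /chi indicE mem_set.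
pose m := `|h0| + \int[lam 0 T]_t `|d t| + (`|k0| + \int[lam 0 T]_t `|e t|) + 1.
have I1 : 0 <= \int[lam 0 T]_t `|d t| by exact: Rint_ge0.
have I2 : 0 <= \int[lam 0 T]_t `|e t| by exact: Rint_ge0.
have hm t : `|h t| <= `|h0| + \int[lam 0 T]_t `|d t|.
  by rewrite (le_trans (ler_normD _ _))// lerD2l; exact: prim_norm.
have km t : `|k t| <= `|k0| + \int[lam 0 T]_t `|e t|.
  by rewrite (le_trans (ler_normD _ _))// lerD2l; exact: prim_norm.
have chiM (f : R -> R) t : (0 <= t -> t <= T -> `|f t| <= m) -> `|chi t * f t| <= m.
  rewrite /chi indicE; case: (boolP (t \in _)) => [|_ _]; last first.
    by rewrite mul0r normr0 /m; have := normr_ge0 h0; have := normr_ge0 k0; lra.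
  by rewrite inE/= in_itv/= => /andP[h1 h2] H; rewrite mul1r H// ltW.
have hjm j t : `|chi t * hj j t| <= m.
  apply: chiM => t0 tT; have := gap d d_ D_ h0 j t (cd j) (dD j) di (di_ j) t0 tT.
  have := d1 j; have := hm t; rewrite -/(h t) -/(hj j t).
  have := ler_normD (hj j t - h t) (h t); rewrite subrK /m.
  by have := normr_ge0 k0; lra.
have kjm j t : `|chi t * kj j t| <= m.
  apply: chiM => t0 tT; have := gap e e_ E_ k0 j t (ce j) (dE j) ei (ei_ j) t0 tT.
  have := e1 j; have := km t; rewrite -/(k t) -/(kj j t).
  have := ler_normD (kj j t - k t) (k t); rewrite subrK /m.
  by have := normr_ge0 h0; lra.
have hm' t : `|chi t * h t| <= m.
  by apply: chiM => _ _; have := hm t; have := normr_ge0 k0; rewrite /m; lra.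
have km' t : `|chi t * k t| <= m.
  by apply: chiM => _ _; have := km t; have := normr_ge0 h0; rewrite /m; lra.
have mh : measurable_fun (setT : set mR) h.
  by apply: measurable_funD => //; exact: measurable_prim.
have mk : measurable_fun (setT : set mR) k.
  by apply: measurable_funD => //; exact: measurable_prim.
have mhj j : measurable_fun (setT : set mR) (hj j).
  by apply: continuous_measurable_fun; exact: deriv1_continuous (dhj j).
have mkj j : measurable_fun (setT : set mR) (kj j).
  by apply: continuous_measurable_fun; exact: deriv1_continuous (dkj j).
pose V := fine (lam 0 T setT).
have conv (f : mR -> R) (f_ : nat -> mR -> R) (I_ : nat -> R) :
    measurable_fun setT f -> (forall j, measurable_fun setT (f_ j)) ->
    (forall j t, `|chi t * f_ j t| <= m) -> (forall t, `|chi t * f t| <= m) ->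
    (forall j t, 0 <= t -> t <= T -> `|f_ j t - f t| <= I_ j) ->
    I_ @ \oo --> (0 : R) ->
    \int[lam 0 T]_t `|chi t * f_ j t - chi t * f t| @[j --> \oo] --> (0 : R).
  move=> mf mf_ fm_ fm fI Icv.
  apply: (@squeeze_cvgr _ _ _ _ (cst 0) (fun j => I_ j * V)).
  - apply: nearW => j; rewrite Rint_ge0//= -Rintegral_cst//.
    apply: le_Rint.
    + apply: (itg_bounded (C := m + m)).
        apply: measurableT_comp => //; apply: measurable_funB; exact: measurable_funM.
      apply: aeW => t; rewrite normr_id (le_trans (ler_normB _ _))//.
      by rewrite lerD.
    + exact: itg_cst.
    + apply: ae_leb_itv => t tI; rewrite /chi indicE mem_set// !mul1r.
      by move: tI; rewrite in_itv/= => /andP[t0 tT]; apply: fI; exact: ltW.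
  - exact: cvg_cst.
  - by rewrite -[X in _ --> X](mul0r V); apply: cvgM => //; exact: cvg_cst.
have ah : \int[lam 0 T]_t `|chi t * hj j t - chi t * h t| @[j --> \oo] --> (0 : R).
  apply: (conv h hj _ mh mhj hjm hm' _ dcv) => j t t0 tT.
  exact: (gap d d_ D_ h0 j t (cd j) (dD j) di (di_ j) t0 tT).
have ak : \int[lam 0 T]_t `|chi t * kj j t - chi t * k t| @[j --> \oo] --> (0 : R).
  apply: (conv k kj _ mk mkj kjm km' _ ecv) => j t t0 tT.
  exact: (gap e e_ E_ k0 j t (ce j) (dE j) ei (ei_ j) t0 tT).
have mm (f : mR -> R) : measurable_fun setT f ->
    measurable_fun (setT : set mR) (fun t => chi t * f t).
  by move=> mf; exact: measurable_funM.
have drop (G : R * R -> R) (f g w : mR -> R) :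
    \int[lam 0 T]_t (G (chi t * f t, chi t * g t) * w t) =
    \int[lam 0 T]_t (G (f t, g t) * w t).
  by apply: eq_Rintegral_ae; apply: filterS (chiE) => t ->; rewrite !mul1r.
have R1 := Rint_comp_cvg (fun j => mm _ (mhj j)) (fun j => mm _ (mkj j)) (mm _ mh)
  (mm _ mk) hjm kjm hm' km' ah ak (C1pair_c1 CP) (C1pair_m1 CP) di_ di dcv.
have R2 := Rint_comp_cvg (fun j => mm _ (mhj j)) (fun j => mm _ (mkj j)) (mm _ mh)
  (mm _ mk) hjm kjm hm' km' ah ak (C1pair_c2 CP) (C1pair_m2 CP) ei_ ei ecv.
have R12 := cvgD R1 R2; rewrite !drop in R12.
have ptw (f : R) (f_ I_ : nat -> R) : (forall j, `|f_ j - f| <= I_ j) ->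
    I_ @ \oo --> (0 : R) -> f_ @ \oo --> f.
  move=> fI Icv; apply/cvgrPdist_le => r r0.
  move/cvgrPdist_le : Icv => /(_ _ r0); apply: filterS => j.
  rewrite sub0r normrN distrC => H; apply: (le_trans (fI j)).
  by apply: le_trans H; exact: ler_norm.
have hT : (fun j => hj j T) @ \oo --> h T.
  apply: ptw dcv => j; exact: (gap d d_ D_ h0 j T (cd j) (dD j) di (di_ j) (ltW T0) (lexx T)).
have kT : (fun j => kj j T) @ \oo --> k T.
  apply: ptw ecv => j; exact: (gap e e_ E_ k0 j T (ce j) (dE j) ei (ei_ j) (ltW T0) (lexx T)).
have LP : (fun j => P (hj j T, kj j T) - P (h0, k0)) @ \oo --> P (h T, k T) - P (h0, k0).
  apply: cvgB; last exact: cvg_cst.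
  by apply: (cvg_comp _ _ (cvg_pair hT kT)); exact: (C1pair_c CP).
apply: (cvg_unique (@Rhausdorff R) LP).
rewrite [X in X @ _](_ : _ = (fun j =>
  \int[lam 0 T]_t (P1 (chi t * hj j t, chi t * kj j t) * d_ j t) +
  \int[lam 0 T]_t (P2 (chi t * hj j t, chi t * kj j t) * e_ j t))); first exact: R12.
by apply/funext => j; rewrite hjT !drop.
Qed.

End TimeCalculus.
(** * Mollified equations *)

Section Cylinder.
Variable R : realType.
Notation mR := (measurableTypeR R).
Notation X := (mR * mR * mR)%type.
Notation tor := (tor R).
Notation cyl := (@cyl R).
Notation lam := (leb_itv false true).
Implicit Types (a b t s r T : R) (k : 'I_3) (N : nat).

Lemma itg_Rint2 a b (f : X * mR -> R) : itg (cyl a b) f ->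
  itg (lam a b) (fun t => \int[tor]_y f (y, t)).
Proof.
move=> fi; have := itg_Rint1 (is_prod_prodm (lam a b) tor) (itg_swap (@cylE R a b) fi).
by apply: eq_itg.
Qed.

Lemma continuous_bnd_itv a b (eta : R -> R) : continuous eta ->
  exists C, forall t, a < t < b -> `|eta t| <= C.
Proof.
move=> ce; have [ab|ba] := leP a b; last first.
  by exists 0 => t /andP[h1 h2]; exfalso; lra.
have cn : {within `[a, b], continuous (fun t => `|eta t|)}.
  by apply: continuous_subspaceT => t; apply: cvg_norm; exact: ce.
have [c _ hc] := EVT_max ab cn; exists `|eta c| => t /andP[h1 h2].
by apply: hc; rewrite in_itv/= !ltW.
Qed.

Lemma ae_cyl_time a b (P : R -> Prop) : (forall t, a < t < b -> P t) ->
  {ae cyl a b, forall z, P z.2}.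
Proof.
move=> H; apply: (ae_snd (@cylE R a b)); apply: ae_leb_itv => t.
by rewrite in_itv; exact: H.
Qed.

Lemma itg_kernel_time a b (K : X -> R) (eta : R -> R) (f : X * mR -> R) :
  measurable_fun setT K -> (exists C, forall y, `|K y| <= C) -> continuous eta ->
  itg (cyl a b) f -> itg (cyl a b) (fun z => f z * (K z.1 * eta z.2)).
Proof.
move=> mK [C KC] ce fi; have [D eD] := continuous_bnd_itv a b ce.
rewrite (_ : (fun z => _) = fun z => (K z.1 * eta z.2) * f z); last first.
  by apply/funext => z; rewrite mulrC.
apply: (itg_bM (C := C * D)) => //.
  apply: measurable_funM; first exact: measurableT_comp mK measurable_fst.
  exact: measurableT_comp (continuous_measurable_fun ce) measurable_snd.
apply: filterS (ae_cyl_time eD) => z h; rewrite normrM ler_pM//.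
Qed.

Lemma Rint_kernel_time a b (K : X -> R) (eta : R -> R) (f : X * mR -> R) :
  measurable_fun setT K -> (exists C, forall y, `|K y| <= C) -> continuous eta ->
  itg (cyl a b) f ->
  \int[cyl a b]_z (f z * (K z.1 * eta z.2)) =
  \int[lam a b]_t ((\int[tor]_y (K y * f (y, t))) * eta t).
Proof.
move=> mK bK ce fi; rewrite (Rfubini2 (@cylE R a b)); last exact: itg_kernel_time.
apply: eq_Rintegral_ae; apply: filterS (itg_slice2 (@cylE R a b) fi) => t ft /=.
rewrite mulrC -RintZ; first by apply: eq_Rintegral => y _; ring.
by have [C KC] := bK; apply: (itg_bM (C := C)) => //; exact: aeW.
Qed.

Lemma itg_kernel_slice a b (K : X -> R) (f : X * mR -> R) :
  measurable_fun setT K -> (exists C, forall y, `|K y| <= C) -> itg (cyl a b) f ->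
  itg (lam a b) (fun t => \int[tor]_y (K y * f (y, t))).
Proof.
move=> mK [C KC] fi; apply: (itg_Rint2 (f := fun z => K z.1 * f z)).
apply: (itg_bM (C := C)) => //; last exact: aeW.
exact: measurableT_comp mK measurable_fst.
Qed.

Let mol N : markov_kernel tor (kap3 N). Proof. exact: mol_markov (tor_mollifier R) N. Qed.

Lemma measurable_kap3 N (x : X) : measurable_fun setT (kap3 N x).
Proof. exact: measurable_kernel_row (mol N) x. Qed.

Lemma kap3_bnd N (x : X) : exists C, forall y, `|kap3 N x y| <= C.
Proof. by have [C kC] := kernel_norm (mol N); exists C. Qed.

Lemma measurable_dkap3_row N k (x : X) : measurable_fun setT (dkap3 N k x).
Proof. exact: measurable_fun_pair2 x (measurable_dkap3 N k). Qed.

Lemma dkap3_bnd N k (x : X) : exists C, forall y, `|dkap3 N k x y| <= C.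
Proof. by have [C kC] := dkap3_bounded R N k; exists C. Qed.

Notation avgc N f := (avgp tor (kap3 N) f).

(** The derivative of the average in the k-th coordinate; time is a parameter. *)
Definition davgp N k (f : X * mR -> R) (z : X * mR) : R :=
  davg N k (fun y => f (y, z.2)) z.1.

Lemma measurable_davgp N k f : measurable_fun setT f -> measurable_fun setT (davgp N k f).
Proof.
move=> mf; apply: (measurable_Rint2 tor
  (f := fun z : (X * mR) * X => dkap3 N k z.1.1 z.2 * f (z.2, z.1.2))).
have m1 : measurable_fun setT (fun z : (X * mR) * X => z.1.1).
  exact: measurableT_comp measurable_fst measurable_fst.
have m2 : measurable_fun setT (fun z : (X * mR) * X => z.1.2).
  exact: measurableT_comp measurable_snd measurable_fst.
apply: measurable_funM.
  exact: (measurableT_comp (measurable_dkap3 N k) (measurable_fun_pair m1 measurable_snd)).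
exact: measurableT_comp mf (measurable_fun_pair measurable_snd m2).
Qed.

Definition interior a b (eta : R -> R) : Prop :=
  [/\ smooth1 eta, exists2 s, a < s & forall t, t <= s -> eta t = 0 &
      forall t, b <= t -> eta t = 0].

Lemma smooth1_continuous (eta : R -> R) : smooth1 eta -> continuous eta.
Proof. by move=> se; have [] := se 0%N. Qed.

(** The fundamental lemma applies in time at each point x, and joint
    measurability joins the slices. *)
Lemma tested_ae a b (F G : X * mR -> R) :
  measurable_fun setT F -> measurable_fun setT G ->
  (forall x, itg (lam a b) (fun t => F (x, t))) ->
  (forall x, itg (lam a b) (fun t => G (x, t))) ->
  (forall x eta, interior a b eta ->
     \int[lam a b]_t (F (x, t) * eta t) = \int[lam a b]_t (G (x, t) * eta t)) ->
  {ae cyl a b, forall z, F z = G z}.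
Proof.
move=> mF mG Fi Gi FG; apply: (prod_ae1 (@cylE R a b)) => // x.
have H : {ae lam a b, forall t, F (x, t) - G (x, t) = 0}.
  apply: (time_fundamental (itgB (Fi x) (Gi x))) => eta se es eb.
  have ie : interior a b eta by [].
  have [C eC] := continuous_bnd_itv a b (smooth1_continuous se).
  have me : measurable_fun (setT : set mR) eta.
    by apply: continuous_measurable_fun; exact: smooth1_continuous.
  have eM (f : mR -> R) : itg (lam a b) f -> itg (lam a b) (fun t => f t * eta t).
    move=> fi; have -> : (fun t => f t * eta t) = (fun t => eta t * f t).
      by apply/funext => t; rewrite mulrC.
    apply: (itg_bM (C := C)) => //; apply: ae_leb_itv => t.
    by rewrite in_itv; exact: eC.
  transitivity (\int[lam a b]_t (F (x, t) * eta t - G (x, t) * eta t)).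
    by apply: eq_Rintegral => t _; rewrite mulrBl.
  by rewrite RintB; [rewrite FG// subrr|exact: eM|exact: eM].
by apply: filterS H => t /eqP; rewrite subr_eq0 => /eqP.
Qed.

(** The averages of q vanish, and q is their limit. *)
Lemma tested_eq0 a b (q : X * mR -> R) : itg (cyl a b) q ->
  (forall N (x : X) eta, interior a b eta ->
     \int[cyl a b]_z (q z * (kap3 N x z.1 * eta z.2)) = 0) ->
  {ae cyl a b, forall z, q z = 0}.
Proof.
move=> qi H; have mq := itgM qi.
have A0 N : {ae cyl a b, forall z, avgc N q z = 0}.
  apply: (tested_ae (G := fun=> 0)).
  - exact: (measurable_avgp (mol N)).
  - exact: measurable_cst.
  - move=> x; exact: (itg_kernel_slice (measurable_kap3 N x) (kap3_bnd N x) qi).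
  - by move=> x; exact: itg_cst.
  - move=> x eta ie; have [se _ _] := ie.
    under [RHS]eq_Rintegral do rewrite mul0r.
    rewrite Rint0 -(H N x eta ie) Rint_kernel_time//.
    + exact: measurable_kap3.
    + exact: kap3_bnd.
    + exact: smooth1_continuous.
apply: (Rint_eq0 qi); have := avgp_cvg (@cylE R a b) (tor_mollifier R) qi.
rewrite (_ : (fun N => _) = fun=> \int[cyl a b]_z `|q z|).
  by move/cvg_lim => /(_ (@Rhausdorff R)); rewrite lim_cst//; exact: Rhausdorff.
apply/funext => N; apply: eq_Rintegral_ae; apply: filterS (A0 N) => z ->.
by rewrite sub0r normrN.
Qed.

(** A density and its weak gradient on the torus times (0, T). The relation is
    required for the kernels, times functions of time, because these are the
    functions that the derivative of an average integrates against. *)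
Record wgrad T (c : X * mR -> R) (p : 'I_3 -> X * mR -> R) : Prop := MkWgrad {
  wg_m : measurable_fun setT c;
  wg_range : forall z, 0 <= c z <= 1;
  wg_pm : forall k, measurable_fun setT (p k);
  wg_p2 : forall k, itg (cyl 0 T) (fun z => p k z ^+ 2);
  wg_weak : forall k N (x : X) eta, interior 0 T eta ->
    \int[cyl 0 T]_z (c z * (dkap3 N k x z.1 * eta z.2)) =
    \int[cyl 0 T]_z (p k z * (kap3 N x z.1 * eta z.2)) }.

Section Wgrad.
Variables (T : R) (c : X * mR -> R) (p : 'I_3 -> X * mR -> R).
Hypothesis cp : wgrad T c p.

Lemma wg_norm z : `|c z| <= 1.
Proof. by have /andP[h1 h2] := wg_range cp z; rewrite ger0_norm. Qed.

Lemma wg_itg : itg (cyl 0 T) c.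
Proof. by apply: (itg_bounded (C := 1)); [exact: wg_m cp|apply: aeW; exact: wg_norm]. Qed.

Lemma wg_pitg k : itg (cyl 0 T) (p k).
Proof. exact: itg_sqr (wg_pm cp k) (wg_p2 cp k). Qed.

Lemma wg_slice t : itg tor (fun y => c (y, t)).
Proof.
apply: (itg_bounded (C := 1)); first exact: measurable_fun_pair1 t (wg_m cp).
by apply: aeW => y; exact: wg_norm.
Qed.

Lemma wg_avg_range N z : 0 <= avgc N c z <= 1.
Proof.
apply: (avg_range (mol N)); first exact: measurable_fun_pair1 z.2 (wg_m cp).
by apply: aeW => y; exact: wg_range cp _.
Qed.

Lemma wg_avg_norm N z : `|avgc N c z| <= 1.
Proof. by have /andP[h1 h2] := wg_avg_range N z; rewrite ger0_norm. Qed.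

Lemma wg_avg_m N : measurable_fun setT (avgc N c).
Proof. exact: (measurable_avgp (mol N) (wg_m cp)). Qed.

Lemma wg_avg_cvg : \int[cyl 0 T]_z `|avgc N c z - c z| @[N --> \oo] --> (0 : R).
Proof. by have H := avgp_cvg (@cylE R 0 T) (tor_mollifier R) wg_itg; exact: H. Qed.

(** The weak gradient, tested with the kernel itself, is the gradient of the
    average. *)
Lemma wg_avg_deriv N k : {ae cyl 0 T, forall z, davgp N k c z = avgc N (p k) z}.
Proof.
apply: tested_ae.
- exact: measurable_davgp (wg_m cp).
- exact: (measurable_avgp (mol N) (wg_pm cp k)).
- move=> x; exact: (itg_kernel_slice (measurable_dkap3_row N k x) (dkap3_bnd N k x) wg_itg).
- move=> x; exact: (itg_kernel_slice (measurable_kap3 N x) (kap3_bnd N x) (wg_pitg k)).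
- move=> x eta ie; have [se _ _] := ie; have ce := smooth1_continuous se.
  have := wg_weak cp k N x ie.
  rewrite (Rint_kernel_time (measurable_dkap3_row N k x) (dkap3_bnd N k x) ce wg_itg).
  by rewrite (Rint_kernel_time (measurable_kap3 N x) (kap3_bnd N x) ce (wg_pitg k)).
Qed.

End Wgrad.

Section WeakChainRule.
Variables (T : R) (c cb : X * mR -> R) (p pb : 'I_3 -> X * mR -> R).
Hypotheses (cp : wgrad T c p) (cbp : wgrad T cb pb).
Variables (P P1 P2 : R * R -> R).
Hypothesis CP : C1pair P P1 P2.

Let comp_bnd (G : R * R -> R) (f g : X * mR -> R) : continuous G ->
  (forall z, `|f z| <= 1) -> (forall z, `|g z| <= 1) ->
  exists C, forall z, `|G (f z, g z)| <= C.
Proof.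
by move=> cG f1 g1; have [C GC] := continuous_bounded_square 1 cG; exists C => z; exact: GC.
Qed.

Let comp_m (G : R * R -> R) (f g : X * mR -> R) : measurable_fun setT G ->
  measurable_fun setT f -> measurable_fun setT g ->
  measurable_fun setT (fun z => G (f z, g z)).
Proof. by move=> mG mf mg; exact: (measurableT_comp mG (measurable_fun_pair mf mg)). Qed.

Lemma itg_compM (G : R * R -> R) (f g w : X * mR -> R) : continuous G ->
  measurable_fun setT G -> measurable_fun setT f -> measurable_fun setT g ->
  (forall z, `|f z| <= 1) -> (forall z, `|g z| <= 1) ->
  itg (cyl 0 T) w -> itg (cyl 0 T) (fun z => G (f z, g z) * w z).
Proof.
move=> cG mG mf mg f1 g1 wi; have [C GC] := comp_bnd cG f1 g1.
by apply: (itg_bM (C := C)) => //; [exact: comp_m|exact: aeW].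
Qed.

Lemma comp_avg_cvg (G : R * R -> R) (w : X * mR -> R) (w_ : nat -> X * mR -> R) :
  continuous G -> measurable_fun setT G ->
  (forall N, itg (cyl 0 T) (w_ N)) -> itg (cyl 0 T) w ->
  \int[cyl 0 T]_z `|w_ N z - w z| @[N --> \oo] --> (0 : R) ->
  \int[cyl 0 T]_z (G (avgc N c z, avgc N cb z) * w_ N z) @[N --> \oo] -->
    \int[cyl 0 T]_z (G (c z, cb z) * w z).
Proof.
move=> cG mG wi_ wi wcv.
apply: (Rint_comp_cvg (wg_avg_m cp) (wg_avg_m cbp) (wg_m cp) (wg_m cbp)
  (wg_avg_norm cp) (wg_avg_norm cbp) (wg_norm cp) (wg_norm cbp)
  (wg_avg_cvg cp) (wg_avg_cvg cbp)) => //.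
Qed.

Lemma C1per_avg_comp (Q Q1 Q2 : R * R -> R) N k t : C1pair Q Q1 Q2 ->
  C1per k (fun x => Q (avgc N c (x, t), avgc N cb (x, t)))
    (fun x => Q1 (avgc N c (x, t), avgc N cb (x, t)) * davgp N k c (x, t) +
              Q2 (avgc N c (x, t), avgc N cb (x, t)) * davgp N k cb (x, t)).
Proof.
move=> CQ; exact: (C1per_comp CQ (C1per_avg N k (wg_slice cp t))
  (C1per_avg N k (wg_slice cbp t))).
Qed.

(** The chain rule holds classically for the averages, and integrating by parts
    in space moves the derivative away from the composition. *)
Lemma avg_chain_rule N k (phi phi' : X * mR -> R) :
  measurable_fun setT phi -> itg (cyl 0 T) phi' ->
  itg (cyl 0 T) (fun z => avgc N (p k) z * phi z) ->
  itg (cyl 0 T) (fun z => avgc N (pb k) z * phi z) ->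
  {ae lam 0 T, forall t, C1per k (fun x => phi (x, t)) (fun x => phi' (x, t))} ->
  \int[cyl 0 T]_z (P (avgc N c z, avgc N cb z) * phi' z) =
  - (\int[cyl 0 T]_z (P1 (avgc N c z, avgc N cb z) * (avgc N (p k) z * phi z)) +
     \int[cyl 0 T]_z (P2 (avgc N c z, avgc N cb z) * (avgc N (pb k) z * phi z))).
Proof.
move=> mphi phii' pphi pbphi Cphi; have [cP mP cP1 mP1 cP2 mP2 _] := CP.
have comp G w cG mG := @itg_compM G (avgc N c) (avgc N cb) w cG mG (wg_avg_m cp N)
  (wg_avg_m cbp N) (wg_avg_norm cp N) (wg_avg_norm cbp N).
have a1 := comp _ _ cP1 mP1 pphi; have a2 := comp _ _ cP2 mP2 pbphi.
have a0 := comp _ _ cP mP phii'.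
rewrite -(RintD a1 a2) (Rfubini2 (@cylE R 0 T) a0).
pose W z := (P1 (avgc N c z, avgc N cb z) * davgp N k c z +
             P2 (avgc N c z, avgc N cb z) * davgp N k cb z) * phi z.
have mW : measurable_fun setT W.
  have m1 := measurable_davgp N k (wg_m cp).
  have m2 := measurable_davgp N k (wg_m cbp).
  have m3 := comp_m mP1 (wg_avg_m cp N) (wg_avg_m cbp N).
  have m4 := comp_m mP2 (wg_avg_m cp N) (wg_avg_m cbp N).
  exact: measurable_funM (measurable_funD (measurable_funM m3 m1) (measurable_funM m4 m2)) mphi.
have WE : {ae cyl 0 T, forall z,
    P1 (avgc N c z, avgc N cb z) * (avgc N (p k) z * phi z) +
    P2 (avgc N c z, avgc N cb z) * (avgc N (pb k) z * phi z) = W z}.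
  have e1 := wg_avg_deriv cp N k; have e2 := wg_avg_deriv cbp N k.
  by apply: filterS2 e1 e2 => z E1 E2; rewrite /W E1 E2; ring.
have Wi : itg (cyl 0 T) W by exact: itg_ae (itgD a1 a2) mW WE.
rewrite (eq_Rintegral_ae WE) (Rfubini2 (@cylE R 0 T) Wi) -RintN; last exact: itg_Rint2.
apply: eq_Rintegral_ae; apply: filterS (Cphi) => t Ct.
exact: (C1per_ibp (C1per_avg_comp N k t CP) Ct).
Qed.

(** The chain rule for the averages, passed to the limit. *)
Lemma weak_chain_rule k (phi phi' : X * mR -> R) :
  measurable_fun setT phi -> measurable_fun setT phi' ->
  (exists C, {ae cyl 0 T, forall z, `|phi z| <= C}) ->
  (exists C, {ae cyl 0 T, forall z, `|phi' z| <= C}) ->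
  (forall t, C1per k (fun x => phi (x, t)) (fun x => phi' (x, t))) ->
  \int[cyl 0 T]_z (P (c z, cb z) * phi' z) =
  - \int[cyl 0 T]_z ((P1 (c z, cb z) * p k z + P2 (c z, cb z) * pb k z) * phi z).
Proof.
move=> mphi mphi' [C phiC] [C' phiC'] Cphi.
have [cP mP cP1 mP1 cP2 mP2 _] := CP.
have phii' : itg (cyl 0 T) phi' by exact: (itg_bounded mphi' phiC').
have phii w : itg (cyl 0 T) w -> itg (cyl 0 T) (fun z => w z * phi z).
  move=> wi; apply: (@eq_itg _ _ _ _ (fun z => phi z * w z)).
    by move=> z; rewrite mulrC.
  exact: (itg_bM mphi phiC wi).
have ap (q : X * mR -> R) N : itg (cyl 0 T) q -> itg (cyl 0 T) (avgc N q).
  exact: (itg_avgp (@cylE R 0 T) (mol N)).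
have conv (q : X * mR -> R) : itg (cyl 0 T) q ->
    \int[cyl 0 T]_z `|avgc N q z * phi z - q z * phi z| @[N --> \oo] --> (0 : R).
  move=> qi; have H := avgp_cvg (@cylE R 0 T) (tor_mollifier R) qi.
  apply: (@squeeze_cvgr _ _ _ _ (cst 0)
    (fun N => C * \int[cyl 0 T]_z `|avgc N q z - q z|)).
  - apply: nearW => N; rewrite Rint_ge0//=.
    have di := itg_abs (itgB (ap q N qi) qi).
    rewrite -(RintZ C di); apply: le_Rint.
    + exact: itg_abs (itgB (phii _ (ap q N qi)) (phii _ qi)).
    + exact: itgZ.
    + apply: filterS (phiC) => z h; rewrite -mulrBl normrM mulrC ler_wpM2r//.
  - exact: cvg_cst.
  - by rewrite -[X in _ --> X](mulr0 C); apply: cvgM => //; exact: cvg_cst.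
have cst0 : \int[cyl 0 T]_z `|phi' z - phi' z| @[N --> \oo] --> (0 : R).
  rewrite (_ : (fun=> _) = fun=> 0); first exact: cvg_cst.
  apply/funext => N; rewrite -[RHS](Rint0 (cyl 0 T)); apply: eq_Rintegral => z _.
  by rewrite subrr normr0.
have Lc := comp_avg_cvg cP mP (fun=> phii') phii' cst0.
have R1 := comp_avg_cvg cP1 mP1 (fun N => phii _ (ap _ N (wg_pitg cp k)))
  (phii _ (wg_pitg cp k)) (conv _ (wg_pitg cp k)).
have R2 := comp_avg_cvg cP2 mP2 (fun N => phii _ (ap _ N (wg_pitg cbp k)))
  (phii _ (wg_pitg cbp k)) (conv _ (wg_pitg cbp k)).
have i1 := itg_compM cP1 mP1 (wg_m cp) (wg_m cbp) (wg_norm cp) (wg_norm cbp)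
  (phii _ (wg_pitg cp k)).
have i2 := itg_compM cP2 mP2 (wg_m cp) (wg_m cbp) (wg_norm cp) (wg_norm cbp)
  (phii _ (wg_pitg cbp k)).
have -> : \int[cyl 0 T]_z ((P1 (c z, cb z) * p k z + P2 (c z, cb z) * pb k z) * phi z) =
    \int[cyl 0 T]_z (P1 (c z, cb z) * (p k z * phi z)) +
    \int[cyl 0 T]_z (P2 (c z, cb z) * (pb k z * phi z)).
  by rewrite -RintD//; apply: eq_Rintegral => z _; ring.
apply: (cvg_unique (@Rhausdorff R) Lc).
have Rc := cvgN (cvgD R1 R2); rewrite [X in X @ _](_ : _ = (fun N =>
  - (\int[cyl 0 T]_z (P1 (avgc N c z, avgc N cb z) * (avgc N (p k) z * phi z)) +
     \int[cyl 0 T]_z (P2 (avgc N c z, avgc N cb z) * (avgc N (pb k) z * phi z))))).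
  exact: Rc.
apply/funext => N; apply: avg_chain_rule => //.
- exact: phii (ap _ N (wg_pitg cp k)).
- exact: phii (ap _ N (wg_pitg cbp k)).
- exact: aeW.
Qed.

End WeakChainRule.

End Cylinder.

(** * The identity for abstract flows *)

Section Flow.
Variable R : realType.
Notation mR := (measurableTypeR R).
Notation X := (mR * mR * mR)%type.
Notation tor := (tor R).
Notation cyl := (@cyl R).
Notation lam := (leb_itv false true).
Notation avgc N f := (avgp tor (kap3 N) f).
Implicit Types (a b t s r T : R) (k : 'I_3) (N : nat).

Let mol N : markov_kernel tor (kap3 N). Proof. exact: mol_markov (tor_mollifier R) N. Qed.

Lemma itg_davgp T N k (q : X * mR -> R) : itg (cyl 0 T) q -> itg (cyl 0 T) (davgp N k q).
Proof.
move=> qi; have [C kC] := @dkap3_bounded R N k.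
pose g (t : mR) := \int[tor]_y `|q (y, t)|.
have gi : itg (lam 0 T) g by exact: (itg_Rint2 (itg_abs qi)).
have g1i : itg (cyl 0 T) (fun z => C * (1 * g z.2)).
  have H := itgZ C (itg_tensor (@cylE R 0 T) (itg_cst tor 1) gi); exact: H.
apply: (itg_le (measurable_davgp N k (itgM qi)) g1i).
apply: filterS (ae_snd (@cylE R 0 T) (itg_slice2 (@cylE R 0 T) qi)) => z qz.
have di := itg_dkap3 N k z.1 qz.
rewrite mul1r (le_trans (Rint_norm di))// /g -(RintZ C (itg_abs qz)).
apply: le_Rint; [exact: itg_abs|exact: itgZ (itg_abs qz)|].
by apply: aeW => y; rewrite normrM ler_wpM2r.
Qed.

(** A transported density: c evolves by minus the divergence of J, from c0
    to cT; the equation and the values at time T are read off the averages. *)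
Record wflow T (c : X * mR -> R) (J : 'I_3 -> X * mR -> R) (c0 cT : X -> R) : Prop :=
  MkWflow {
  wf_m : forall k, measurable_fun setT (J k);
  wf_2 : forall k, itg (cyl 0 T) (fun z => J k z ^+ 2);
  wf_0 : itg tor c0;
  wf_T : measurable_fun setT cT;
  wf_Trange : forall x, 0 <= cT x <= 1;
  wf_evol : forall N (x : X) eta eta', smooth1 eta -> smooth1 eta' -> deriv1 eta eta' ->
    (forall t, T <= t -> eta t = 0) -> (forall t, T <= t -> eta' t = 0) ->
    avg tor (kap3 N) c0 x * eta 0 +
    \int[cyl 0 T]_z (c z * (kap3 N x z.1 * eta' z.2)) =
    \sum_(k < 3) \int[cyl 0 T]_z (J k z * (dkap3 N k x z.1 * eta z.2));
  wf_trace : forall N (x : X), exists h : R -> R,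
    [/\ {ae lam 0 T, forall t, avgc N c (x, t) = h t},
        forall r, 0 < r <= T -> forall e, 0 < e -> exists2 dl, 0 < dl &
          forall t, 0 < t -> r - dl < t -> t < r -> `|h t - h r| <= e &
        h T = avg tor (kap3 N) cT x] }.

(** Minus the divergence of the averaged flux. *)
Definition rate N (J : 'I_3 -> X * mR -> R) (z : X * mR) : R :=
  - \sum_(k < 3) davgp N k (J k) z.

Section OneFlow.
Variables (T : R) (T0 : 0 < T) (c : X * mR -> R) (p J : 'I_3 -> X * mR -> R).
Variables (c0 cT : X -> R).
Hypotheses (cp : wgrad T c p) (cf : wflow T c J c0 cT).

Lemma wf_itg k : itg (cyl 0 T) (J k).
Proof. exact: itg_sqr (wf_m cf k) (wf_2 cf k). Qed.

Lemma wf_Titg : itg tor cT.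
Proof.
apply: (itg_bounded (C := 1)); first exact: wf_T cf.
by apply: aeW => x; have /andP[h1 h2] := wf_Trange cf x; rewrite ger0_norm.
Qed.

Lemma itg_davgp_row N k x : itg (lam 0 T) (fun t => davgp N k (J k) (x, t)).
Proof.
exact: (itg_kernel_slice (measurable_dkap3_row N k x) (dkap3_bnd N k x) (wf_itg k)).
Qed.

Lemma itg_rate_row N x : itg (lam 0 T) (fun t => rate N J (x, t)).
Proof. by apply: itgN; apply: itg_sum => k; exact: itg_davgp_row. Qed.

Lemma itg_rate N : itg (cyl 0 T) (rate N J).
Proof. by apply: itgN; apply: itg_sum => k; apply: itg_davgp; exact: wf_itg. Qed.

(** Testing the evolution with a kernel centred at x leaves an ordinary
    differential equation for the average at x. *)
Lemma wf_ode N x :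
  {ae lam 0 T, forall t, avgc N c (x, t) =
     avg tor (kap3 N) c0 x + prim 0 T (fun s => rate N J (x, s)) t} /\
  avg tor (kap3 N) cT x = avg tor (kap3 N) c0 x + prim 0 T (fun s => rate N J (x, s)) T.
Proof.
have [h [hE hl <-]] := wf_trace cf N x.
have key r : 0 < r -> r <= T ->
    h r = avg tor (kap3 N) c0 x + prim 0 T (fun s => rate N J (x, s)) r.
  move=> r0 rT; apply: (@weak_time_derivative R 0 T r _ _ 1 (fun t => avgc N c (x, t)) _ r0 rT).
  - exact: itg_rate_row.
  - exact: measurable_fun_pair2 x (wg_avg_m cp N).
  - by apply: aeW => t; exact: wg_avg_norm cp N _.
  - move=> e e0; have r0T : 0 < r <= T by rewrite r0.
    have [dl dl0 H] := hl r r0T e e0; exists dl => //.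
    have pos : {ae lam 0 T, forall t, 0 < t}.
      by apply: ae_leb_itv => t; rewrite in_itv/= => /andP[].
    by apply: filterS2 hE pos => t -> t0; exact: H.
  - move=> j; have ce := smooth1_continuous (smooth1_cutoff j r).
    have cd := smooth1_continuous (smooth1_dcutoff j r).
    have vanish t : T <= t -> cutoff j r t = 0.
      by move=> Tt; apply: cutoff_ge; exact: le_trans rT Tt.
    have vanish' t : T <= t -> dcutoff j r t = 0.
      move=> Tt; rewrite /dcutoff flatp_le0 ?mulr0 ?mul0r ?oppr0//.
      by rewrite subr_le0 (le_trans rT).
    have := wf_evol cf N x (smooth1_cutoff j r) (smooth1_dcutoff j r)
      (deriv1_cutoff j r) vanish vanish'.
    rewrite (Rint_kernel_time (measurable_kap3 N x) (kap3_bnd N x) cd (wg_itg cp)).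
    rewrite (eq_bigr (fun k => \int[lam 0 T]_t (davgp N k (J k) (x, t) * cutoff j r t)))
      => [H|k _]; last first.
      exact: (Rint_kernel_time (measurable_dkap3_row N k x) (dkap3_bnd N k x) ce (wf_itg k)).
    have E : \int[lam 0 T]_t (cutoff j r t * rate N J (x, t)) =
        - \sum_(k < 3) \int[lam 0 T]_t (davgp N k (J k) (x, t) * cutoff j r t).
      have ki k : itg (lam 0 T) (fun t => davgp N k (J k) (x, t) * cutoff j r t).
        have -> : (fun t => davgp N k (J k) (x, t) * cutoff j r t) =
            (fun t => cutoff j r t * davgp N k (J k) (x, t)).
          by apply/funext => t; rewrite mulrC.
        apply: (itg_bM (C := 1)); last exact: itg_davgp_row.
          exact: continuous_measurable_fun.
        by apply: aeW => t; have /andP[h1 h2] := cutoff_itv j r t; rewrite ger0_norm.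
      rewrite -Rint_sum// -RintN; last exact: itg_sum.
      apply: eq_Rintegral => t _; rewrite /rate mulrN mulrC mulr_suml//.
    by rewrite E; apply/eqP; rewrite subr_eq0 -H.
split; last by apply: key => //; exact: lexx.
have pos : {ae lam 0 T, forall t, 0 < t /\ t <= T}.
  by apply: ae_leb_itv => t; rewrite in_itv/= => /andP[? /ltW].
by apply: filterS2 hE pos => t -> [t0 tT]; exact: key.
Qed.

Lemma wf_avg_cvg : \int[tor]_x `|avg tor (kap3 N) cT x - cT x| @[N --> \oo] --> (0 : R).
Proof. exact: (mol_cvg (tor_mollifier R) wf_Titg). Qed.

Lemma wf_avgT_norm N x : `|avg tor (kap3 N) cT x| <= 1.
Proof.
have /andP[h1 h2] : 0 <= avg tor (kap3 N) cT x <= 1.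
  by apply: (avg_range (mol N)); [exact: wf_T cf|apply: aeW; exact: wf_Trange cf].
by rewrite ger0_norm.
Qed.

Lemma wf_avgT_m N : measurable_fun setT (avg tor (kap3 N) cT).
Proof. exact: measurable_avg (mol N) _ (wf_T cf). Qed.

End OneFlow.

Section FluxTerm.
Variables (T : R) (c cb : X * mR -> R) (p pb : 'I_3 -> X * mR -> R).
Hypotheses (cp : wgrad T c p) (cbp : wgrad T cb pb).
Variables (P P1 P2 : R * R -> R).
Hypothesis CP : C1pair P P1 P2.

(** The averaged chain rule moves the derivative from the flux to the densities;
    gradients and fluxes then converge in the mean square. *)
Lemma flux_term_cvg k (q : X * mR -> R) : measurable_fun setT q ->
  itg (cyl 0 T) (fun z => q z ^+ 2) ->
  (- \int[cyl 0 T]_z (P (avgc N c z, avgc N cb z) * davgp N k q z)) @[N --> \oo] -->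
  \int[cyl 0 T]_z ((P1 (c z, cb z) * p k z + P2 (c z, cb z) * pb k z) * q z).
Proof.
move=> mq q2; have qi := itg_sqr mq q2.
have [cP mP cP1 mP1 cP2 mP2 _] := CP.
have sq (f : X * mR -> R) (mf : measurable_fun setT f)
    (f2 : itg (cyl 0 T) (fun z => f z ^+ 2)) :=
  avgp_cvg_sqr (@cylE R 0 T) (tor_mollifier R) mf f2.
have ma (f : X * mR -> R) N : measurable_fun setT f -> measurable_fun setT (avgc N f).
  exact: (measurable_avgp (mol N)).
have [aq2 aqcv] := sq _ mq q2.
have prodi (f : X * mR -> R) : measurable_fun setT f -> itg (cyl 0 T) (fun z => f z ^+ 2) ->
    itg (cyl 0 T) (fun z => f z * q z).
  by move=> mf f2; exact: itg_sqrM.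
have prodiN (f : X * mR -> R) N : measurable_fun setT f -> itg (cyl 0 T) (fun z => f z ^+ 2) ->
    itg (cyl 0 T) (fun z => avgc N f z * avgc N q z).
  by move=> mf f2; apply: itg_sqrM; [exact: ma|exact: ma|exact: (sq _ mf f2).1|exact: aq2].
have prodcv (f : X * mR -> R) : measurable_fun setT f -> itg (cyl 0 T) (fun z => f z ^+ 2) ->
    \int[cyl 0 T]_z `|avgc N f z * avgc N q z - f z * q z| @[N --> \oo] --> (0 : R).
  move=> mf f2; have [f1 fcv] := sq _ mf f2.
  exact: (L2_mul_cvg (fun N => ma f N mf) (fun N => ma q N mq) mf mq f1 aq2 f2 q2 fcv aqcv).
have mp := wg_pm cp k; have p2 := wg_p2 cp k.
have mpb := wg_pm cbp k; have pb2 := wg_p2 cbp k.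
have R1 := comp_avg_cvg cp cbp cP1 mP1 (fun N => prodiN _ N mp p2) (prodi _ mp p2) (prodcv _ mp p2).
have R2 := comp_avg_cvg cp cbp cP2 mP2 (fun N => prodiN _ N mpb pb2) (prodi _ mpb pb2)
  (prodcv _ mpb pb2).
have i1 := itg_compM cP1 mP1 (wg_m cp) (wg_m cbp) (wg_norm cp) (wg_norm cbp) (prodi _ mp p2).
have i2 := itg_compM cP2 mP2 (wg_m cp) (wg_m cbp) (wg_norm cp) (wg_norm cbp) (prodi _ mpb pb2).
have -> : \int[cyl 0 T]_z ((P1 (c z, cb z) * p k z + P2 (c z, cb z) * pb k z) * q z) =
    \int[cyl 0 T]_z (P1 (c z, cb z) * (p k z * q z)) +
    \int[cyl 0 T]_z (P2 (c z, cb z) * (pb k z * q z)).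
  by rewrite -RintD//; apply: eq_Rintegral => z _; ring.
have Rc := cvgD R1 R2; rewrite [X in X @ _](_ : _ = (fun N =>
  \int[cyl 0 T]_z (P1 (avgc N c z, avgc N cb z) * (avgc N (p k) z * avgc N q z)) +
  \int[cyl 0 T]_z (P2 (avgc N c z, avgc N cb z) * (avgc N (pb k) z * avgc N q z)))).
  exact: Rc.
apply/funext => N; rewrite (avg_chain_rule cp cbp CP (N := N) (k := k) (phi := avgc N q)) ?opprK//.
- exact: ma.
- exact: itg_davgp.
- exact: prodiN.
- exact: prodiN.
- apply: filterS (itg_slice2 (@cylE R 0 T) qi) => t qt.
  by have H := C1per_avg N k qt; exact: H.
Qed.

End FluxTerm.

Section TwoFlows.
Variables (T : R) (T0 : 0 < T) (c cb : X * mR -> R) (p pb J Jb : 'I_3 -> X * mR -> R).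
Variables (c0 cT cbT : X -> R).
Hypotheses (cp : wgrad T c p) (cbp : wgrad T cb pb).
Hypotheses (cf : wflow T c J c0 cT) (cbf : wflow T cb Jb c0 cbT).
Variables (P P1 P2 P11 P12 P21 P22 : R * R -> R).
Hypotheses (CP : C1pair P P1 P2) (CP1 : C1pair P1 P11 P12) (CP2 : C1pair P2 P21 P22).
Hypothesis P0 : forall a, P (a, a) = 0.

(** The flows start from the same datum, so the chain rule in time leaves only
    the value at time T. *)
Lemma avg_flow_identity N :
  \int[tor]_x P (avg tor (kap3 N) cT x, avg tor (kap3 N) cbT x) =
  (\sum_(k < 3) - \int[cyl 0 T]_z (P1 (avgc N c z, avgc N cb z) * davgp N k (J k) z)) +
  (\sum_(k < 3) - \int[cyl 0 T]_z (P2 (avgc N c z, avgc N cb z) * davgp N k (Jb k) z)).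
Proof.
have [cP mP cP1 mP1 cP2 mP2 _] := CP.
have comp G w cG mG := @itg_compM R T G (avgc N c) (avgc N cb) w cG mG (wg_avg_m cp N)
  (wg_avg_m cbp N) (wg_avg_norm cp N) (wg_avg_norm cbp N).
have b1 := comp _ _ cP1 mP1 (itg_rate cf N); have b2 := comp _ _ cP2 mP2 (itg_rate cbf N).
transitivity (\int[cyl 0 T]_z (P1 (avgc N c z, avgc N cb z) * rate N J z) +
   \int[cyl 0 T]_z (P2 (avgc N c z, avgc N cb z) * rate N Jb z)).
  rewrite (Rfubini1 (@cylE R 0 T) b1) (Rfubini1 (@cylE R 0 T) b2).
  rewrite -(RintD (itg_Rint1 (@cylE R 0 T) b1) (itg_Rint1 (@cylE R 0 T) b2)).
  apply: eq_Rintegral => x _.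
  have [h1 ->] := wf_ode T0 cp cf N x; have [h2 ->] := wf_ode T0 cbp cbf N x.
  have := chain_time (avg tor (kap3 N) c0 x) (avg tor (kap3 N) c0 x) T0 CP
    (itg_rate_row cf N x) (itg_rate_row cbf N x).
  rewrite /= P0 subr0 => ->; congr (_ + _); apply: eq_Rintegral_ae.
    by apply: filterS2 h1 h2 => t e1 e2; congr (P1 (_, _) * _); [exact: esym e1|exact: esym e2].
  by apply: filterS2 h1 h2 => t e1 e2; congr (P2 (_, _) * _); [exact: esym e1|exact: esym e2].
have E (G : R * R -> R) (K : 'I_3 -> X * mR -> R) : continuous G -> measurable_fun setT G ->
    (forall k, itg (cyl 0 T) (K k)) ->
    \int[cyl 0 T]_z (G (avgc N c z, avgc N cb z) * rate N K z) =
    \sum_(k < 3) - \int[cyl 0 T]_z (G (avgc N c z, avgc N cb z) * davgp N k (K k) z).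
  move=> cG mG Ki.
  have ki k : itg (cyl 0 T) (fun z => G (avgc N c z, avgc N cb z) * davgp N k (K k) z).
    by apply: comp => //; exact: itg_davgp.
  rewrite sumrN -Rint_sum// -RintN; last exact: itg_sum.
  by apply: eq_Rintegral => z _; rewrite /rate mulrN mulr_sumr.
have e1 := E _ _ cP1 mP1 (wf_itg cf); have e2 := E _ _ cP2 mP2 (wf_itg cbf).
by rewrite e1 e2.
Qed.

Lemma flow_identity :
  \int[tor]_x P (cT x, cbT x) =
  (\sum_(k < 3) \int[cyl 0 T]_z
     ((P11 (c z, cb z) * p k z + P12 (c z, cb z) * pb k z) * J k z)) +
  (\sum_(k < 3) \int[cyl 0 T]_z
     ((P21 (c z, cb z) * p k z + P22 (c z, cb z) * pb k z) * Jb k z)).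
Proof.
have [cP mP _ _ _ _ _] := CP.
have normT (a : X -> R) : (forall x, 0 <= a x <= 1) -> forall x, `|a x| <= 1.
  by move=> H x; have /andP[h1 h2] := H x; rewrite ger0_norm.
have cst0 : \int[tor]_x `|(1 : R) - 1| @[N --> \oo] --> (0 : R).
  rewrite (_ : (fun=> _) = fun=> 0); first exact: cvg_cst.
  by apply/funext => N; rewrite subrr normr0 Rint0.
have L := Rint_comp_cvg (wf_avgT_m cf) (wf_avgT_m cbf) (wf_T cf) (wf_T cbf)
  (wf_avgT_norm cf) (wf_avgT_norm cbf) (normT _ (wf_Trange cf)) (normT _ (wf_Trange cbf))
  (wf_avg_cvg cf) (wf_avg_cvg cbf) cP mP (fun=> itg_cst tor 1) (itg_cst tor 1) cst0.
have {}L : \int[tor]_x P (avg tor (kap3 N) cT x, avg tor (kap3 N) cbT x) @[N --> \oo] -->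
    \int[tor]_x P (cT x, cbT x).
  rewrite (_ : \int[tor]_x P (cT x, cbT x) = \int[tor]_x (P (cT x, cbT x) * 1)).
    rewrite [X in X @ _](_ : _ = fun N => \int[tor]_x (P (avg tor (kap3 N) cT x, avg tor (kap3 N) cbT x) * 1)).
      exact: L.
    by apply/funext => N; apply: eq_Rintegral => x _; rewrite mulr1.
  by apply: eq_Rintegral => x _; rewrite mulr1.
apply: (cvg_unique (@Rhausdorff R) L).
rewrite [X in X @ _](_ : _ = fun N =>
  (\sum_(k < 3) - \int[cyl 0 T]_z (P1 (avgc N c z, avgc N cb z) * davgp N k (J k) z)) +
  (\sum_(k < 3) - \int[cyl 0 T]_z (P2 (avgc N c z, avgc N cb z) * davgp N k (Jb k) z))); last first.
  by apply/funext => N; exact: avg_flow_identity.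
have S (F : 'I_3 -> nat -> R) (l : 'I_3 -> R) : (forall k, F k @ \oo --> l k) ->
    (fun N => \sum_(k < 3) F k N) @ \oo --> \sum_(k < 3) l k.
  move=> H; rewrite !big_ord_recr !big_ord0 /=.
  rewrite [X in X @ _](_ : _ = (fun N => 0 + F (widen_ord (leqnSn 2) (widen_ord (leqnSn 1) ord_max)) N +
      F (widen_ord (leqnSn 2) ord_max) N + F ord_max N)); last first.
    by apply/funext => N; rewrite !big_ord_recr big_ord0.
  by apply: cvgD => //; apply: cvgD => //; apply: cvgD => //; exact: cvg_cst.
have S1 := S _ _ (fun k => flux_term_cvg cp cbp CP1 (k := k) (wf_m cf k) (wf_2 cf k)).
have S2 := S _ _ (fun k => flux_term_cvg cp cbp CP2 (k := k) (wf_m cbf k) (wf_2 cbf k)).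
have H := cvgD S1 S2; exact: H.
Qed.

End TwoFlows.

End Flow.

(** * Functions of class C2 on the half-line *)

Section HalfLineExtension.
Variable R : realType.
Implicit Types (f F g p : R -> R) (x l : R).

Lemma is_derive_eps F x l :
  (forall e, 0 < e -> exists2 d, 0 < d &
     forall y, y != x -> `|y - x| < d -> `|(F y - F x) / (y - x) - l| <= e) <->
  is_derive x 1 F l.
Proof.
have E h : h^-1 *: (F (h *: 1 + x) - F x) = (F (h + x) - F x) / ((h + x) - x).
  by rewrite addrK -[h *: 1]/(h * 1) mulr1 mulrC.
split=> [H|D].
  have C : h^-1 *: (F (h *: 1 + x) - F x) @[h --> 0^'] --> l.
    apply/cvgrPdist_le => e e0; have [d d0 Hd] := H e e0.
    apply/nbhs_ballP; exists d => //= h; rewrite /ball/= sub0r normrN => hd h0.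
    rewrite distrC E; apply: Hd; last by rewrite addrK.
    by rewrite -subr_eq0 addrK.
  by apply: DeriveDef; [apply/cvg_ex; exists l|exact: (cvg_lim (@Rhausdorff R) C)].
move=> e e0; have C : h^-1 *: (F (h *: 1 + x) - F x) @[h --> 0^'] --> l.
  have := @ex_derive _ _ _ _ _ _ _ D; rewrite /derivable => /cvg_ex[l' C].
  have El : 'D_1 F x = l by exact: (@derive_val _ _ _ _ _ _ _ D).
  by rewrite -El /derive (cvg_lim (@Rhausdorff R) C).
move/cvgrPdist_le : C => /(_ e e0) /nbhs_ballP[d /= d0 Hd]; exists d => // y yx yd.
have := Hd (y - x); rewrite /ball/= sub0r normrN => /(_ yd).
by rewrite subr_eq0 => /(_ yx); rewrite distrC E subrK.
Qed.

Notation halfline := (`[0, +oo[%classic : set R).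

Lemma diff_quot_eps f x l : 0 <= x ->
  diff_quot f x --> l <->
  (forall e, 0 < e -> exists2 d, 0 < d & forall y, 0 <= y -> y != x ->
     `|y - x| < d -> `|(f y - f x) / (y - x) - l| <= e).
Proof.
move=> x0; split=> [C e e0|H].
  move/cvgrPdist_le : C => /(_ e e0) /nbhs_ballP[d /= d0 Hd]; exists d => // y y0 yx yd.
  by rewrite distrC; apply: Hd => //=; rewrite ?in_itv/= ?y0// /ball/= distrC.
apply/cvgrPdist_le => e e0; have [d d0 Hd] := H e e0.
apply/nbhs_ballP; exists d => //= y; rewrite /ball/= distrC => yd yx.
by rewrite in_itv/= andbT => y0; rewrite distrC; exact: Hd.
Qed.

Lemma halfline_proper x : 0 <= x -> ProperFilter (within halfline x^').
Proof.
move=> x0; apply: Build_ProperFilter_ex => A /nbhs_ballP[d /= d0 Hd].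
exists (x + d / 2); apply: Hd => /=.
- rewrite /ball/= opprD addNKr normrN ger0_norm ?divr_ge0 ?ltW//.
  by rewrite ltr_pdivrMr// mulr_natr mulr2n ltrDl.
- by rewrite -subr_eq0 addrAC subrr add0r gt_eqF// divr_gt0.
- by rewrite in_itv/= andbT addr_ge0// divr_ge0// ltW.
Qed.

Lemma half_derivE f x l : 0 <= x -> diff_quot f x --> l -> half_deriv f x = l.
Proof.
move=> x0 C; have Pr := halfline_proper x0.
exact: (@cvg_lim _ (@Rhausdorff R) _ _ Pr _ _ C).
Qed.

Lemma half_deriv_cvg f x : 0 <= x -> cvg (diff_quot f x) ->
  diff_quot f x --> half_deriv f x.
Proof. by move=> x0 /cvg_ex[l C]; rewrite (half_derivE x0 C). Qed.

Lemma diff_quot_deriv f F F' : (forall x, 0 <= x -> f x = F x) -> deriv1 F F' ->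
  forall x, 0 <= x -> diff_quot f x --> F' x.
Proof.
move=> fF dF x x0; apply/(diff_quot_eps _ _ x0) => e e0.
have [d d0 Hd] := (is_derive_eps F x (F' x)).2 (dF x) e e0; exists d => // y y0 yx yd.
by rewrite !fF//; exact: Hd.
Qed.

Lemma half_deriv_deriv f F F' : (forall x, 0 <= x -> f x = F x) -> deriv1 F F' ->
  forall x, 0 <= x -> half_deriv f x = F' x.
Proof. by move=> fF dF x x0; apply: half_derivE => //; exact: diff_quot_deriv dF x x0. Qed.

Lemma C1_half_deriv f F F' : (forall x, 0 <= x -> f x = F x) -> deriv1 F F' ->
  continuous F' -> C1_half f.
Proof.
move=> fF dF cF; split=> [x x0|].
  by apply/cvg_ex; exists (F' x); exact: diff_quot_deriv dF x x0.
apply: (@subspace_eq_continuous _ _ _ F'); last exact: continuous_subspaceT.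
move=> x; rewrite inE/= in_itv/= andbT => x0.
by rewrite -(half_deriv_deriv fF dF).
Qed.

Lemma C2_half_id : C2_half (@id R).
Proof.
split; first exact: (C1_half_deriv (fun x _ => erefl) (@deriv1_id R) (fun=> cvg_cst _)).
apply: (C1_half_deriv (F := fun=> 1) (F' := fun=> 0)).
- by move=> x x0; exact: (half_deriv_deriv (fun x _ => erefl) (@deriv1_id R)).
- exact: deriv1_cst.
- by move=> x; exact: cvg_cst.
Qed.

Lemma half_deriv_id x : 0 <= x -> half_deriv (@id R) x = 1.
Proof. exact: (half_deriv_deriv (fun x _ => erefl) (@deriv1_id R)). Qed.

Lemma half_deriv2_id x : 0 <= x -> half_deriv (half_deriv (@id R)) x = 0.
Proof. exact: (half_deriv_deriv half_deriv_id (deriv1_cst 1)). Qed.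

Definition glue p f (x : R) : R := if 0 <= x then f x else p x.

Lemma glue_ge0 p f x : 0 <= x -> glue p f x = f x.
Proof. by rewrite /glue => ->. Qed.

Lemma glue_lt0 p f x : x < 0 -> glue p f x = p x.
Proof. by rewrite /glue leNgt => ->. Qed.

Lemma glue_le0 p f x : p 0 = f 0 -> x <= 0 -> glue p f x = p x.
Proof.
by move=> pf; rewrite le_eqVlt => /predU1P[->|/glue_lt0//]; rewrite glue_ge0.
Qed.

Lemma deriv1_glue p p' f : deriv1 p p' -> (forall x, 0 <= x -> cvg (diff_quot f x)) ->
  p 0 = f 0 -> p' 0 = half_deriv f 0 ->
  deriv1 (glue p f) (glue p' (half_deriv f)).
Proof.
move=> dp df pf pf' x; apply/is_derive_eps => e e0.
have L : x <= 0 -> exists2 d, 0 < d & forall y, y <= 0 -> y != x -> `|y - x| < d ->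
    `|(glue p f y - glue p f x) / (y - x) - glue p' (half_deriv f) x| <= e.
  move=> x0; have [d d0 Hd] := (is_derive_eps p x (p' x)).2 (dp x) e e0.
  by exists d => // y y0 yx yd; rewrite !glue_le0//; exact: Hd.
have U : 0 <= x -> exists2 d, 0 < d & forall y, 0 <= y -> y != x -> `|y - x| < d ->
    `|(glue p f y - glue p f x) / (y - x) - glue p' (half_deriv f) x| <= e.
  move=> x0; have [d d0 Hd] := (diff_quot_eps f _ x0).1 (half_deriv_cvg x0 (df x x0)) e e0.
  by exists d => // y y0 yx yd; rewrite !glue_ge0//; exact: Hd.
have [x0|x0|x0] := ltgtP x 0.
- have [d d0 Hd] := L (ltW x0); exists (Num.min d (- x)).
    by rewrite lt_min d0 oppr_gt0.
  move=> y yx; rewrite lt_min => /andP[yd yx'].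
  apply: Hd => //; have := ler_norm (y - x); lra.
- have [d d0 Hd] := U (ltW x0); exists (Num.min d x).
    by rewrite lt_min d0.
  move=> y yx; rewrite lt_min => /andP[yd yx'].
  by apply: Hd => //; have := ler_norm (- (y - x)); rewrite normrN; lra.
- subst x; have [d d0 Hd] := L (lexx 0); have [d' d'0 Hd'] := U (lexx 0).
  exists (Num.min d d'); first by rewrite lt_min d0.
  move=> y yx; rewrite lt_min => /andP[yd yd'].
  by have [y0|/ltW y0] := leP 0 y; [exact: Hd'|exact: Hd].
Qed.

Lemma continuous_glue p f : continuous p -> {within halfline, continuous f} ->
  p 0 = f 0 -> continuous (glue p f).
Proof.
move=> cp /subspace_continuousP cf pf x; apply/cvgrPdist_le => e e0.
have L : x <= 0 -> exists2 d, 0 < d & forall y, y <= 0 -> `|x - y| < d ->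
    `|glue p f x - glue p f y| <= e.
  move=> x0; have /cvgrPdist_le/(_ _ e0)/nbhs_ballP[d /= d0 Hd] := cp x.
  by exists d => // y y0 yd; rewrite !glue_le0//; exact: Hd.
have U : 0 <= x -> exists2 d, 0 < d & forall y, 0 <= y -> `|x - y| < d ->
    `|glue p f x - glue p f y| <= e.
  move=> x0; have xI : halfline x by rewrite /= in_itv/= x0.
  have /cvgrPdist_le/(_ _ e0)/nbhs_ballP[d /= d0 Hd] := cf x xI.
  by exists d => // y y0 yd; rewrite !glue_ge0//; apply: Hd => //=; rewrite in_itv/= y0.
apply/nbhs_ballP; have [x0|x0|x0] := ltgtP x 0.
- have [d d0 Hd] := L (ltW x0); exists (Num.min d (- x)).
    by rewrite /= lt_min d0 oppr_gt0.
  move=> y; rewrite /ball/= lt_min => /andP[yd yx'].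
  by apply: Hd => //; have := ler_norm (- (x - y)); rewrite normrN; lra.
- have [d d0 Hd] := U (ltW x0); exists (Num.min d x).
    by rewrite /= lt_min d0.
  move=> y; rewrite /ball/= lt_min => /andP[yd yx'].
  by apply: Hd => //; have := ler_norm (x - y); lra.
- subst x; have [d d0 Hd] := L (lexx 0); have [d' d'0 Hd'] := U (lexx 0).
  exists (Num.min d d'); first by rewrite /= lt_min d0.
  move=> y; rewrite /ball/= lt_min => /andP[yd yd'].
  by have [y0|/ltW y0] := leP 0 y; [exact: Hd'|exact: Hd].
Qed.

(** On the negative half-line, take the Taylor polynomial of degree 2 at 0. *)
Lemma C2_half_extension (beta : R -> R) : C2_half beta ->
  exists b0 b1 b2 : R -> R, [/\ deriv1 b0 b1, deriv1 b1 b2, continuous b2,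
    forall x, 0 <= x -> b0 x = beta x &
    forall x, 0 <= x -> b1 x = half_deriv beta x].
Proof.
move=> [[d1 _] [d2 c2]].
set u := beta 0; set v := half_deriv beta 0; set w := half_deriv (half_deriv beta) 0.
pose p0 x := u + (v * x + w / 2 * (x * x)); pose p1 x := v + w * x; pose p2 (x : R) := w.
have dp1 : deriv1 p1 p2.
  by apply: eq_deriv1 (deriv1D (deriv1_cst v) (deriv1Z w (@deriv1_id R))) => // x; rewrite /p2; lra.
have dp0 : deriv1 p0 p1.
  apply: eq_deriv1 (deriv1D (deriv1_cst u) (deriv1D (deriv1Z v (@deriv1_id R))
    (deriv1Z (w / 2) (deriv1M (@deriv1_id R) (@deriv1_id R))))) => // x.
  by rewrite /p1; lra.
exists (glue p0 beta), (glue p1 (half_deriv beta)), (glue p2 (half_deriv (half_deriv beta))).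
split.
- by apply: deriv1_glue => //; rewrite /p0 /p1 ?mulr0 ?addr0.
- by apply: deriv1_glue => //; rewrite /p1 ?mulr0 ?addr0.
- by apply: continuous_glue => // x; exact: cvg_cst.
- by move=> x; exact: glue_ge0.
- by move=> x; exact: glue_ge0.
Qed.

End HalfLineExtension.

Section Pairs.
Variable R : realType.

Lemma eq_C1pair (P P1 P2 Q Q1 Q2 : R * R -> R) : C1pair P P1 P2 -> P =1 Q -> P1 =1 Q1 -> P2 =1 Q2 ->
  C1pair Q Q1 Q2.
Proof. by move=> CP /funext <- /funext <- /funext <-. Qed.

Lemma C1pair_l (g g' : R -> R) : deriv1 g g' -> continuous g' ->
  C1pair (fun z => g z.1) (fun z => g' z.1) (fun=> 0).
Proof.
move=> dg cg'; have cg := deriv1_continuous dg.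
have c1 (h : R -> R) : continuous h -> continuous (fun z : R * R => h z.1).
  by move=> ch z; apply: continuous_comp; [exact: cvg_fst|exact: ch].
have m1 (h : R -> R) : continuous h -> measurable_fun setT (fun z : R * R => h z.1).
  by move=> ch; apply: measurableT_comp; [exact: continuous_measurable_fun|exact: measurable_fst].
split; [exact: c1|exact: m1|exact: c1|exact: m1| |exact: measurable_cst|].
  by move=> z; exact: cvg_cst.
move=> p q s p' q' dp dq; rewrite mul0r addr0.
have H := is_derive1_comp (dg (p s)) dp.
by apply: (is_derive_eq H); rewrite mulrC.
Qed.

Lemma C1pair_r (g g' : R -> R) : deriv1 g g' -> continuous g' ->
  C1pair (fun z => g z.2) (fun=> 0) (fun z => g' z.2).
Proof.
move=> dg cg'; have cg := deriv1_continuous dg.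
have c1 (h : R -> R) : continuous h -> continuous (fun z : R * R => h z.2).
  by move=> ch z; apply: continuous_comp; [exact: cvg_snd|exact: ch].
have m1 (h : R -> R) : continuous h -> measurable_fun setT (fun z : R * R => h z.2).
  by move=> ch; apply: measurableT_comp; [exact: continuous_measurable_fun|exact: measurable_snd].
split; [exact: c1|exact: m1| |exact: measurable_cst|exact: c1|exact: m1|].
  by move=> z; exact: cvg_cst.
move=> p q s p' q' dp dq; rewrite mul0r add0r.
have H := is_derive1_comp (dg (q s)) dq.
by apply: (is_derive_eq H); rewrite mulrC.
Qed.

Lemma C1pairD (P P1 P2 Q Q1 Q2 : R * R -> R) : C1pair P P1 P2 -> C1pair Q Q1 Q2 ->
  C1pair (fun z => P z + Q z) (fun z => P1 z + Q1 z) (fun z => P2 z + Q2 z).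
Proof.
move=> [cP mP cP1 mP1 cP2 mP2 dP] [cQ mQ cQ1 mQ1 cQ2 mQ2 dQ]; split.
- by move=> z; apply: cvgD; [exact: cP|exact: cQ].
- exact: measurable_funD.
- by move=> z; apply: cvgD; [exact: cP1|exact: cQ1].
- exact: measurable_funD.
- by move=> z; apply: cvgD; [exact: cP2|exact: cQ2].
- exact: measurable_funD.
move=> p q s p' q' dp dq; have a := dP _ _ _ _ _ dp dq; have b := dQ _ _ _ _ _ dp dq.
by apply: is_derive_eq (is_deriveD a b) _; ring.
Qed.

Lemma C1pairM (P P1 P2 Q Q1 Q2 : R * R -> R) : C1pair P P1 P2 -> C1pair Q Q1 Q2 ->
  C1pair (fun z => P z * Q z) (fun z => P1 z * Q z + P z * Q1 z)
    (fun z => P2 z * Q z + P z * Q2 z).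
Proof.
move=> [cP mP cP1 mP1 cP2 mP2 dP] [cQ mQ cQ1 mQ1 cQ2 mQ2 dQ]; split.
- by move=> z; apply: cvgM; [exact: cP|exact: cQ].
- exact: measurable_funM.
- by move=> z; apply: cvgD; apply: cvgM; [exact: cP1|exact: cQ|exact: cP|exact: cQ1].
- by apply: measurable_funD; exact: measurable_funM.
- by move=> z; apply: cvgD; apply: cvgM; [exact: cP2|exact: cQ|exact: cP|exact: cQ2].
- by apply: measurable_funD; exact: measurable_funM.
move=> p q s p' q' dp dq; have a := dP _ _ _ _ _ dp dq; have b := dQ _ _ _ _ _ dp dq.
apply: is_derive_eq (is_deriveM a b) _.
by rewrite -![_ *: _]/(_ * _); ring.
Qed.

Lemma C1pairN (P P1 P2 : R * R -> R) : C1pair P P1 P2 ->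
  C1pair (fun z => - P z) (fun z => - P1 z) (fun z => - P2 z).
Proof.
move=> CP; have z1 : deriv1 (fun _ : R => -1 : R) (fun=> 0) by exact: deriv1_cst.
have c0 : continuous (fun _ : R => 0 : R) by move=> x; exact: cvg_cst.
by apply: eq_C1pair (C1pairM (C1pair_l z1 c0) CP) _ _ _ => z; lra.
Qed.

Section Compositions.
Variables b0 b1 b2 : R -> R.
Hypotheses (d0 : deriv1 b0 b1) (d1 : deriv1 b1 b2) (c2 : continuous b2).

Let c1 : continuous b1. Proof. exact: deriv1_continuous d1. Qed.
Let cc : continuous (fun _ : R => 1 : R). Proof. by move=> x; exact: cvg_cst. Qed.

Definition gap_f (z : R * R) := b0 z.1 - b0 z.2.
Definition gap_f1 (z : R * R) := b1 z.1.
Definition gap_f2 (z : R * R) := - b1 z.2.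
Definition gap_g (z : R * R) := (z.1 - z.2) * b1 z.1.
Definition gap_g1 (z : R * R) := b1 z.1 + (z.1 - z.2) * b2 z.1.
Definition gap_g2 (z : R * R) := - b1 z.1.
Definition gap_h (z : R * R) := (z.1 - z.2) * b1 z.2.
Definition gap_h1 (z : R * R) := b1 z.2.
Definition gap_h2 (z : R * R) := - b1 z.2 + (z.1 - z.2) * b2 z.2.

Lemma C1pair_gap_f : C1pair gap_f gap_f1 gap_f2.
Proof.
apply: eq_C1pair (C1pairD (C1pair_l d0 c1) (C1pairN (C1pair_r d0 c1))) _ _ _ => z //;
  by rewrite /gap_f1 /gap_f2; lra.
Qed.

Let diff := C1pairD (C1pair_l (@deriv1_id R) cc) (C1pairN (C1pair_r (@deriv1_id R) cc)).

Lemma C1pair_gap_g : C1pair gap_g gap_g1 gap_g2.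
Proof.
apply: eq_C1pair (C1pairM diff (C1pair_l d1 c2)) _ _ _ => z //;
  by rewrite /gap_g1 /gap_g2; ring.
Qed.

Lemma C1pair_gap_h : C1pair gap_h gap_h1 gap_h2.
Proof.
apply: eq_C1pair (C1pairM diff (C1pair_r d1 c2)) _ _ _ => z //;
  by rewrite /gap_h1 /gap_h2; ring.
Qed.

(** The two families of gradients in the identity are those of the partial
    derivatives of [(beta a - beta b) (a - b)]. *)
Lemma C1pair_product : C1pair (fun z => gap_f z * (z.1 - z.2))
  (fun z => gap_f z + gap_g z) (fun z => - (gap_f z + gap_h z)).
Proof.
apply: eq_C1pair (C1pairM C1pair_gap_f diff) _ _ _ => z //;
  by rewrite /gap_f /gap_f1 /gap_f2 /gap_g /gap_h; ring.
Qed.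

End Compositions.

End Pairs.

(** * Representatives and test functions *)

Section LpRepresentatives.
Context d (T : measurableType d) (R : realType).
Variables (mu : {measure set T -> \bar R}) (D : set T).
Hypotheses (mD : measurable D) (Doo : (mu D < +oo)%E).
Let muD := mfrestr mD Doo.

Lemma in_Lp_measurable p (f : T -> R) : in_Lp mu p D f ->
  exists2 g, measurable_fun setT g & {ae mu, forall x, D x -> f x = g x}.
Proof.
move=> [g gL fg]; exists g => //.
by have := sub_Lfun_mfun gL; rewrite inE.
Qed.

Lemma in_L1_itg (f : T -> R) : in_Lp mu 1%E D f ->
  exists2 g, itg muD g & {ae mu, forall x, D x -> f x = g x}.
Proof.
move=> [g gL fg]; exists g => //; have /Lfun1_integrable gi := gL.
have mg := itgM gi; apply/(itg_restr mD Doo mg).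
exact: integrableS gi.
Qed.

Lemma in_L2_itg (f : T -> R) : in_Lp mu 2%:E D f ->
  exists g : T -> R, [/\ measurable_fun setT g, itg muD (fun x => g x ^+ 2) &
    {ae mu, forall x, D x -> f x = g x}].
Proof.
move=> [g gL fg]; exists g.
have mg : measurable_fun setT g by have := sub_Lfun_mfun gL; rewrite inE.
split=> //; have gi := Lfun2_integrable_sqr gL.
apply/(itg_restr mD Doo (measurable_funX 2 mg)).
exact: integrableS gi.
Qed.

Lemma itg_in_L1 (f g : T -> R) : itg muD g -> {ae mu, forall x, D x -> f x = g x} ->
  in_Lp mu 1%E D f.
Proof.
move=> gi fg; have mg := itgM gi; exists (g \_ D).
  apply/Lfun1_integrable; have /(itg_restr mD Doo mg) := gi.
  by rewrite integrable_mkcond// restrict_EFin.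
by apply: filterS fg => x H xD; rewrite patchE mem_set// H.
Qed.

Lemma Rint_ae_restr (f g : T -> R) : measurable_fun setT g ->
  {ae mu, forall x, D x -> f x = g x} ->
  \int[mu]_(x in D) f x = \int[muD]_x g x.
Proof. by move=> mg fg; rewrite (Rint_restr mD Doo mg); exact: eq_Rintegral_ae_in. Qed.

End LpRepresentatives.

Section SeparatelyContinuous.
Context d (X : measurableType d) (R : realType).
Notation mR := (measurableTypeR R).

(** Freezing the second variable on a grid gives countably many measurable
    pieces, and the grid can be refined. *)
Lemma measurable_separately (f : X * mR -> R) :
  (forall t, measurable_fun setT (fun x => f (x, t))) ->
  (forall x, continuous (fun t : R => f (x, t))) -> measurable_fun setT f.
Proof.
move=> mf cf; pose q n (i : int) : R := i%:~R / n.+1%:R.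
pose h n (z : X * mR) := f (z.1, q n (Num.floor (z.2 * n.+1%:R))).
apply: (measurable_fun_cvg (h := h)) => [n _ Y mY|[x t] _]; last first.
  suff Q : q n (Num.floor (t * n.+1%:R)) @[n --> \oo] --> t.
    exact: (cvg_comp _ _ Q (cf x t)).
  apply/cvgrPdist_le => e e0.
  have := near_infty_natSinv_lt (PosNum e0); apply: filterS => n /= hn.
  rewrite /q; have n0 : 0 < n.+1%:R :> R by rewrite ltr0n.
  have := floor_itv (t * n.+1%:R); set F := Num.floor _.
  rewrite intrD => /andP[h1 h2].
  have E : t = (t * n.+1%:R) / n.+1%:R by rewrite mulfK// gt_eqF.
  rewrite {1}E -mulrBl ger0_norm; last first.
    by apply: divr_ge0; [rewrite subr_ge0|exact: ltW].
  apply: le_trans (ltW hn); rewrite -[leRHS]mul1r ler_pM2r ?invr_gt0//.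
  by move: h1 h2; rewrite -[1%:~R]/(1 : R); move: (_%:~R) => y; lra.
rewrite setTI; pose i_ m : int := odflt 0 (unpickle m).
have -> : h n @^-1` Y = \bigcup_m
   ((fun x => f (x, q n (i_ m))) @^-1` Y `*`
    `[(i_ m)%:~R / n.+1%:R, ((i_ m) + 1)%:~R / n.+1%:R[%classic).
  have n0 : 0 < n.+1%:R :> R by rewrite ltr0n.
  apply/seteqP; split=> [[x t] /= hY|[x t] /= [m _ [/= fY]]].
    exists (pickle (Num.floor (t * n.+1%:R))) => //=.
    rewrite /i_ pickleK/=; split=> //=.
    rewrite in_itv/= ler_pdivrMr// ltr_pdivlMr//; exact: floor_itv.
  rewrite in_itv/= ler_pdivrMr// ltr_pdivlMr// -floor_eq => /eqP E.
  by rewrite /h/= E.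
apply: bigcup_measurable => m _; apply: measurableX; last exact: measurable_itv.
by rewrite -[X in measurable X]setTI; exact: mf.
Qed.

End SeparatelyContinuous.

Section TestFunctionTools.
Variable R : realType.
Notation mR := (measurableTypeR R).
Notation X := (mR * mR * mR)%type.
Implicit Types (phi : R * R * R * R -> R) (k : 'I_3).

Lemma continuous_measurable4 phi : continuous phi ->
  measurable_fun (setT : set (X * mR)) phi.
Proof.
move=> cphi; apply: measurable_separately => [t|x]; last first.
  by move=> t; apply: (continuous_comp (f := fun t => (x, t))) (cphi _);
    exact: (cvg_pair (cvg_cst _) (@cvg_id _ _)).
apply: (@measurable_separately _ (mR * mR)%type) => [x3|x12]; last first.
  by move=> x3; apply: (continuous_comp (f := fun x3 => (x12, x3, t))) (cphi _);
    exact: (cvg_pair (cvg_pair (cvg_cst _) (@cvg_id _ _)) (cvg_cst _)).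
apply: (@measurable_separately _ mR) => [x2|x1]; last first.
  by move=> x2; apply: (continuous_comp (f := fun x2 => (x1, x2, x3, t))) (cphi _);
    exact: (cvg_pair (cvg_pair (cvg_pair (cvg_cst _) (@cvg_id _ _)) (cvg_cst _)) (cvg_cst _)).
apply: continuous_measurable_fun => x1.
apply: (continuous_comp (f := fun x1 => (x1, x2, x3, t))) (cphi _).
exact: (cvg_pair (cvg_pair (cvg_pair (@cvg_id _ _) (cvg_cst _)) (cvg_cst _)) (cvg_cst _)).
Qed.

Lemma continuous_bounded_cyl phi (a b : R) : continuous phi ->
  exists C, forall x t, torus R x -> a <= t <= b -> `|phi (x, t)| <= C.
Proof.
move=> cphi; pose I : set R := `[0, 1]%classic.
have cK : compact (I `*` I `*` I `*` (`[a, b]%classic : set R)).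
  by apply: compact_setX; [apply: compact_setX; [apply: compact_setX|]|];
    exact: segment_compact.
have : compact (phi @` (I `*` I `*` I `*` (`[a, b]%classic : set R))).
  by apply: continuous_compact => //; apply: continuous_subspaceT.
move=> /compact_bounded[M [Mr HM]]; exists (M + 1) => x t xT tT.
apply: (HM (M + 1)); first by rewrite ltrDl.
exists (x, t) => //; move: xT => [[]]; rewrite /= !in_itv/=.
move=> /andP[a1 a2] /andP[a3 a4] /andP[a5 a6].
by split; [split; [split|]|]; rewrite /I //= in_itv/= ?a1 ?a3 ?a5 ?ltW.
Qed.

(** Directional derivatives along a basis vector are derivatives on lines. *)
Lemma test_fun_slice phi k t : test_fun phi ->
  C1per k (fun x => phi (x, t)) (fun x => space_deriv k phi (x, t)).
Proof.
move=> [sphi per [M0 phiM]].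
have [cphi H] := sphi 1%N; have [dphi [cdphi _]] := H (basis3 R k, 0).
have line (x : X) : continuous (fun s : R => (shiftk k x s, t) : R * R * R * R).
  have c0 (a b : R) : continuous (fun s : R => a + s * b).
    move=> s; apply: cvgD; first exact: cvg_cst.
    by apply: cvgM; [exact: cvg_id|exact: cvg_cst].
  move=> s.
  exact: (cvg_pair (cvg_pair (cvg_pair (c0 _ _ s) (c0 _ _ s)) (c0 _ _ s)) (cvg_cst _)).
have [C phiC] := continuous_bounded_cyl t t cphi.
have [C' phiC'] := continuous_bounded_cyl t t cdphi.
split.
- exact: measurable_fun_pair1 t (continuous_measurable4 cphi).
- exact: measurable_fun_pair1 t (continuous_measurable4 cdphi).
- by exists C => x xT; apply: phiC; rewrite ?lexx.
- by exists C' => x xT; apply: phiC'; rewrite ?lexx.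
- move=> x; rewrite -[RHS](per k); congr (phi (_, t)).
  by rewrite /shiftk /basis3 !mul1r; case: x => [[]].
- move=> x s; have E (h : R) : h^-1 *: (phi (shiftk k x (h *: 1 + s), t) - phi (shiftk k x s, t)) =
     h^-1 *: (phi (h *: (basis3 R k, 0) + (shiftk k x s, t)) - phi (shiftk k x s, t)).
    congr (_ *: (phi _ - _)); rewrite /shiftk -[h *: 1]/(h * 1) mulr1.
    pose e m : R := (k == m :> nat)%:R.
    rewrite -[RHS]/(h * e 0%N + (x.1.1 + s * e 0%N), h * e 1%N + (x.1.2 + s * e 1%N),
      h * e 2%N + (x.2 + s * e 2%N), h * 0 + t) mulr0 add0r.
    by congr (_, _, _, _); rewrite /e; ring.
  have C1 := dphi (shiftk k x s, t); have Ev : 'D_1 (fun s => phi (shiftk k x s, t)) s =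
      space_deriv k phi (shiftk k x s, t).
    by rewrite /space_deriv /derive; under eq_fun do rewrite E.
  apply: DeriveDef; last exact: Ev.
  by rewrite /derivable; under eq_fun do rewrite E.
- move=> x s; exact: continuous_comp (line x s) (cdphi _).
Qed.

End TestFunctionTools.

(** * Weak derivatives on the cylinder *)

Section WeakDerivatives.
Variable R : realType.
Notation mR := (measurableTypeR R).
Notation X := (mR * mR * mR)%type.
Notation tor := (tor R).
Notation cyl := (@cyl R).
Notation cyl_set := (@cyl_set R).
Notation lam := (leb_itv false true).
Implicit Types (a b t s r T : R) (k : 'I_3) (N : nat).

#[local] Instance leb4_ae_filter : Filter (nbhs (almost_everywhere (leb4 R))).
Proof. exact: ae_filter_ringOfSetsType. Qed.

Lemma in_Lp_sub d (Y : measurableType d) (mu : {measure set Y -> \bar R}) p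
    (D D' : set Y) (f : Y -> R) : D' `<=` D -> in_Lp mu p D f -> in_Lp mu p D' f.
Proof. by move=> DD [g gL fg]; exists g => //; apply: filterS fg => x H /DD; exact: H. Qed.

(** Test functions vanish for large times, so integrals over the infinite cylinder
    are integrals over a finite one, where representatives are available. *)
Lemma Rint_cyl_oo a b (F : R * R * R * R -> R) (G : X * mR -> R) : 0 <= a ->
  measurable_fun setT G ->
  (forall x t, 0 < t -> ~~ (a < t < b) -> F (x, t) = 0) ->
  {ae leb4 R, forall z, cyl_set a b z -> F z = G z} ->
  \int[leb4 R]_(z in cylinder_oo R) F z = \int[cyl a b]_z G z.
Proof.
move=> a0 mG F0 FG; rewrite -(Rint_ae_restr (measurable_cyl a b) (leb4_cyl_fin a b) mG FG).
rewrite Rintegral_mkcond [RHS]Rintegral_mkcond; apply: eq_Rintegral => -[x t] _.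
rewrite !patchE; case: (boolP ((x, t) \in cylinder_oo R)) => h1;
  case: (boolP ((x, t) \in cyl_set a b)) => h2 //.
- move: h1 h2; rewrite notin_setE inE => -[/= xT]; rewrite in_itv/= andbT => t0 h2.
  apply: F0 => //; apply/negP => h.
  by apply: h2; split=> //=; rewrite in_itv.
- move: h1 h2; rewrite notin_setE inE => h1 [/= xT]; rewrite in_itv/= => /andP[h2 _].
  by exfalso; apply: h1; split => //=; rewrite in_itv/= andbT (le_lt_trans a0).
Qed.

Lemma is_weak_deriv_ae k (f f' g g' : R * R * R * R -> R) :
  {ae leb4 R, forall z, cylinder_oo R z -> f z = f' z} ->
  {ae leb4 R, forall z, cylinder_oo R z -> g z = g' z} ->
  is_weak_deriv k f g -> is_weak_deriv k f' g'.
Proof.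
move=> ff gg [Lp weak]; split=> [a b a0|phi tphi].
  have sub z : (torus R `*` `[a, b]%classic) z -> cylinder_oo R z.
    move=> [zT]; rewrite /= in_itv/= => /andP[az _]; split=> //=.
    by rewrite in_itv/= andbT (lt_le_trans a0).
  have [[u uL fu] [v vL gv]] := Lp a b a0; split.
    exists u => //; apply: filterS2 ff fu => z H1 H2 zD.
    by rewrite -H1 ?H2//; exact: sub.
  exists v => //; apply: filterS2 gg gv => z H1 H2 zD.
  by rewrite -H1 ?H2//; exact: sub.
have -> : \int[leb4 R]_(z in cylinder_oo R) (f' z * space_deriv k phi z) =
    \int[leb4 R]_(z in cylinder_oo R) (f z * space_deriv k phi z).
  by apply: eq_Rintegral_ae_in; apply: filterS ff => z H /H ->.
have -> : \int[leb4 R]_(z in cylinder_oo R) (g' z * phi z) =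
    \int[leb4 R]_(z in cylinder_oo R) (g z * phi z).
  by apply: eq_Rintegral_ae_in; apply: filterS gg => z H /H ->.
exact: weak.
Qed.

Lemma ae_cyl_exhaust (P : R * R * R * R -> Prop) T :
  (forall a, 0 < a -> {ae leb4 R, forall z, cyl_set a T z -> P z}) ->
  {ae leb4 R, forall z, cylinder T z -> P z}.
Proof.
move=> H; have pos n : 0 < n.+1%:R^-1 :> R by rewrite invr_gt0 ltr0n.
have H' := ae_foralln (fun n => H n.+1%:R^-1 (pos n)).
apply: filterS H' => -[x t] Hx [xT]; rewrite /= in_itv/= => /andP[t0 tT].
have [n _ /(_ n (leqnn n))/= hn] := near_infty_natSinv_lt (PosNum t0).
by apply: (Hx n); split => //=; rewrite in_itv/= hn.
Qed.

Lemma interior_test_fun N (x : R * R * R) a b eta : 0 <= a -> interior a b eta ->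
  test_fun_interior (kernel_test N x eta).
Proof.
move=> a0 [se [s as_ es] eb]; split; first exact: kernel_test_fun se eb.
exists s; first exact: le_lt_trans a0 as_.
by move=> y t ts; rewrite kernel_testE es// mulr0.
Qed.

Lemma interior_out a b eta t : interior a b eta -> ~~ (a < t < b) -> eta t = 0.
Proof.
move=> [_ [s as_ es] eb]; rewrite negb_and -!leNgt => /orP[ta|/eb//].
by apply: es; rewrite (le_trans ta)// ltW.
Qed.

(** Kernels times functions of time separate integrable functions. Weak
    derivatives are integrable only away from time 0, whence the exhaustion. *)
Lemma weak_deriv_unique k (f g1 g2 : R * R * R * R -> R) T :
  is_weak_deriv k f g1 -> is_weak_deriv k f g2 ->
  {ae leb4 R, forall z, cylinder T z -> g1 z = g2 z}.
Proof.
move=> [L1 W1] [L2 W2]; apply: ae_cyl_exhaust => a a0.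
have sub : cyl_set a T `<=` torus R `*` `[a, T]%classic.
  by move=> z [zT]; rewrite /= in_itv/= => /andP[h1 h2]; split=> //=; rewrite in_itv/= !ltW.
have rep g : is_weak_deriv k f g -> exists2 q, itg (cyl a T) q &
    {ae leb4 R, forall z, cyl_set a T z -> g z = q z}.
  move=> [L _]; apply: (in_L1_itg (measurable_cyl a T) (leb4_cyl_fin a T)).
  by have [_ h] := L a T a0; exact: in_Lp_sub sub h.
have [q1 q1i E1] := rep g1 (conj L1 W1); have [q2 q2i E2] := rep g2 (conj L2 W2).
have q0 : {ae cyl a T, forall z, q1 z - q2 z = 0}.
  apply: tested_eq0 => [|N x eta ie]; first exact: itgB.
  have tphi := interior_test_fun N x (ltW a0) ie.
  have [se _ _] := ie; have ce := smooth1_continuous se.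
  have ki q : itg (cyl a T) q -> itg (cyl a T) (fun z => q z * (kap3 N x z.1 * eta z.2)).
    exact: (itg_kernel_time (measurable_kap3 N x) (kap3_bnd N x) ce).
  have E q g : itg (cyl a T) q -> {ae leb4 R, forall z, cyl_set a T z -> g z = q z} ->
     \int[leb4 R]_(z in cylinder_oo R) (g z * kernel_test N x eta z) =
     \int[cyl a T]_z (q z * (kap3 N x z.1 * eta z.2)).
    move=> qi gq; apply: Rint_cyl_oo (ltW a0) _ _ _.
    - exact: itgM (ki _ qi).
    - by move=> y t _ h; rewrite kernel_testE (interior_out ie h) !mulr0.
    - by apply: filterS gq => -[y t] H zD; rewrite H.
  transitivity (\int[cyl a T]_z (q1 z * (kap3 N x z.1 * eta z.2) -
      q2 z * (kap3 N x z.1 * eta z.2))).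
    by apply: eq_Rintegral => z _; rewrite mulrBl.
  rewrite (RintB (ki _ q1i) (ki _ q2i)) -(E _ _ q1i E1) -(E _ _ q2i E2).
  by apply/eqP; rewrite subr_eq0 -eqr_opp -(W1 _ tphi) -(W2 _ tphi).
have [H _] := ae_restrP (measurable_cyl a T) (leb4_cyl_fin a T) (fun z => q1 z - q2 z = 0).
have {}q0 := H q0.
apply: filterS2 (filterI E1 E2) (q0) => z [H1 H2] H3 zD; rewrite H1// H2//.
by apply/eqP; rewrite -subr_eq0 H3.
Qed.

(** A density and its weak gradient, up to representatives on a cylinder. *)
Record wrep T (f : R * R * R * R -> R) (pf : 'I_3 -> R * R * R * R -> R)
    (c : X * mR -> R) (p : 'I_3 -> X * mR -> R) : Prop := MkWrep {
  wr_wgrad : wgrad T c p;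
  wr_c : {ae leb4 R, forall z, cylinder T z -> f z = c z};
  wr_p : forall k, {ae leb4 R, forall z, cylinder T z -> pf k z = p k z} }.

Lemma wgrad_of_weak_deriv T (f : R * R * R * R -> R) (pf : 'I_3 -> R * R * R * R -> R)
    (c : X * mR -> R) (p : 'I_3 -> X * mR -> R) :
  measurable_fun setT c -> (forall z, 0 <= c z <= 1) ->
  (forall k, measurable_fun setT (p k)) ->
  (forall k, itg (cyl 0 T) (fun z => p k z ^+ 2)) ->
  {ae leb4 R, forall z, cylinder T z -> f z = c z} ->
  (forall k, {ae leb4 R, forall z, cylinder T z -> pf k z = p k z}) ->
  (forall k, is_weak_deriv k f (pf k)) ->
  wrep T f pf c p.
Proof.
move=> mc c01 mp p2 fc pfp W; split=> //; split=> // k N x eta ie.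
have tphi := interior_test_fun N x (lexx 0) ie.
have [se _ _] := ie; have ce := smooth1_continuous se.
have [_ /(_ _ tphi) W'] := W k.
have E1 : \int[leb4 R]_(z in cylinder_oo R)
    (f z * space_deriv k (kernel_test N x eta) z) =
    - \int[cyl 0 T]_z (c z * (dkap3 N k x z.1 * eta z.2)).
  have ci : itg (cyl 0 T) c.
    by apply: (itg_bounded (C := 1)) => //; apply: aeW => z;
      have /andP[h1 h2] := c01 z; rewrite ger0_norm.
  have ki := itg_kernel_time (measurable_dkap3_row N k x) (dkap3_bnd N k x) ce ci.
  rewrite -(RintN ki); apply: Rint_cyl_oo (lexx 0) _ _ _.
  - exact: measurableT_comp (itgM ki).
  - by move=> y t _ h; rewrite kernel_test_space// (interior_out ie h) mulr0 oppr0 mulr0.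
  - by apply: filterS (fc) => -[y t] H zD; rewrite H// kernel_test_space// mulrN.
have E2 : \int[leb4 R]_(z in cylinder_oo R) (pf k z * kernel_test N x eta z) =
    \int[cyl 0 T]_z (p k z * (kap3 N x z.1 * eta z.2)).
  have ki := itg_kernel_time (measurable_kap3 N x) (kap3_bnd N x) ce (itg_sqr (mp k) (p2 k)).
  apply: Rint_cyl_oo (lexx 0) (itgM ki) _ _.
  - by move=> y t _ h; rewrite kernel_testE (interior_out ie h) !mulr0.
  - by apply: filterS (pfp k) => -[y t] H zD; rewrite H.
by move: W'; rewrite E1 E2 => /oppr_inj.
Qed.

Lemma space_deriv0 k phi (x : R * R * R) (t : R) : (forall y, phi (y, t) = 0) ->
  test_fun phi -> space_deriv k phi (x, t) = 0.
Proof.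
move=> phi0 /(test_fun_slice k t) C; have := C1per_deriv C x.
rewrite (_ : (fun s => phi (shiftk k x s, t)) = cst 0); last exact/funext.
have -> : (x, t) = (shiftk k x 0, t) by rewrite /shiftk !mul0r !addr0; case: x => [[]].
move=> /(_ 0) D; rewrite -(@derive_val _ _ _ _ _ _ _ D).
by rewrite derive_cst.
Qed.

Section Composition.
Variables (f fb : R * R * R * R -> R) (pf pfb : 'I_3 -> R * R * R * R -> R).
Hypothesis reps : forall T, 0 < T -> exists c p cb pb, wrep T f pf c p /\ wrep T fb pfb cb pb.
Variables (P P1 P2 : R * R -> R).
Hypothesis CP : C1pair P P1 P2.

Definition chain k (z : R * R * R * R) :=
  P1 (f z, fb z) * pf k z + P2 (f z, fb z) * pfb k z.

Lemma comp_reps T (c : X * mR -> R) p (cb : X * mR -> R) pb k : wrep T f pf c p -> wrep T fb pfb cb pb ->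
  [/\ itg (cyl 0 T) (fun z => P (c z, cb z)),
      itg (cyl 0 T) (fun z => P1 (c z, cb z) * p k z + P2 (c z, cb z) * pb k z),
      {ae leb4 R, forall z, cylinder T z -> P (f z, fb z) = P (c z, cb z)} &
      {ae leb4 R, forall z, cylinder T z ->
         chain k z = P1 (c z, cb z) * p k z + P2 (c z, cb z) * pb k z}].
Proof.
move=> [cp fc pfp] [cbp fbc pfbp]; have [cP mP cP1 mP1 cP2 mP2 _] := CP.
have bnd (G : R * R -> R) (w : X * mR -> R) : continuous G -> measurable_fun setT G -> itg (cyl 0 T) w ->
    itg (cyl 0 T) (fun z => G (c z, cb z) * w z).
  move=> cG mG wi.
  exact: (itg_compM cG mG (wg_m cp) (wg_m cbp) (wg_norm cp) (wg_norm cbp) wi).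
split.
- apply: (@eq_itg _ _ _ _ (fun z => P (c z, cb z) * 1)).
    by move=> z; rewrite mulr1.
  by apply: bnd => //; exact: itg_cst.
- by apply: itgD; apply: bnd => //; [exact: wg_pitg cp k|exact: wg_pitg cbp k].
- by apply: filterS2 fc fbc => z H1 H2 zD; rewrite H1// H2.
- apply: filterS2 (filterI fc fbc) (filterI (pfp k) (pfbp k)) => z [H1 H2] [H3 H4] zD.
  by rewrite /chain H1// H2// H3// H4.
Qed.

(** The chain rule on a cylinder that contains the support of the test function. *)
Lemma chain_is_weak_deriv k : is_weak_deriv k (fun z => P (f z, fb z)) (chain k).
Proof.
split=> [a b a0|phi tphi].
  pose T := `|b| + 1; have T0 : 0 < T by rewrite ltr_wpDl.
  have [c [p [cb [pb [r rb]]]]] := reps T0; have [i1 i2 e1 e2] := comp_reps k r rb.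
  have sub : torus R `*` `[a, b]%classic `<=` cylinder T.
    move=> z [zT]; rewrite /= in_itv/= => /andP[h1 h2]; split=> //=.
    rewrite in_itv/= (lt_le_trans a0)//= /T (le_lt_trans h2)//.
    by rewrite (le_lt_trans (ler_norm b))// ltrDl.
  have h1 : in_Lp (leb4 R) 1%E (cylinder T) _ := itg_in_L1 i1 e1.
  have h2 : in_Lp (leb4 R) 1%E (cylinder T) _ := itg_in_L1 i2 e2.
  split; first exact: (@in_Lp_sub _ _ (leb4 R) 1%E _ _ _ sub h1).
  exact: (@in_Lp_sub _ _ (leb4 R) 1%E _ _ _ sub h2).
have [tf [a a0 phia]] := tphi; have [sphi per [M phiM]] := tf.
pose T := `|M| + 1; have T0 : 0 < T by rewrite ltr_wpDl.
have out x t : ~~ (0 < t < T) -> phi (x, t) = 0.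
  rewrite negb_and -!leNgt => /orP[t0|Tt]; first by apply: phia; rewrite (le_trans t0)// ltW.
  apply: phiM; rewrite (le_trans _ Tt)// /T (le_trans (ler_norm M))// lerDl.
  exact: ler01.
have [c [p [cb [pb [r rb]]]]] := reps T0; have [i1 i2 e1 e2] := comp_reps k r rb.
have [cphi H] := sphi 1%N; have [_ [cdphi _]] := H (basis3 R k, 0).
have mphi := continuous_measurable4 cphi; have mdphi := continuous_measurable4 cdphi.
have E1 : \int[leb4 R]_(z in cylinder_oo R) (P (f z, fb z) * space_deriv k phi z) =
    \int[cyl 0 T]_z (P (c z, cb z) * space_deriv k phi z).
  apply: Rint_cyl_oo (lexx 0) _ _ _.
  - exact: measurable_funM (itgM i1) mdphi.
  - move=> x t _ h; rewrite space_deriv0 ?mulr0// => y; exact: out.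
  - by apply: filterS e1 => z E zD; rewrite (E zD).
have E2 : \int[leb4 R]_(z in cylinder_oo R) (chain k z * phi z) =
    \int[cyl 0 T]_z ((P1 (c z, cb z) * p k z + P2 (c z, cb z) * pb k z) * phi z).
  apply: Rint_cyl_oo (lexx 0) _ _ _.
  - exact: measurable_funM (itgM i2) mphi.
  - by move=> x t _ h; rewrite (out x t h) mulr0.
  - apply: filterS e2 => z E zD; congr (_ * _); exact: (E zD).
have bnd (q : R * R * R * R -> R) : continuous q ->
    exists C, {ae cyl 0 T, forall z, `|q z| <= C}.
  move=> cq; have [C hC] := continuous_bounded_cyl 0 T cq; exists C.
  apply/ae_restrP; apply: aeW => -[x t] [/= xT]; rewrite in_itv/= => /andP[t0 tT].
  by apply: hC; rewrite ?ltW.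
rewrite E1 E2.
exact: (weak_chain_rule (wr_wgrad r) (wr_wgrad rb) CP mphi mdphi (bnd _ cphi) (bnd _ cdphi)
  (fun t => test_fun_slice k t tf)).
Qed.

End Composition.

End WeakDerivatives.

(** * Renormalized solutions as flows *)

Section Tools.
Variable R : realType.
Notation mR := (measurableTypeR R).
Notation X := (mR * mR * mR)%type.
Notation tor := (tor R).
Notation lam := (leb_itv false true).

Definition unit_clamp (x : R) : R := Num.max 0 (Num.min 1 x).

Lemma unit_clamp_itv x : 0 <= unit_clamp x <= 1.
Proof.
by rewrite /unit_clamp le_max lexx/= ge_max ler01 ge_min lexx.
Qed.

Lemma unit_clamp_id x : 0 <= x <= 1 -> unit_clamp x = x.
Proof. by move=> /andP[x0 x1]; rewrite /unit_clamp (min_idPr x1) (max_idPr x0). Qed.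

Lemma measurable_unit_clamp d (T : measurableType d) (f : T -> R) :
  measurable_fun setT f -> measurable_fun setT (fun x => unit_clamp (f x)).
Proof.
move=> mf; apply: measurable_maxr; first exact: measurable_cst.
by apply: measurable_minr => //; exact: measurable_cst.
Qed.

Section SquareIntegrable.
Context d (T : measurableType d) (mu : {finite_measure set T -> \bar R}).

Definition L2 (f : T -> R) : Prop :=
  measurable_fun setT f /\ itg mu (fun x => f x ^+ 2).

Lemma L2D f g : L2 f -> L2 g -> L2 (fun x => f x + g x).
Proof.
move=> [mf f2] [mg g2]; split; first exact: measurable_funD.
apply: (itg_le (g := fun x => 2 * f x ^+ 2 + 2 * g x ^+ 2)).
- by apply: measurable_funX; exact: measurable_funD.
- by apply: itgD; exact: itgZ.
- apply: aeW => x; rewrite ger0_norm ?sqr_ge0//.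
  by have := sqr_ge0 (f x - g x); rewrite sqrrB sqrrD; lra.
Qed.

Lemma L2_bM (b f : T -> R) (C : R) : measurable_fun setT b -> (forall x, `|b x| <= C) ->
  L2 f -> L2 (fun x => b x * f x).
Proof.
move=> mb bC [mf f2]; split; first exact: measurable_funM.
have H := itg_bM (C := C ^+ 2) (measurable_funX 2 mb) (_ : {ae mu, forall x, `|b x ^+ 2| <= C ^+ 2}) f2.
apply: (eq_itg _ (H _)) => [x|]; first by rewrite exprMn.
apply: aeW => x; rewrite normrX; apply: lerXn2r => //; rewrite nnegrE//.
exact: le_trans (normr_ge0 _) (bC x).
Qed.

Lemma L2Z (a : R) (f : T -> R) : L2 f -> L2 (fun x => a * f x).
Proof. by apply: (L2_bM (b := fun=> a) (C := `|a|)) => //; exact: measurable_cst. Qed.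

Lemma L2_sum (I : Type) (s : seq I) (P : pred I) (f : I -> T -> R) :
  (forall i, P i -> L2 (f i)) -> L2 (fun x => \sum_(i <- s | P i) f i x).
Proof.
move=> fi; elim: s => [|i s IH].
  under eq_fun do rewrite big_nil.
  split; first exact: measurable_cst.
  by apply: (eq_itg (f := fun=> 0)) (itg_cst mu 0) => x; rewrite expr0n.
have [Pi|Pi] := boolP (P i).
  by under eq_fun do rewrite big_cons Pi; apply: L2D => //; exact: fi.
by under eq_fun do rewrite big_cons (negbTE Pi).
Qed.

End SquareIntegrable.

Lemma norm_le_sqr (w d : R) : 0 < d -> `|w| <= d + d^-1 * w ^+ 2.
Proof.
move=> d0; rewrite -(ler_pM2l d0) mulrDr mulVKf ?gt_eqF//.
have := sqr_ge0 (`|w| - d); rewrite sqrrB (real_normK (num_real w)).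
by have := sqr_ge0 w; have := sqr_ge0 d; move: (`|w|) (w ^+ 2) => v q; lra.
Qed.

Lemma ae_left_point (T s : R) (P : R -> Prop) : 0 <= s -> s < T ->
  {ae lam 0 T, forall t, P t} -> exists t, s < t < T /\ P t.
Proof.
move=> s0 sT H.
have H' : {ae @lebesgue_measure R, forall t, (`]0, T[%classic : set mR) t -> P t}.
  have [E _] := @ae_restrP _ mR R (@lebesgue_measure R) `]0, T[%classic (measurable_itv _)
    (leb_itv_fin false true 0 T) P; exact: E H.
have [N [mN N0 PN]] := H'; apply: contrapT => nP.
have sub : (`]s, T[%classic : set mR) `<=` N.
  move=> t /=; rewrite in_itv/= => tI; apply: PN => /= Pt; apply: nP; exists t; split => //.
  by apply: Pt; move: tI => /andP[st tT]; rewrite /= in_itv/= tT (le_lt_trans s0).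
have h := le_measure (@lebesgue_measure R) (mem_set (measurable_itv `]s, T[)) (mem_set mN) sub.
have {}h : (@lebesgue_measure R `]s, T[%classic <= 0)%E by apply: le_trans h _; rewrite [leLHS]N0.
move: h; rewrite lebesgue_measure_itv/= lte_fin sT.
by rewrite -EFinD lee_fin subr_le0 leNgt sT.
Qed.

(** The distance of v to [0, 1] is at most its distance to its averages, which
    tends to 0. *)
Lemma avg_range_ae (v : X -> R) : itg tor v ->
  (forall N x, 0 <= avg tor (kap3 N) v x <= 1) -> {ae tor, forall x, v x = unit_clamp (v x)}.
Proof.
move=> vi H; have mv := itgM vi.
have di : itg tor (fun x => v x - unit_clamp (v x)).
  apply: itgB => //; apply: (itg_bounded (C := 1)); first exact: measurable_unit_clamp.
  by apply: aeW => x; have /andP[h1 h2] := unit_clamp_itv (v x); rewrite ger0_norm.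
have mol N := mol_markov (tor_mollifier R) N.
have D0 : {ae tor, forall x, v x - unit_clamp (v x) = 0}.
  apply: (Rint_eq0 di); apply/eqP; rewrite eq_le Rint_ge0// andbT.
  have cv := mol_cvg (tor_mollifier R) vi.
  set a := \int[tor]_x _.
  have near : \forall N \near \oo, a <= \int[tor]_x `|avg tor (kap3 N) v x - v x|; last first.
    exact: (closed_cvg (fun y => a <= y) (@closed_ge R a) near _ cv).
  apply: nearW => N; apply: le_Rint.
  - exact: itg_abs.
  - exact: itg_abs (itgB (itg_avg (mol N) vi) vi).
  - apply: aeW => x; have := H N x; move: (avg _ _ _ _) => w /andP[w0 w1].
    rewrite /unit_clamp; have [h1|h1] := leP 1 (v x).
      rewrite (max_idPr ler01) ger0_norm ?subr_ge0// ler_normr.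
      by apply/orP; right; lra.
    have [h2|h2] := leP (v x) 0.
      rewrite subr0 ler0_norm// ler_normr.
      by apply/orP; left; lra.
    by rewrite subrr normr0.
by apply: filterS D0 => x /eqP; rewrite subr_eq0 => /eqP.
Qed.

End Tools.

Section Solutions.
Variables (R : realType) (n : nat).
Notation mR := (measurableTypeR R).
Notation X := (mR * mR * mR)%type.
Notation tor := (tor R).
Notation cyl := (@cyl R).
Notation cyl_set := (@cyl_set R).
Notation lam := (leb_itv false true).
Notation avgc N f := (avgp tor (kap3 N) f).
Variables (D : 'I_n -> 'I_n -> R) (c0 : 'I_n -> R * R * R -> R).
Variables (c : 'I_n -> R * R * R * R -> R) (u : 'I_n -> R * R * R * R -> 'rV[R]_3).
Hypothesis sol : renormalized_solution D c0 c u.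
Hypothesis rep : L2_continuous_in_time c.

#[local] Instance leb3_ae_filter : Filter (nbhs (almost_everywhere (leb3 R))).
Proof. exact: ae_filter_ringOfSetsType. Qed.

#[local] Instance leb4_ae_filter' : Filter (nbhs (almost_everywhere (leb4 R))).
Proof. exact: ae_filter_ringOfSetsType. Qed.

Lemma density_reps : exists chat : 'I_n -> X * mR -> R,
  [/\ forall i, measurable_fun setT (chat i), forall i z, 0 <= chat i z <= 1 &
      forall i, {ae leb4 R, forall z, cylinder_oo R z -> c i z = chat i z}].
Proof.
have [[H _] _ _ _] := sol.
have /choice[g gP] : forall i, exists g : X * mR -> R, measurable_fun setT g /\
    {ae leb4 R, forall z, cylinder_oo R z -> c i z = g z}.
  by move=> i; have [/in_Lp_measurable[g mg cg] _] := H i; exists g.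
exists (fun i z => unit_clamp (g i z)); split.
- by move=> i; apply: measurable_unit_clamp; have [] := gP i.
- by move=> i z; exact: unit_clamp_itv.
- move=> i; have [_ cg] := gP i; have [_ c01] := H i.
  by apply: filterS2 cg c01 => z E r zD; rewrite -E// unit_clamp_id// r.
Qed.

Variables (T : R) (T0 : 0 < T).

Let cylP (P : R * R * R * R -> Prop) : {ae leb4 R, forall z, cylinder_oo R z -> P z} ->
  {ae leb4 R, forall z, cyl_set 0 T z -> P z}.
Proof.
apply: filterS => z H [zT]; rewrite /= in_itv/= => /andP[z0 _]; apply: H.
by split=> //=; rewrite in_itv/= z0.
Qed.

(** The flux is the product of the bounded square root of the density and a
    square-integrable field. *)
Lemma flux_reps : exists J : 'I_n -> 'I_3 -> X * mR -> R,
  (forall i k, L2 (cyl 0 T) (J i k)) /\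
  (forall i k, {ae leb4 R, forall z, cyl_set 0 T z -> flux c u i z 0 k = J i k z}).
Proof.
have [[H _] H2 _ _] := sol; have [chat [mc c01 cE]] := density_reps.
suff /choice[J HJ] : forall i, exists J : 'I_3 -> X * mR -> R, forall k,
    L2 (cyl 0 T) (J k) /\
    {ae leb4 R, forall z, cyl_set 0 T z -> flux c u i z 0 k = J k z}.
  by exists J; split=> i k; have [] := HJ i k.
move=> i; suff /choice[J HJ] : forall k, exists J : X * mR -> R,
    L2 (cyl 0 T) J /\
    {ae leb4 R, forall z, cyl_set 0 T z -> flux c u i z 0 k = J z}.
  by exists J.
move=> k; have [_ /(_ T T0) [_ /(_ k) w2]] := H2 i.
have [w [mw ww wE]] := in_L2_itg (measurable_cyl 0 T) (leb4_cyl_fin 0 T) w2.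
exists (fun z => Num.sqrt (chat i z) * w z); split.
  apply: (L2_bM (C := 1)) => [|z|//].
    by apply: measurableT_comp (mc i); exact: continuous_measurable_fun (@sqrt_continuous R).
  have /andP[h0 h1] := c01 i z; rewrite ger0_norm ?sqrtr_ge0//.
  by rewrite -[leRHS]sqrtr1 ler_wsqrtr.
have [_ r] := H i; apply: filterS2 (filterI wE (cylP (cE i))) (cylP r) => z [E1 E2] r1 zD.
rewrite -(E1 zD) -(E2 zD) /flux !mxE mulrA -expr2 sqr_sqrtr//.
by have /andP[] := r1 zD.
Qed.

(** The fluxes determine the gradient of the density, which is therefore square
    integrable. *)
Lemma gradient_rep i (chat : 'I_n -> X * mR -> R) (J : 'I_n -> 'I_3 -> X * mR -> R) :
  (forall i, measurable_fun setT (chat i)) -> (forall i z, 0 <= chat i z <= 1) ->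
  (forall i, {ae leb4 R, forall z, cylinder_oo R z -> c i z = chat i z}) ->
  (forall i k, L2 (cyl 0 T) (J i k)) ->
  (forall i k, {ae leb4 R, forall z, cyl_set 0 T z -> flux c u i z 0 k = J i k z}) ->
  exists p, wrep T (c i) (fun k z => weak_grad (c i) z 0 k) (chat i) p.
Proof.
move=> mc c01 cE J2 JE; have [_ _ [_ [FS _]] _] := sol; have [wd FE] := FS i.
have cn j z : `|chat j z| <= 1 by have /andP[h0 h1] := c01 j z; rewrite ger0_norm.
pose p k z := - \sum_(j < n | j != i)
  (D i j)^-1 * (chat j z * J i k z + - chat i z * J j k z).
have p2 k : L2 (cyl 0 T) (p k).
  have H : L2 (cyl 0 T) (fun z => \sum_(j < n | j != i)
      (D i j)^-1 * (chat j z * J i k z + - chat i z * J j k z)).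
    apply: L2_sum => j _; apply/L2Z/L2D; apply: (L2_bM (C := 1)) => //.
      exact: measurableT_comp (mc i).
    by move=> z; rewrite normrN.
  rewrite (_ : p k = fun z => -1 * \sum_(j < n | j != i)
      (D i j)^-1 * (chat j z * J i k z + - chat i z * J j k z)); first exact: L2Z.
  by apply/funext => z; rewrite mulN1r.
exists p; apply: wgrad_of_weak_deriv => //.
- by move=> k; have [] := p2 k.
- by move=> k; have [] := p2 k.
- exact: cylP (cE i).
- move=> k.
  have allc : {ae leb4 R, forall z, forall j, cyl_set 0 T z -> c j z = chat j z}.
    by apply: filter_forall => j; exact: cylP (cE j).
  have allJ : {ae leb4 R, forall z, forall j, cyl_set 0 T z -> flux c u j z 0 k = J j k z}.
    by apply: filter_forall => j; exact: JE.
  apply: filterS2 (filterI allc allJ) (cylP FE) => z [h1 h2] h3 zD.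
  rewrite -(h3 zD) mxE summxE /p; congr (- _); apply: eq_bigr => j _.
  by rewrite !mxE -!(h1 _ zD) -!(h2 _ zD) !mxE mulNr.
- move=> k; have H := xgetPex (cst 0) (wd k).
  apply: is_weak_deriv_ae H; first exact: aeW.
  by apply: aeW => z _; rewrite mxE.
Qed.

Lemma kernel_space_dot (v : 'rV[R]_3) N (x : X) eta (y : X) (t : R) : smooth1 eta ->
  dot v (space_grad (kernel_test N x eta) (y, t)) =
  - \sum_(k < 3) v 0 k * (dkap3 N k x y * eta t).
Proof.
move=> se; rewrite /dot -sumrN; apply: eq_bigr => k _.
by rewrite mxE kernel_test_space// mulrN.
Qed.

(** The equation renormalized by the identity: its last term vanishes with the
    second derivative of the identity. *)
Lemma evolution i (chat : X * mR -> R) (J : 'I_3 -> X * mR -> R) (c0hat : X -> R)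
    N (x : X) (eta eta' : R -> R) :
  measurable_fun setT chat -> (forall z, 0 <= chat z <= 1) ->
  {ae leb4 R, forall z, cylinder_oo R z -> c i z = chat z} ->
  (forall k, L2 (cyl 0 T) (J k)) ->
  (forall k, {ae leb4 R, forall z, cyl_set 0 T z -> flux c u i z 0 k = J k z}) ->
  itg tor c0hat -> {ae leb3 R, forall y, torus R y -> c0 i y = c0hat y} ->
  smooth1 eta -> smooth1 eta' -> deriv1 eta eta' ->
  (forall t, T <= t -> eta t = 0) -> (forall t, T <= t -> eta' t = 0) ->
  avg tor (kap3 N) c0hat x * eta 0 +
  \int[cyl 0 T]_z (chat z * (kap3 N x z.1 * eta' z.2)) =
  \sum_(k < 3) \int[cyl 0 T]_z (J k z * (dkap3 N k x z.1 * eta z.2)).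
Proof.
move=> mc c01 cE J2 JE c0i c0E se se' de eT eT'.
have [[Hi _] _ [RE _] _] := sol.
have ce := smooth1_continuous se; have ce' := smooth1_continuous se'.
have := RE i (kernel_test N x eta) id (kernel_test_fun N x se eT) (@C2_half_id R).
rewrite /renormalized_equation.
have [_ r] := Hi i.
have out t : ~~ (0 < t < T) -> 0 < t -> T <= t.
  by move=> h t0; move: h; rewrite t0/= -leNgt.
have ci : itg (cyl 0 T) chat.
  by apply: (itg_bounded (C := 1)) => //; apply: aeW => z;
    have /andP[h1 h2] := c01 z; rewrite ger0_norm.
have -> : \int[leb3 R]_(y in torus R) (id (c0 i y) * kernel_test N x eta (y, 0)) =
    avg tor (kap3 N) c0hat x * eta 0.
  have mk := mol_markov (tor_mollifier R) N.
  have ri := itg_row mk x c0i.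
  rewrite mulrC -(RintZ (eta 0) ri).
  apply: Rint_ae_restr; first exact: itgM (itgZ (eta 0) ri).
  by apply: filterS c0E => y E yT; rewrite kernel_testE /= E//; ring.
have -> : \int[leb4 R]_(z in cylinder_oo R)
    (id (c i z) * time_deriv (kernel_test N x eta) z) =
    \int[cyl 0 T]_z (chat z * (kap3 N x z.1 * eta' z.2)).
  apply: Rint_cyl_oo (lexx 0) _ _ _.
  - exact: itgM (itg_kernel_time (measurable_kap3 N x) (kap3_bnd N x) ce' ci).
  - by move=> y t t0 h; rewrite (kernel_test_time _ _ _ _ de) (eT' _ (out t h t0)) !mulr0.
  - apply: filterS (cylP cE) => -[y t] E zD.
    by rewrite (kernel_test_time _ _ _ _ de) /= (E zD).
have ki k := itg_kernel_time (measurable_dkap3_row N k x) (dkap3_bnd N k x) ce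
  (itg_sqr (J2 k).1 (J2 k).2).
have -> : \int[leb4 R]_(z in cylinder_oo R) (Num.sqrt (c i z) * half_deriv id (c i z) *
     dot (Num.sqrt (c i z) *: u i z) (space_grad (kernel_test N x eta) z)) =
    - \sum_(k < 3) \int[cyl 0 T]_z (J k z * (dkap3 N k x z.1 * eta z.2)).
  rewrite -Rint_sum// -RintN; last exact: itg_sum.
  apply: Rint_cyl_oo (lexx 0) _ _ _.
  - exact: itgM (itgN (itg_sum _ ki)).
  - move=> y t t0 h; rewrite kernel_space_dot// (eT _ (out t h t0)).
    by rewrite big1 ?oppr0 ?mulr0// => k _; rewrite !mulr0.
  - have allJ : {ae leb4 R, forall z, forall k, cyl_set 0 T z -> flux c u i z 0 k = J k z}.
      by apply: filter_forall.
    apply: filterS2 allJ (cylP r) => -[y t] h1 h2 zD.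
    have /andP[c_ge0 _] := h2 zD.
    rewrite kernel_space_dot// half_deriv_id// mulr1 mulrN mulr_sumr; congr (- _).
    apply: eq_bigr => k _; rewrite -(h1 k zD) /flux !mxE.
    by rewrite -{3}(sqr_sqrtr c_ge0); ring.
have -> : \int[leb4 R]_(z in cylinder_oo R) (c i z * half_deriv (half_deriv id) (c i z) *
     dot (weak_grad (fun w => Num.sqrt (c i w)) z) (Num.sqrt (c i z) *: u i z) *
     kernel_test N x eta z) = \int[leb4 R]_(z in cylinder_oo R) (0 : R).
  apply: eq_Rintegral_ae_in; apply: filterS r => z h zD; have /andP[c_ge0 _] := h zD.
  by rewrite half_deriv2_id// mulr0 !mul0r.
rewrite (_ : \int[leb4 R]_(z in cylinder_oo R) (0 : R) = 0); last first.
  by rewrite Rintegral_mkcond (_ : _ \_ _ = fun=> 0) ?Rint0//; apply/funext => z; rewrite patchE; case: ifP.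
by rewrite mulr0 addr0 => /eqP; rewrite subr_eq0 => /eqP.
Qed.

Lemma slice_reps i : exists g : R -> X -> R, forall t, 0 <= t ->
  L2 tor (g t) /\ {ae leb3 R, forall y, torus R y -> c i (y, t) = g t y}.
Proof.
suff /choice[g gP] : forall t, exists g : X -> R, 0 <= t -> L2 tor g /\
    {ae leb3 R, forall y, torus R y -> c i (y, t) = g y} by exists g.
move=> t; have [t0|t0] := leP 0 t; last by exists (fun=> 0) => h; exfalso; lra.
have [/in_L2_itg] := rep i t0.
move=> /(_ (@measurable_torus R) (@leb3_torus_fin R))[g [mg g2 cg]] _.
by exists g.
Qed.

(** The inequality |a| <= d + a^2 / d turns convergence in the mean square of the
    slices into convergence of their averages. *)
Lemma slice_continuous i (g : R -> X -> R) N (x : X) r : 0 <= r ->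
  (forall t, 0 <= t -> L2 tor (g t) /\
     {ae leb3 R, forall y, torus R y -> c i (y, t) = g t y}) ->
  forall e, 0 < e -> exists2 dl, 0 < dl & forall t, 0 <= t -> `|t - r| < dl ->
    `|avg tor (kap3 N) (g t) x - avg tor (kap3 N) (g r) x| <= e.
Proof.
move=> r0 gP e e0; have mk := mol_markov (tor_mollifier R) N.
have [C kC] := kernel_norm mk; have C0 : 0 <= C := le_trans (normr_ge0 _) (kC x x).
pose V := \int[tor]_y (1 : R).
have V0 : 0 <= V by apply: Rint_ge0 => _; exact: ler01.
(* The constant part contributes C d V, the square part C eps / d. *)
pose d := e / (2 * (C * V + 1)); have CV0 : 0 <= C * V by exact: mulr_ge0.
have d0 : 0 < d by rewrite divr_gt0// mulr_gt0// ltr_wpDl.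
have [_ cv] := rep i r0.
pose eps := d * e / (2 * (C + 1)).
have eps0 : 0 < eps by rewrite divr_gt0// mulr_gt0// ltr_wpDl.
move/cvgrPdist_le : cv => /(_ eps eps0) /nbhs_ballP[dl /= dl0 H].
exists dl => // t t0 tr; have tI : (`[0, +oo[%classic : set R) t by rewrite /= in_itv/= t0.
have := H t _ tI; rewrite /ball/= distrC => /(_ tr).
have [[mt t2] tE] := gP t t0; have [[mr r2] rE] := gP r r0.
have dL : L2 tor (fun y => g t y - g r y).
  have := L2D (conj mt t2) (L2Z (-1) (conj mr r2)).
  by under eq_fun do rewrite mulN1r.
have [md d2] := dL; have di := itg_sqr md d2.
have -> : \int[leb3 R]_(y in torus R) (c i (y, t) - c i (y, r)) ^+ 2 =
    \int[tor]_y (g t y - g r y) ^+ 2.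
  apply: Rint_ae_restr; first exact: itgM d2.
  by apply: filterS2 tE rE => y E1 E2 yT; rewrite E1// E2.
have S0 : 0 <= \int[tor]_y (g t y - g r y) ^+ 2 by apply: Rint_ge0 => y; exact: sqr_ge0.
rewrite sub0r normrN ger0_norm// => Seps.
rewrite -(avgB mk x (itg_sqr mt t2) (itg_sqr mr r2)).
have b1 := Rint_norm (itg_row mk x di); apply: (le_trans b1).
have h1 : itg tor (fun=> d) by exact: itg_cst.
have h2 := itgZ d^-1 d2.
have step : \int[tor]_y `|kap3 N x y * (g t y - g r y)| <=
    \int[tor]_y (C * (d + d^-1 * (g t y - g r y) ^+ 2)).
  apply: le_Rint.
  - exact: itg_abs (itg_row mk x di).
  - by have h3 := itgZ C (itgD h1 h2); exact: h3.
  - apply: aeW => y; rewrite normrM ler_pM//.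
    exact: norm_le_sqr.
apply: (le_trans step); rewrite (RintZ C (itgD h1 h2)) (RintD h1 h2) (RintZ d^-1 d2).
have -> : \int[tor]_y d = d * V by rewrite -[in LHS](mulr1 d) RintZ//; exact: itg_cst.
have bS : d^-1 * \int[tor]_y (g t y - g r y) ^+ 2 <= e / (2 * (C + 1)).
  rewrite -(ler_pM2l d0) mulVKf ?gt_eqF// mulrA; exact: Seps.
have e20 : 0 <= e / 2 by rewrite divr_ge0// ltW.
have a1 : C * (d * V) <= e / 2.
  rewrite /d; have p : 0 < C * V + 1 by rewrite ltr_wpDl.
  rewrite (_ : C * _ = (e / 2) * (C * V / (C * V + 1))); last by field; rewrite gt_eqF.
  by apply: ler_piMr => //; rewrite ler_pdivrMr// mul1r lerDl.
have a2 : C * (e / (2 * (C + 1))) <= e / 2.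
  have p : 0 < C + 1 by rewrite ltr_wpDl.
  rewrite (_ : C * _ = (e / 2) * (C / (C + 1))); last by field; rewrite gt_eqF.
  by apply: ler_piMr => //; rewrite ler_pdivrMr// mul1r lerDl.
rewrite mulrDr [leRHS](splitr e) lerD//.
by apply: le_trans a2; rewrite ler_wpM2l.
Qed.

Lemma slice_avg i (chat : X * mR -> R) (g : R -> X -> R) N (x : X) :
  {ae leb4 R, forall z, cylinder_oo R z -> c i z = chat z} ->
  (forall t, 0 <= t -> L2 tor (g t) /\
     {ae leb3 R, forall y, torus R y -> c i (y, t) = g t y}) ->
  {ae lam 0 T, forall t, avgc N chat (x, t) = avg tor (kap3 N) (g t) x}.
Proof.
move=> cE gP.
have [_ E] := ae_restrP (measurable_cyl 0 T) (leb4_cyl_fin 0 T) (fun z => c i z = chat z).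
have H := ae_prod2 (@cylE R 0 T) (E (cylP cE)).
have pos : {ae lam 0 T, forall t, 0 < t}.
  by apply: ae_leb_itv => t; rewrite in_itv/= => /andP[].
apply: filterS2 H pos => t ct t0; apply: eq_Rintegral_ae.
have [_ gE] := gP t (ltW t0).
have gE' : {ae tor, forall y, c i (y, t) = g t y} by apply/ae_restrP.
by apply: filterS2 ct gE' => y <- <-.
Qed.

(** The averages at time T are limits of averages at earlier times, which lie in
    [0, 1]. *)
Lemma slice_end_range i (chat : X * mR -> R) (g : R -> X -> R) :
  measurable_fun setT chat -> (forall z, 0 <= chat z <= 1) ->
  {ae leb4 R, forall z, cylinder_oo R z -> c i z = chat z} ->
  (forall t, 0 <= t -> L2 tor (g t) /\
     {ae leb3 R, forall y, torus R y -> c i (y, t) = g t y}) ->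
  {ae tor, forall y, g T y = unit_clamp (g T y)}.
Proof.
move=> mc c01 cE gP; have [[mT T2] _] := gP T (ltW T0).
apply: avg_range_ae; first exact: itg_sqr mT T2.
move=> N x; have mk := mol_markov (tor_mollifier R) N.
have key e : 0 < e -> - e <= avg tor (kap3 N) (g T) x <= 1 + e.
  move=> e0; have [dl dl0 H] := slice_continuous N x (ltW T0) gP e0.
  have sT : Num.max 0 (T - dl) < T by rewrite gt_max T0 ltrBlDr ltrDl.
  have s0 : 0 <= Num.max 0 (T - dl) by rewrite le_max lexx.
  have [t [/andP[st tT] tE]] := ae_left_point s0 sT (slice_avg N x cE gP).
  move: st; rewrite gt_max => /andP[t0 tdl].
  have tr : `|t - T| < dl by rewrite ltr0_norm ?subr_lt0//; lra.
  have := H t (ltW t0) tr; rewrite -tE.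
  have /andP[h1 h2] : 0 <= avgc N chat (x, t) <= 1.
    apply: (avg_range mk); first exact: measurable_fun_pair1 t mc.
    by apply: aeW => y; exact: c01.
  rewrite ler_norml => /andP[h3 h4]; apply/andP; split; lra.
apply/andP; split; apply/ler_addgt0Pr => e e0.
  by have /andP[h _] := key e e0; lra.
by have /andP[_ h] := key e e0.
Qed.

(** The representatives are measurable everywhere and take values in [0, 1], as
    the averages require. *)
Lemma solution_flow i (c0hat : X -> R) : itg tor c0hat ->
  {ae leb3 R, forall y, torus R y -> c0 i y = c0hat y} ->
  exists (chat : X * mR -> R) p J cT,
  [/\ wrep T (c i) (fun k z => weak_grad (c i) z 0 k) chat p, wflow T chat J c0hat cT,
      forall k, {ae leb4 R, forall z, cyl_set 0 T z -> flux c u i z 0 k = J k z} &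
      {ae leb3 R, forall y, torus R y -> c i (y, T) = cT y}].
Proof.
move=> c0i c0E; have [chat [mc c01 cE]] := density_reps.
have [J [J2 JE]] := flux_reps.
have [p pr] := gradient_rep i mc c01 cE J2 JE.
have [g gP] := slice_reps i; have [[mT T2] TE] := gP T (ltW T0).
have gT := slice_end_range (mc i) (c01 i) (cE i) gP.
exists (chat i), p, (J i), (fun y => unit_clamp (g T y)); split => //; last first.
  have [H _] := ae_restrP (@measurable_torus R) (@leb3_torus_fin R) (fun y => g T y = unit_clamp (g T y)).
  by apply: filterS2 TE (H gT) => y E1 E2 yT; rewrite E1// -E2.
split.
- by move=> k; have [] := J2 i k.
- by move=> k; have [] := J2 i k.
- by [].
- exact: measurable_unit_clamp.
- by move=> x; exact: unit_clamp_itv.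
- move=> N x eta eta' se se' de eT eT'.
  exact: (evolution (J := J i) N x (mc i) (c01 i) (cE i) (J2 i) (JE i) c0i c0E se se' de eT eT').
- move=> N x; exists (fun t => avg tor (kap3 N) (g t) x); split.
  + exact: slice_avg (cE i) gP.
  + move=> r /andP[r0 _] e e0; have [dl dl0 H] := slice_continuous N x (ltW r0) gP e0.
    exists dl => // t t0 h1 h2; apply: H; first exact: ltW.
    by rewrite ltr0_norm ?subr_lt0//; lra.
  + by apply: eq_Rintegral_ae; apply: filterS gT => y <-.
Qed.

End Solutions.

(** * The identity for one species *)

Section Species.
Variables (R : realType) (n : nat).
Notation mR := (measurableTypeR R).
Notation X := (mR * mR * mR)%type.
Notation tor := (tor R).
Notation cyl := (@cyl R).
Notation cyl_set := (@cyl_set R).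

#[local] Instance leb3_ae_filter' : Filter (nbhs (almost_everywhere (leb3 R))).
Proof. exact: ae_filter_ringOfSetsType. Qed.

#[local] Instance leb4_ae_filter'' : Filter (nbhs (almost_everywhere (leb4 R))).
Proof. exact: ae_filter_ringOfSetsType. Qed.

Lemma initial_rep (c0 : 'I_n -> R * R * R -> R) i : initial_data c0 ->
  exists2 c0hat : X -> R, itg tor c0hat &
    {ae leb3 R, forall y, torus R y -> c0 i y = c0hat y}.
Proof.
move=> [Lp ge0 sum1 _]; have [g mg gE] := in_Lp_measurable (Lp i).
exists (fun y => unit_clamp (g y)).
  apply: (itg_bounded (C := 1)); first exact: measurable_unit_clamp.
  by apply: aeW => y; have /andP[h1 h2] := unit_clamp_itv (g y); rewrite ger0_norm.
have all0 : {ae leb3 R, forall y, forall j, torus R y -> 0 <= c0 j y}.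
  by apply: filter_forall.
apply: filterS2 gE (filterI all0 sum1) => y E [p s] yT; rewrite -E// unit_clamp_id// p//=.
rewrite -(s yT) (bigD1 i)//= lerDl; apply: sumr_ge0 => j _; exact: p.
Qed.

Variables (D : 'I_n -> 'I_n -> R) (c0 : 'I_n -> R * R * R -> R).
Variables (c cb : 'I_n -> R * R * R * R -> R) (u ub : 'I_n -> R * R * R * R -> 'rV[R]_3).
Hypotheses (hc0 : initial_data c0) (hc : renormalized_solution D c0 c u)
  (hcb : renormalized_solution D c0 cb ub)
  (hc_rep : L2_continuous_in_time c) (hcb_rep : L2_continuous_in_time cb).
Variables (T : R) (T0 : 0 < T) (beta : R -> R) (hbeta : C2_half beta) (i : 'I_n).

Let pc k z := weak_grad (c i) z 0 k.
Let pcb k z := weak_grad (cb i) z 0 k.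

Lemma species_reps T' : 0 < T' -> exists c' p cb' pb,
  wrep T' (c i) pc c' p /\ wrep T' (cb i) pcb cb' pb.
Proof.
move=> T'0; have [c0hat c0i c0E] := initial_rep i hc0.
have [c' [p [_ [_ [r _ _ _]]]]] := solution_flow hc hc_rep T'0 c0i c0E.
have [cb' [pb [_ [_ [rb _ _ _]]]]] := solution_flow hcb hcb_rep T'0 c0i c0E.
by exists c', p, cb', pb.
Qed.

(** The weak gradient of a composition is unique, hence given by the chain
    rule. *)
Lemma weak_grad_chain (P P1 P2 : R * R -> R) (f : R * R * R * R -> R)
    (c' cb' : X * mR -> R) (p pb : 'I_3 -> X * mR -> R) :
  C1pair P P1 P2 ->
  {ae leb4 R, forall z, cylinder_oo R z -> P (c i z, cb i z) = f z} ->
  wrep T (c i) pc c' p -> wrep T (cb i) pcb cb' pb ->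
  weakly_differentiable f /\
  forall k, {ae leb4 R, forall z, cylinder T z ->
    weak_grad f z 0 k = P1 (c' z, cb' z) * p k z + P2 (c' z, cb' z) * pb k z}.
Proof.
move=> CP Pf r rb.
have W k : is_weak_deriv k f (chain (c i) (cb i) pc pcb P1 P2 k).
  apply: is_weak_deriv_ae Pf _ (chain_is_weak_deriv species_reps CP k).
  exact: aeW.
split=> k; first by exists (chain (c i) (cb i) pc pcb P1 P2 k).
have H := xgetPex (cst 0) (ex_intro _ _ (W k) : exists g, is_weak_deriv k f g).
have U := weak_deriv_unique T H (W k).
have [_ _ _ E] := comp_reps CP k r rb.
apply: filterS2 U E => z E1 E2 zD; rewrite mxE -(E2 zD); exact: E1 zD.
Qed.

Let f z := beta (c i z) - beta (cb i z).
Let g z := (c i z - cb i z) * half_deriv beta (c i z).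
Let gb z := (c i z - cb i z) * half_deriv beta (cb i z).
Let F x := (beta (c i (x, T)) - beta (cb i (x, T))) * (c i (x, T) - cb i (x, T)).
Let G z := dot (weak_grad f z) (flux c u i z - flux cb ub i z).
Let K z := dot (weak_grad g z) (flux c u i z) - dot (weak_grad gb z) (flux cb ub i z).

(** The abstract identity for (beta(a) - beta(b)) (a - b); each species
    satisfies the identity separately. *)
Lemma species_identity :
  ([/\ weakly_differentiable f, weakly_differentiable g & weakly_differentiable gb] /\
   [/\ in_Lp (leb3 R) 1%E (torus R) F, in_Lp (leb4 R) 1%E (cylinder T) G
     & in_Lp (leb4 R) 1%E (cylinder T) K]) /\
  \int[leb3 R]_(x in torus R) F x =
  \int[leb4 R]_(z in cylinder T) G z + \int[leb4 R]_(z in cylinder T) K z.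
Proof.
have [b0 [b1 [b2 [d0 d1 cb2 b0E b1E]]]] := C2_half_extension hbeta.
have CPf := C1pair_gap_f d0 d1; have CPg := C1pair_gap_g d1 cb2.
have CPh := C1pair_gap_h d1 cb2; have CP := C1pair_product d0 d1.
have [c0hat c0i c0E] := initial_rep i hc0.
have [c' [p [J [cT [r fl JE TE]]]]] := solution_flow hc hc_rep T0 c0i c0E.
have [cb' [pb [Jb [cbT [rb flb JbE TbE]]]]] := solution_flow hcb hcb_rep T0 c0i c0E.
have [[/(_ i)[_ rc] _] _ _ _] := hc; have [[/(_ i)[_ rcb] _] _ _ _] := hcb.
have fE : {ae leb4 R, forall z, cylinder_oo R z -> gap_f b0 (c i z, cb i z) = f z}.
  apply: filterS2 rc rcb => z H1 H2 zD.
  by have /andP[h1 _] := H1 zD; have /andP[h2 _] := H2 zD; rewrite /gap_f/= !b0E.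
have gE : {ae leb4 R, forall z, cylinder_oo R z -> gap_g b1 (c i z, cb i z) = g z}.
  apply: filterS2 rc rcb => z H1 H2 zD.
  by have /andP[h1 _] := H1 zD; rewrite /gap_g/= b1E.
have hE : {ae leb4 R, forall z, cylinder_oo R z -> gap_h b1 (c i z, cb i z) = gb z}.
  apply: filterS2 rc rcb => z H1 H2 zD.
  by have /andP[h2 _] := H2 zD; rewrite /gap_h/= b1E.
have [wf wfE] := weak_grad_chain CPf fE r rb.
have [wg wgE] := weak_grad_chain CPg gE r rb.
have [wh whE] := weak_grad_chain CPh hE r rb.
pose Gf k z := gap_f1 b1 (c' z, cb' z) * p k z + gap_f2 b1 (c' z, cb' z) * pb k z.
pose Gg k z := gap_g1 b1 b2 (c' z, cb' z) * p k z + gap_g2 b1 (c' z, cb' z) * pb k z.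
pose Gh k z := gap_h1 b1 (c' z, cb' z) * p k z + gap_h2 b1 b2 (c' z, cb' z) * pb k z.
have cp := wr_wgrad r; have cbp := wr_wgrad rb.
have pairL2 (Q Q1 Q2 : R * R -> R) k : C1pair Q Q1 Q2 ->
    L2 (cyl 0 T) (fun z => Q1 (c' z, cb' z) * p k z + Q2 (c' z, cb' z) * pb k z).
  move=> [_ _ cQ1 mQ1 cQ2 mQ2 _].
  have mcc := measurable_fun_pair (wg_m cp) (wg_m cbp).
  apply: L2D.
    have [C hC] := continuous_bounded_square 1 cQ1.
    apply: (L2_bM (C := C)).
    + exact: (measurableT_comp mQ1 mcc).
    + by move=> z; apply: hC; [exact: wg_norm cp z|exact: wg_norm cbp z].
    + by split; [exact: wg_pm cp k|exact: wg_p2 cp k].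
  have [C hC] := continuous_bounded_square 1 cQ2.
  apply: (L2_bM (C := C)).
  + exact: (measurableT_comp mQ2 mcc).
  + by move=> z; apply: hC; [exact: wg_norm cp z|exact: wg_norm cbp z].
  + by split; [exact: wg_pm cbp k|exact: wg_p2 cbp k].
have L2J k : L2 (cyl 0 T) (J k) by split; [exact: wf_m fl k|exact: wf_2 fl k].
have L2Jb k : L2 (cyl 0 T) (Jb k) by split; [exact: wf_m flb k|exact: wf_2 flb k].
have prod (a b : X * mR -> R) : L2 (cyl 0 T) a -> L2 (cyl 0 T) b ->
    itg (cyl 0 T) (fun z => a z * b z).
  by move=> [ma a2] [mb bb2]; exact: itg_sqrM.
have fJ k := prod _ _ (pairL2 _ _ _ k CPf) (L2J k).
have fJb k := prod _ _ (pairL2 _ _ _ k CPf) (L2Jb k).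
have gJ k := prod _ _ (pairL2 _ _ _ k CPg) (L2J k).
have hJb k := prod _ _ (pairL2 _ _ _ k CPh) (L2Jb k).
have Gi : itg (cyl 0 T) (fun z => \sum_(k < 3) (Gf k z * J k z - Gf k z * Jb k z)).
  by apply: itg_sum => k; exact: itgB (fJ k) (fJb k).
have Ki : itg (cyl 0 T) (fun z => \sum_(k < 3) (Gg k z * J k z - Gh k z * Jb k z)).
  by apply: itg_sum => k; exact: itgB (gJ k) (hJb k).
have allk (Q : 'I_3 -> R * R * R * R -> Prop) :
    (forall k, {ae leb4 R, forall z, cyl_set 0 T z -> Q k z}) ->
    {ae leb4 R, forall z, forall k, cyl_set 0 T z -> Q k z}.
  by move=> H; apply: filter_forall.
have GE : {ae leb4 R, forall z, cyl_set 0 T z ->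
    G z = \sum_(k < 3) (Gf k z * J k z - Gf k z * Jb k z)}.
  apply: filterS2 (allk _ wfE) (filterI (allk _ JE) (allk _ JbE)) => z H1 [H2 H3] zD.
  rewrite /G /dot; apply: eq_bigr => k _.
  by rewrite (H1 k zD) -(H2 k zD) -(H3 k zD) /Gf !mxE; ring.
have KE : {ae leb4 R, forall z, cyl_set 0 T z ->
    K z = \sum_(k < 3) (Gg k z * J k z - Gh k z * Jb k z)}.
  apply: filterS2 (filterI (allk _ wgE) (allk _ whE)) (filterI (allk _ JE) (allk _ JbE))
    => z [H1 H1'] [H2 H3] zD.
  rewrite /K /dot -sumrB; apply: eq_bigr => k _.
  by congr (_ * _ - _ * _); [exact: H1 k zD|exact: H2 k zD|exact: H1' k zD|exact: H3 k zD].
have [cP mP _ _ _ _ _] := CP.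
have normT (a : X -> R) : (forall x, 0 <= a x <= 1) -> forall x, `|a x| <= 1.
  by move=> H x; have /andP[h1 h2] := H x; rewrite ger0_norm.
have Fi : itg tor (fun x => gap_f b0 (cT x, cbT x) * (cT x - cbT x)).
  have [C hC] := continuous_bounded_square 1 cP.
  apply: (itg_bounded (C := C)).
    exact: (measurableT_comp mP (measurable_fun_pair (wf_T fl) (wf_T flb))).
  apply: aeW => x.
  exact: (hC _ _ (normT _ (wf_Trange fl) x) (normT _ (wf_Trange flb) x)).
have FE : {ae leb3 R, forall x, torus R x ->
    F x = gap_f b0 (cT x, cbT x) * (cT x - cbT x)}.
  apply: filterS2 TE TbE => x H1 H2 xT; rewrite /F H1// H2// /gap_f/=.
  have /andP[h1 _] := wf_Trange fl x; have /andP[h2 _] := wf_Trange flb x.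
  by rewrite !b0E.
split.
  split; first by split.
  split; [exact: itg_in_L1 Fi FE|exact: itg_in_L1 Gi GE|exact: itg_in_L1 Ki KE].
have -> := Rint_ae_restr (@measurable_torus R) (@leb3_torus_fin R) (itgM Fi) FE.
have -> := Rint_ae_restr (measurable_cyl 0 T) (leb4_cyl_fin 0 T) (itgM Gi) GE.
have -> := Rint_ae_restr (measurable_cyl 0 T) (leb4_cyl_fin 0 T) (itgM Ki) KE.
have id1 := flow_identity T0 cp cbp fl flb CP (C1pairD CPf CPg) (C1pairN (C1pairD CPf CPh)).
have diag a : gap_f b0 (a, a) * ((a, a).1 - (a, a).2) = 0 by rewrite /= subrr mulr0.
have {}id1 := id1 diag.
transitivity (\int[tor]_x (gap_f b0 (cT x, cbT x) * (cT x - cbT x))); first by [].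
rewrite {}id1.
have e1 k : \int[cyl 0 T]_z (((gap_f1 b1 (c' z, cb' z) + gap_g1 b1 b2 (c' z, cb' z)) * p k z +
     (gap_f2 b1 (c' z, cb' z) + gap_g2 b1 (c' z, cb' z)) * pb k z) * J k z) =
    \int[cyl 0 T]_z (Gf k z * J k z) + \int[cyl 0 T]_z (Gg k z * J k z).
  rewrite -(RintD (fJ k) (gJ k)); apply: eq_Rintegral => z _; rewrite /Gf /Gg; ring.
have e2 k : \int[cyl 0 T]_z ((- (gap_f1 b1 (c' z, cb' z) + gap_h1 b1 (c' z, cb' z)) * p k z +
     - (gap_f2 b1 (c' z, cb' z) + gap_h2 b1 b2 (c' z, cb' z)) * pb k z) * Jb k z) =
    - (\int[cyl 0 T]_z (Gf k z * Jb k z) + \int[cyl 0 T]_z (Gh k z * Jb k z)).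
  rewrite -(RintD (fJb k) (hJb k)) -RintN; last exact: itgD (fJb k) (hJb k).
  apply: eq_Rintegral => z _; rewrite /Gf /Gh; ring.
rewrite (eq_bigr _ (fun k _ => e1 k)) (eq_bigr _ (fun k _ => e2 k)).
rewrite (Rint_sum _ (fun k => itgB (fJ k) (fJb k))) (Rint_sum _ (fun k => itgB (gJ k) (hJb k))).
rewrite (eq_bigr _ (fun k _ => RintB (fJ k) (fJb k))).
rewrite (eq_bigr _ (fun k _ => RintB (gJ k) (hJb k))).
rewrite -!big_split/=; apply: eq_bigr => k _; ring.
Qed.

End Species.

Theorem theorem4 (R : realType) (n : nat) (hn : (2 <= n)%N)
    (D : 'I_n -> 'I_n -> R) (hD : diffusivities D)
    (c0 : 'I_n -> R * R * R -> R) (hc0 : initial_data c0)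
    (c cb : 'I_n -> R * R * R * R -> R)
    (u ub : 'I_n -> R * R * R * R -> 'rV[R]_3)
    (hc : renormalized_solution D c0 c u)
    (hcb : renormalized_solution D c0 cb ub)
    (hc_rep : L2_continuous_in_time c)
    (hcb_rep : L2_continuous_in_time cb)
    (T : R) (hT : 0 < T) (beta : R -> R) (hbeta : C2_half beta) :
  let beta' := half_deriv beta in
  let J := flux c u in
  let Jb := flux cb ub in
  let F i := fun x : R * R * R =>
    (beta (c i (x, T)) - beta (cb i (x, T))) * (c i (x, T) - cb i (x, T)) in
  let f i := fun z => beta (c i z) - beta (cb i z) in
  let g i := fun z => (c i z - cb i z) * beta' (c i z) in
  let gb i := fun z => (c i z - cb i z) * beta' (cb i z) in
  let G i := fun z => dot (weak_grad (f i) z) (J i z - Jb i z) in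
  let K i := fun z =>
    dot (weak_grad (g i) z) (J i z) - dot (weak_grad (gb i) z) (Jb i z) in
  (forall i,
     [/\ weakly_differentiable (f i), weakly_differentiable (g i)
       & weakly_differentiable (gb i)] /\
     [/\ in_Lp (leb3 R) 1%E (torus R) (F i),
         in_Lp (leb4 R) 1%E (cylinder T) (G i)
       & in_Lp (leb4 R) 1%E (cylinder T) (K i)]) /\
  \sum_(i < n) \int[leb3 R]_(x in torus R) F i x =
    \sum_(i < n) \int[leb4 R]_(z in cylinder T) G i z
  + \sum_(i < n) \int[leb4 R]_(z in cylinder T) K i z.
Proof.
move=> beta' J Jb F f g gb G K.
have H i := species_identity hc0 hc hcb hc_rep hcb_rep hT hbeta i.
split=> [i|]; first by have [] := H i.
by rewrite -big_split; apply: eq_bigr => i _; have [_] := H i.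
Qed.
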